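(* Let $(b,c)$ be a graph over a discrete measure space $(X,m)$ and let $d$ be an intrinsic metric for $b$ on $(X,m)$ with finite jump size. Assume that the graph has uniform subexponential growth with respect to $d$. Then for every $p\in[1,\infty]$, $$\sigma(L_p)=\sigma(L_2).$$
   Context: Graphs. $X$ is a countable set with the discrete topology, $m:X\to(0,\infty)$, and $m(A)=\sum_{x\in A}m(x)$ for $A\subseteq X$. A graph over $(X,m)$ is a pair $(b,c)$ with $c:X\to[0,\infty)$ and $b:X\times X\to[0,\infty)$ symmetric, with zero diagonal, and $\sum_{y\in X}b(x,y)<\infty$ for all $x\in X$. Write $x\sim y$ if $b(x,y)>0$ (then $x,y$ are called neighbors). It is assumed that every vertex has at least one neighbor. The graph is not assumed to be locally finite. Metrics and growth. A pseudo metric is a function $d:X\times X\to[0,\infty)$ that is symmetric, has zero diagonal and satisfies the triangle inequality. A pseudo metric $d$ is called an intrinsic metric for $b$ on $(X,m)$ if $\sum_{y\in X}b(x,y)d(x,y)^2\le m(x)$ for all $x\in X$. Its jump size is $s=\sup\{d(x,y): x\sim y\}$. Balls are $B_r(x)=\{y\in X: d(x,y)\le r\}$. The graph has uniform subexponential growth (with respect to $d$) if for every $\varepsilon>0$ there is $C_\varepsilon>0$ with $m(B_r(x))\le C_\varepsilon e^{\varepsilon r}m(x)$ for all $x\in X$, $r\ge0$. Operators. $\ell^p=\ell^p(X,m)$, $p\in[1,\infty]$, are the complex $\ell^p$-spaces with norms $\|f\|_p=(\sum_x|f(x)|^pm(x))^{1/p}$ for $p<\infty$ and $\|f\|_\infty=\sup_x|f(x)|$.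 $C_c(X)$ is the space of finitely supported complex functions. Let $$Q(f,g)=\frac12\sum_{x,y\in X}b(x,y)(f(x)-f(y))\overline{(g(x)-g(y))}+\sum_{x\in X}c(x)f(x)\overline{g(x)},$$ with domain $D(Q)$ the closure of $C_c(X)$ with respect to $\|f\|_Q=(Q(f,f)+\|f\|_2^2)^{1/2}$. This is a regular Dirichlet form on $\ell^2(X,m)$; $L=L_2$ is the associated positive selfadjoint operator, which acts as $Lf(x)=\frac1{m(x)}\sum_{y}b(x,y)(f(x)-f(y))+\frac{c(x)}{m(x)}f(x)$. The semigroup $T_t=e^{-tL}$, $t\ge0$, extends consistently to contraction semigroups on all $\ell^p$, $p\in[1,\infty]$, strongly continuous for $p<\infty$. For $p\in[1,\infty)$, $L_p$ denotes the generator on $\ell^p$ with the sign convention $T_t=e^{-tL_p}$, and $L_\infty:=L_1^*$ is the dual operator of $L_1$ on $\ell^\infty$. $\sigma(L_p)$ denotes the spectrum of $L_p$ on $\ell^p$. *)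

(* Defs.v *)
From HB Require Import structures.
From mathcomp Require Import all_boot all_order all_algebra.
From mathcomp Require Import complex.
From mathcomp Require Import all_classical all_reals all_analysis.

Set Implicit Arguments.
Unset Strict Implicit.
Unset Printing Implicit Defensive.
Import Order.TTheory GRing.Theory Num.Theory.
Import numFieldNormedType.Exports.

Local Open Scope classical_set_scope.
Local Open Scope complex_scope.
Local Open Scope ring_scope.

(* Modulus as an element of R: `|z| lives in R[i], with zero imaginary part. *)
Definition cmod (R : realType) (z : R[i]) : R := complex.Re `|z|.

(* Unordered sums of real and complex families.  They have the expected value
   for absolutely summable families and a junk value otherwise; they are only
   used on families that are absolutely summable by Cauchy-Schwarz or Hoelder. *)
Definition rsum (R : realType) (I : choiceType) (F : I -> R) : R :=
  fine (\esum_(i in [set: I]) (Num.max (F i) 0)%:E) -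
  fine (\esum_(i in [set: I]) (Num.max (- F i) 0)%:E).

Definition csum (R : realType) (I : choiceType) (F : I -> R[i]) : R[i] :=
  rsum (fun i => complex.Re (F i)) +i* rsum (fun i => complex.Im (F i)).

Record graph (R : realType) (X : countType) := Graph {
  edge_weight : X -> X -> R ;
  killing : X -> R ;
  edge_weight_ge0 : forall x y, 0 <= edge_weight x y ;
  edge_weight_sym : forall x y, edge_weight x y = edge_weight y x ;
  edge_weight_diag : forall x, edge_weight x x = 0 ;
  edge_weight_summable : forall x,
    (\esum_(y in [set: X]) (edge_weight x y)%:E < +oo)%E ;
  killing_ge0 : forall x, 0 <= killing x
}.

Section Graphs.
Variables (R : realType) (X : countType).
Implicit Types (m : X -> R) (G : graph R X) (d : X -> X -> R).

Definition adjacent G x y : Prop := 0 < edge_weight G x y.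

Definition no_isolated_vertex G : Prop := forall x, exists y, adjacent G x y.

Definition vol m (A : set X) : \bar R := \esum_(x in A) (m x)%:E.

Definition pseudo_metric d : Prop :=
  [/\ forall x y, 0 <= d x y,
      forall x y, d x y = d y x,
      forall x, d x x = 0 &
      forall x y z, d x z <= d x y + d y z].

Definition intrinsic_metric m G d : Prop :=
  pseudo_metric d /\
  forall x, (\esum_(y in [set: X]) (edge_weight G x y * d x y ^+ 2)%:E
             <= (m x)%:E)%E.

Definition jump_size G d : \bar R :=
  ereal_sup [set z | exists x y, adjacent G x y /\ z = (d x y)%:E].

Definition dball d (x : X) (r : R) : set X := [set y | d x y <= r].

Definition uniform_subexponential_growth m d : Prop :=
  forall eps : R, 0 < eps -> exists2 C : R, 0 < C &
    forall (x : X) (r : R), 0 <= r ->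
      (vol m (dball d x r) <= (C * expR (eps * r) * m x)%:E)%E.

End Graphs.

Section LpSpaces.
Variables (R : realType) (X : countType) (m : X -> R).
Local Notation fn := (X -> R[i]).
Implicit Types (p : \bar R) (f g h : fn).

(* Only used for 1 <= p; the value at -oo is irrelevant. *)
Definition lp_norm p f : \bar R :=
  match p with
  | r%:E => poweR (\esum_(x in [set: X]) (cmod (f x) `^ r * m x)%:E) r^-1
  | +oo => ereal_sup [set z | exists x, z = (cmod (f x))%:E]
  | -oo => 0
  end%E.

Definition lp p : set fn := [set f | (lp_norm p f < +oo)%E].

Definition inner f g : R[i] := csum (fun x => f x * (g x)^* * (m x)%:C).

(* The bilinear duality between l^1 and l^oo. *)
Definition pairing f g : R[i] := csum (fun x => f x * g x * (m x)%:C).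

Definition Cc : set fn := [set f | finite_set [set x | f x != 0]].

(* An unbounded operator is given by its graph: A (f, g) means that f is in the
   domain of A and A f = g. *)
Definition operator := set (fn * fn).

Definition resolvent_set p (A : operator) : set R[i] :=
  [set lam |
    (forall h, lp p h ->
       exists! f, A (f, fun x => h x + lam * f x)) /\
    (exists M : R, forall f g, A (f, g) ->
       (lp_norm p f <= M%:E * lp_norm p (fun x => g x - lam * f x)%R)%E)].

Definition spectrum p (A : operator) : set R[i] := ~` resolvent_set p A.

(* Only the values T t f with 0 <= t and f in l^p are meaningful. *)
Record contraction_semigroup p (T : R -> fn -> fn) : Prop := {
  semigroup_linear : forall t (a : R[i]) f g, 0 <= t -> lp p f -> lp p g ->
    T t (fun x => a * f x + g x) = (fun x => a * T t f x + T t g x) ;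
  semigroup_contr : forall t f, 0 <= t -> lp p f ->
    (lp_norm p (T t f) <= lp_norm p f)%E ;
  semigroup0 : forall f, lp p f -> T 0 f = f ;
  semigroupD : forall s t f, 0 <= s -> 0 <= t -> lp p f ->
    T (s + t) f = T s (T t f)
}.

Definition strongly_continuous p (T : R -> fn -> fn) : Prop :=
  forall f, lp p f ->
    lp_norm p (fun x => T t f x - f x) @[t --> (0 : R)^'+] --> (0 : \bar R)%E.

(* The generator A with the sign convention T t = exp (- t A). *)
Definition generator p (T : R -> fn -> fn) : operator :=
  [set fg | [/\ lp p fg.1, lp p fg.2 &
    lp_norm p (fun x => (t^-1)%:C * (fg.1 x - T t fg.1 x) - fg.2 x)
      @[t --> (0 : R)^'+] --> (0 : \bar R)%E]].

(* The dual, acting in l^oo, of a densely defined operator in l^1. *)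
Definition dual_operator (A : operator) : operator :=
  [set fg | [/\ lp +oo%E fg.1, lp +oo%E fg.2 &
    forall u v, A (u, v) -> pairing v fg.1 = pairing u fg.2]].

End LpSpaces.

Section Laplacians.
Variables (R : realType) (X : countType) (m : X -> R) (G : graph R X).
Local Notation fn := (X -> R[i]).
Local Notation b := (edge_weight G).
Local Notation c := (killing G).
Implicit Types (f g h : fn).

Definition qform f g : R[i] :=
  2^-1 * csum (fun xy : X * X =>
      (b xy.1 xy.2)%:C * (f xy.1 - f xy.2) * (g xy.1 - g xy.2)^*) +
  csum (fun x => (c x)%:C * f x * (g x)^*).

(* Q(f, f) with its correct value, possibly +oo, for every f. *)
Definition energy f : \bar R :=
  ((2^-1)%:E * \esum_(xy in [set: X * X])
      (b xy.1 xy.2 * cmod (f xy.1 - f xy.2)%R ^+ 2)%:E +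
   \esum_(x in [set: X]) (c x * cmod (f x) ^+ 2)%:E)%E.

Definition form_norm f : \bar R :=
  poweR (energy f + poweR (lp_norm m 2%:E f) 2)%E 2^-1.

Definition form_domain : set fn :=
  [set f | [/\ lp m 2%:E f, (energy f < +oo)%E &
    forall eps : R, 0 < eps ->
      exists2 phi, Cc phi & (form_norm (fun x => f x - phi x)%R < eps%:E)%E]].

(* The operator associated with the closed form (qform, form_domain). *)
Definition laplacian2 : operator R X :=
  [set fg | [/\ form_domain fg.1, lp m 2%:E fg.2 &
    forall h, form_domain h -> qform fg.1 h = inner m fg.2 h]].

(* T t = exp (- t L) on l^2, i.e. T is the C_0-semigroup generated by - L. *)
Definition heat_semigroup (T : R -> fn -> fn) : Prop :=
  [/\ contraction_semigroup m 2%:E T,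
      strongly_continuous m 2%:E T &
      generator m 2%:E T = laplacian2].

(* S is the consistent extension to l^p of the semigroup T on l^2; for finite p
   it is unique, because the intersection of l^2 and l^p is dense in l^p. *)
Definition lp_extension (p : \bar R) (T S : R -> fn -> fn) : Prop :=
  [/\ contraction_semigroup m p S,
      strongly_continuous m p S &
      forall t f, 0 <= t -> lp m 2%:E f -> lp m p f -> S t f = T t f].

Definition lp_generator (p : \bar R) : operator R X :=
  [set fg | exists T S,
    [/\ heat_semigroup T, lp_extension p T S & generator m p S fg]].

(* L_p for 1 <= p <= +oo; the value at -oo is irrelevant. *)
Definition laplacian (p : \bar R) : operator R X :=
  match p with
  | r%:E => lp_generator r%:E
  | +oo => dual_operator m (lp_generator 1%:E)
  | -oo => set0
  end%E.

End Laplacians.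

(* Main.v *)
(* For [z] outside the l^2-spectrum, the resolvent kernel of [L_2] decays like
   [exp (- eps d(x, y)) / sqrt (m x * m y)] (Combes-Thomas: conjugate [Q - z] by a bounded
   weight [exp (eps min(d, N))]; since [d] is intrinsic with finite jump size this is a small
   perturbation for small [eps]). Subexponential growth makes this kernel summable in each
   variable, so by the Schur test it acts on every l^p, and it is the resolvent of [L_p]
   there: the range of the kernel lies in the domain by Duhamel's formula, [L_p + 1] is
   injective by dissipativity, and the resolvent identity carries this over to [L_p - z].
   Hence the spectrum of [L_p] is contained in that of [L_2].
   Conversely, nonreal points are not in the l^2-spectrum. If a real [lam] is not in the
   l^p-spectrum, the kernels at [z = lam + i eps] are bounded on l^p by a constant [2 M]
   independent of [eps]; as [(L_2 - z)^-1] is normal, the symmetrization argument of Lax bounds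
   it by [2 M] on l^2 as well, and letting [eps] be small places [lam] outside the
   l^2-spectrum. *)
Require Import Defs.
From HB Require Import structures.
From mathcomp Require Import all_boot all_order all_algebra.
From mathcomp Require Import complex.
From mathcomp Require Import all_classical all_reals all_analysis.
From mathcomp Require Import ring lra.

Set Implicit Arguments.
Unset Strict Implicit.
Unset Printing Implicit Defensive.
Import Order.TTheory GRing.Theory Num.Theory.
Import numFieldNormedType.Exports.

Local Open Scope classical_set_scope.
Local Open Scope complex_scope.
Local Open Scope ring_scope.

(** * Unordered sums *)

(** Two consistency problems shape the argument. [lp_generator] quantifies over all heat semigroups
    and all consistent extensions, so both must be shown to exist, and every statement about a
    generator must hold for an arbitrary choice of them. The way out is a description of the graph
    of [L_p] that mentions no semigroup: once a resolvent kernel [k] at some [z] is known,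
    [L_p f = g] means [f = k (g - z f)], for all p alike ([laplacianP]). The base point is [z = -1],
    where truncation of minimizers makes the kernel of [(1 + L)^-1] a contraction on every l^p.
    Secondly, a resolvent of [L_p] at a real point has a priori no relation to l^2; at nearby
    nonreal points both resolvents are given by one kernel, which is why the converse inclusion
    passes through them. Finally, without local finiteness a finitely supported function need not
    lie in the domain of [L], so such functions are used in the form domain only, and dense
    subspaces of the domain are reached through resolvents. *)

Section Modulus.
Variable R : realType.
Implicit Types (z w : R[i]) (a b : R).

Lemma cmodC z : (cmod z)%:C = `|z|.
Proof. by rewrite /cmod normc_def. Qed.

Lemma cmod_ge0 z : 0 <= cmod z.
Proof. by rewrite /cmod normc_def /= sqrtr_ge0. Qed.

Lemma cmodM z w : cmod (z * w) = cmod z * cmod w.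
Proof. by apply: complexI; rewrite rmorphM /= !cmodC normrM. Qed.

Lemma cmodD z w : cmod (z + w) <= cmod z + cmod w.
Proof. by rewrite -lecR rmorphD /= !cmodC ler_normD. Qed.

Lemma cmodN z : cmod (- z) = cmod z.
Proof. by rewrite /cmod normrN. Qed.

Lemma cmodB z w : cmod (z - w) <= cmod z + cmod w.
Proof. by rewrite (le_trans (cmodD _ _))// cmodN. Qed.

Lemma cmod_distC z w : cmod (z - w) = cmod (w - z).
Proof. by rewrite -cmodN opprB. Qed.

Lemma cmod_dist_trans u z w : cmod (z - w) <= cmod (z - u) + cmod (u - w).
Proof. by rewrite (le_trans _ (cmodD _ _))// addrA subrK. Qed.

Lemma cmod0 : cmod (0 : R[i]) = 0.
Proof. by rewrite /cmod normr0. Qed.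

Lemma cmod1 : cmod (1 : R[i]) = 1.
Proof. by rewrite /cmod normr1. Qed.

Lemma cmod_eq0 z : cmod z = 0 -> z = 0.
Proof. by move=> z0; apply/eqP; rewrite -normr_eq0 -cmodC z0. Qed.

Lemma cmod_real a : cmod a%:C = `|a|.
Proof. by rewrite /cmod normc_def /= expr0n addr0 sqrtr_sqr. Qed.

Lemma cmod_conj z : cmod z^* = cmod z.
Proof. by rewrite /cmod normcJ. Qed.

Lemma cmodV z : cmod z^-1 = (cmod z)^-1.
Proof. by apply: complexI; rewrite fmorphV /= !cmodC normfV. Qed.

Lemma cmod_sqr z : cmod z ^+ 2 = complex.Re z ^+ 2 + complex.Im z ^+ 2.
Proof. by rewrite /cmod normc_def /= sqr_sqrtr// addr_ge0 ?sqr_ge0. Qed.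

Lemma mulcJ z : z * z^* = (cmod z ^+ 2)%:C.
Proof. by rewrite -sqr_normc rmorphXn /= cmodC. Qed.

Lemma Re_le_cmod z : `|complex.Re z| <= cmod z.
Proof. by rewrite -lecR cmodC normc_ge_Re. Qed.

Lemma Im_le_cmod z : `|complex.Im z| <= cmod z.
Proof.
rewrite -(ler_pXn2r (ltn0Sn 1)) ?nnegrE ?cmod_ge0// cmod_sqr -normrX ger0_norm ?sqr_ge0//.
by rewrite lerDr sqr_ge0.
Qed.

Lemma cmod_le_ReIm z : cmod z <= `|complex.Re z| + `|complex.Im z|.
Proof.
rewrite -(ler_pXn2r (ltn0Sn 1)) ?nnegrE ?cmod_ge0 ?addr_ge0// cmod_sqr sqrrD.
by rewrite !real_normK ?num_real// lerD2r lerDl mulrn_wge0// mulr_ge0.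
Qed.

Lemma cmod_le0 z : (forall e : R, 0 < e -> cmod z <= e) -> z = 0.
Proof.
move=> h; apply: cmod_eq0; apply/eqP; rewrite eq_le cmod_ge0 andbT.
by apply/ler_addgt0Pr => e e0; rewrite add0r h.
Qed.

Lemma cmod_sum (I : Type) (s : seq I) (F : I -> R[i]) :
  cmod (\sum_(i <- s) F i) <= \sum_(i <- s) cmod (F i).
Proof.
elim: s => [|i s IH]; first by rewrite !big_nil cmod0.
by rewrite !big_cons (le_trans (cmodD _ _))// lerD2l.
Qed.

Lemma cmod_dist z w : cmod z <= cmod w + cmod (z - w).
Proof. by rewrite (le_trans _ (cmodD _ _))// addrC subrK. Qed.

Lemma ReD z w : complex.Re (z + w) = complex.Re z + complex.Re w.
Proof. by case: z; case: w. Qed.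

Lemma ReN z : complex.Re (- z) = - complex.Re z.
Proof. by case: z. Qed.

Lemma ReB z w : complex.Re (z - w) = complex.Re z - complex.Re w.
Proof. by rewrite ReD ReN. Qed.

Lemma Re_conj z : complex.Re z^* = complex.Re z.
Proof. by case: z. Qed.

Lemma conj_realC a : (a%:C)^* = a%:C :> R[i].
Proof. by apply/eqP; rewrite eq_complex /= oppr0 !eqxx. Qed.

(** Such multipliers turn a bound tested against functions of modulus at most 1 into a bound on a
    sum of absolute values ([op_schur]). At [z = 0] the multiplier chosen is 0, hence an inequality
    for [cmod u]. *)
Lemma phase z : exists2 u, cmod u <= 1 & u * z = (cmod z)%:C.
Proof.
have [->|z0] := eqVneq z 0; first by exists 0; rewrite ?mulr0 cmod0 ?ler01.
have m0 : cmod z != 0 by apply: contra_neq z0 => /cmod_eq0.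
exists (z^* / (cmod z)%:C); first by rewrite cmodM cmodV cmod_conj cmod_real ger0_norm ?cmod_ge0// divff.
rewrite mulrAC mulrC [z^* * z]mulrC mulcJ rmorphXn /= expr2 mulKf//.
by apply: contra_neq m0 => /complexI.
Qed.

End Modulus.

Lemma sub_undup_catl (I : eqType) (s t r : seq I) :
  {subset undup (s ++ t) <= r} -> {subset s <= r}.
Proof. by move=> h i hi; apply: h; rewrite mem_undup mem_cat hi. Qed.

Lemma sub_undup_catr (I : eqType) (s t r : seq I) :
  {subset undup (s ++ t) <= r} -> {subset t <= r}.
Proof. by move=> h i hi; apply: h; rewrite mem_undup mem_cat hi orbT. Qed.

Section FiniteBounds.
Variables (R : realType) (I : choiceType).
Implicit Types (F H : I -> R) (A B : R).

(** A real-valued substitute for an upper bound on [esum], equivalent to it for nonnegative families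
    ([sbdP]). Arguments about infinite sums reduce to finite sums over duplicate-free lists, without
    extended reals. *)
Definition sbd F A := forall s : seq I, uniq s -> \sum_(i <- s) F i <= A.

Lemma sbd_ge0 F A : sbd F A -> 0 <= A.
Proof. by move=> /(_ [::] isT); rewrite big_nil. Qed.

Lemma sbd1 F A i : sbd F A -> F i <= A.
Proof. by move=> /(_ [:: i] isT); rewrite big_seq1. Qed.

Lemma sbd_le F H A B : (forall i, F i <= H i) -> A <= B -> sbd H A -> sbd F B.
Proof. by move=> FH AB h s us; rewrite (le_trans _ AB)// (le_trans _ (h s us))// ler_sum. Qed.

Lemma sbdD F H A B : sbd F A -> sbd H B -> sbd (fun i => F i + H i) (A + B).
Proof. by move=> f h s us; rewrite big_split lerD ?f ?h. Qed.

Lemma sbdZ F A c : 0 <= c -> sbd F A -> sbd (fun i => c * F i) (c * A).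
Proof. by move=> c0 f s us; rewrite -mulr_sumr ler_wpM2l ?f. Qed.

Lemma sbd_inf F A : (forall e : R, 0 < e -> sbd F (A + e)) -> sbd F A.
Proof. by move=> h s us; apply/ler_addgt0Pr => e e0; apply: h. Qed.

Lemma sbdP F A : (forall i, 0 <= F i) ->
  ((\esum_(i in [set: I]) (F i)%:E <= A%:E)%E <-> sbd F A).
Proof.
move=> F0; split=> [h s us|h].
  rewrite -lee_fin (le_trans _ h)//; apply: esum_ge; exists [set` s].
    by split => //; exact: finite_seq.
  by rewrite -fsbig_seq// -sumEFin.
apply: ge_ereal_sup => _ [S [finS _] <-].
rewrite fsbig_finite//= sumEFin lee_fin; exact/h/finmap.fset_uniq.
Qed.

Lemma sbd_fin F : (forall i, 0 <= F i) ->
  ((\esum_(i in [set: I]) (F i)%:E < +oo)%E <-> exists A, sbd F A).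
Proof.
move=> F0; split=> [h|[A /sbdP-/(_ F0)]]; last by move=> h; rewrite (le_lt_trans h)// ltry.
exists (fine (\esum_(i in [set: I]) (F i)%:E)); apply/sbdP => //.
by rewrite fineK// ge0_fin_numE// esum_ge0// => i _; rewrite lee_fin.
Qed.

Lemma sbd_fine F A : (forall i, 0 <= F i) -> sbd F A ->
  sbd F (fine (\esum_(i in [set: I]) (F i)%:E)).
Proof.
move=> F0 h; apply/sbdP => //; rewrite fineK// ge0_fin_numE ?esum_ge0//.
  by apply/(sbd_fin F0); exists A.
by move=> i _; rewrite lee_fin.
Qed.

Lemma sbd_sup F A e : (forall i, 0 <= F i) -> sbd F A -> 0 < e ->
  exists2 s, uniq s & fine (\esum_(i in [set: I]) (F i)%:E) - e < \sum_(i <- s) F i.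
Proof.
move=> F0 h e0; apply/not_exists2P => nh.
have : sbd F (fine (\esum_(i in [set: I]) (F i)%:E) - e).
  by move=> s us; have [//|] := nh s; move/negP; rewrite -leNgt.
move/(sbdP _ F0); have : sbd F (fine (\esum_(i in [set: I]) (F i)%:E)) by exact: sbd_fine h.
move=> /sbd_ge0 g0.
have -> : \esum_(i in [set: I]) (F i)%:E = (fine (\esum_(i in [set: I]) (F i)%:E))%:E.
  rewrite fineK// ge0_fin_numE ?esum_ge0//.
    by apply/(sbd_fin F0); exists A.
  by move=> i _; rewrite lee_fin.
by rewrite /= lee_fin; lra.
Qed.

Lemma ler_sum_subset F (s t : seq I) : (forall i, 0 <= F i) ->
  uniq s -> {subset s <= t} -> \sum_(i <- s) F i <= \sum_(i <- t) F i.
Proof.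
move=> F0; elim: s t => [|i s IH] t /=; first by rewrite big_nil sumr_ge0.
move=> /andP[iNs us] st; have it : i \in t by rewrite st ?inE ?eqxx.
rewrite (perm_big _ (perm_to_rem it)) !big_cons lerD2l IH// => j js.
have := st j; rewrite inE js orbT => /(_ isT); rewrite (perm_mem (perm_to_rem it)) inE.
by case/orP => // /eqP ji; move: iNs; rewrite -ji js.
Qed.

End FiniteBounds.

Section ComplexSums.
Variables (R : realType) (I : choiceType).
Implicit Types (F H : I -> R[i]) (A B : R).

(** Convergence along the net of finite sets. Limits are unique, so a [csum] is computed by
    exhibiting a limit; the definition through positive and negative parts serves only to establish
    convergence. *)
Definition csums F (l : R[i]) := forall e : R, 0 < e ->
  exists2 s : seq I, uniq s & forall t, uniq t -> {subset s <= t} ->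
    cmod (\sum_(i <- t) F i - l) <= e.

Variant asum F : Prop := Asum A of sbd (fun i => cmod (F i)) A.

Lemma rsum_net (F : I -> R) A : sbd (fun i => `|F i|) A -> forall e : R, 0 < e ->
  exists2 s : seq I, uniq s & forall t, uniq t -> {subset s <= t} ->
    `|\sum_(i <- t) F i - rsum F| <= e.
Proof.
move=> FA e e0; have e20 : 0 < e / 2 by rewrite divr_gt0.
have p0 i : 0 <= Num.max (F i) 0 by rewrite le_max lexx orbT.
have n0 i : 0 <= Num.max (- F i) 0 by rewrite le_max lexx orbT.
have FE i : F i = Num.max (F i) 0 - Num.max (- F i) 0.
  by rewrite !maxEle; case: (ltgtP (F i) 0); case: (ltgtP (- F i) 0) => ? ?; lra.
have pA : sbd (fun i => Num.max (F i) 0) A.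
  by apply: sbd_le FA => // i; rewrite ge_max ler_norm normr_ge0.
have nA : sbd (fun i => Num.max (- F i) 0) A.
  by apply: sbd_le FA => // i; rewrite ge_max -normrN ler_norm normr_ge0.
have [s1 us1 h1] := sbd_sup p0 pA e20.
have [s2 us2 h2] := sbd_sup n0 nA e20.
exists (undup (s1 ++ s2)); first exact: undup_uniq.
move=> t ut st; rewrite (eq_bigr (fun i => Num.max (F i) 0 - Num.max (- F i) 0)) => [|i _]; last exact: FE.
rewrite sumrB /rsum.
have l1 := le_trans (ltW h1) (ler_sum_subset p0 us1 (sub_undup_catl st)).
have l2 := le_trans (ltW h2) (ler_sum_subset n0 us2 (sub_undup_catr st)).
have u1 := sbd_fine p0 pA ut; have u2 := sbd_fine n0 nA ut.
by rewrite ler_norml; apply/andP; split; lra.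
Qed.

Lemma csumsP F : asum F -> csums F (csum F).
Proof.
move=> [A FA] e e0; have e20 : 0 < e / 2 by rewrite divr_gt0.
have rA : sbd (fun i => `|complex.Re (F i)|) A.
  by apply: sbd_le FA => // i; exact: Re_le_cmod.
have iA : sbd (fun i => `|complex.Im (F i)|) A.
  by apply: sbd_le FA => // i; exact: Im_le_cmod.
have [s1 us1 h1] := rsum_net rA e20.
have [s2 us2 h2] := rsum_net iA e20.
exists (undup (s1 ++ s2)); first exact: undup_uniq.
move=> t ut st.
have {}h1 := h1 t ut (sub_undup_catl st).
have {}h2 := h2 t ut (sub_undup_catr st).
have -> : \sum_(i <- t) F i = (\sum_(i <- t) complex.Re (F i)) +i* (\sum_(i <- t) complex.Im (F i)).
  elim: (t) => [|i r IH]; first by rewrite !big_nil.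
  by rewrite !big_cons IH; case: (F i).
rewrite (le_trans (cmod_le_ReIm _))//= /csum /=; lra.
Qed.

Lemma csums_uniq F l l' : csums F l -> csums F l' -> l = l'.
Proof.
move=> h h'; apply/eqP; rewrite -subr_eq0; apply/eqP/cmod_le0 => e e0.
have e20 : 0 < e / 2 by rewrite divr_gt0.
have [s us hs] := h _ e20; have [t ut ht] := h' _ e20.
have {}hs := hs (undup (s ++ t)) (undup_uniq _) (sub_undup_catl (fun _ => id)).
have {}ht := ht (undup (s ++ t)) (undup_uniq _) (sub_undup_catr (fun _ => id)).
rewrite (le_trans (cmod_dist_trans (\sum_(i <- undup (s ++ t)) F i) _ _))// cmod_distC; lra.
Qed.

Lemma csumE F l : asum F -> csums F l -> csum F = l.
Proof. by move=> /csumsP; exact: csums_uniq. Qed.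

Lemma eq_csum F H : F =1 H -> csum F = csum H.
Proof. by move=> /funext ->. Qed.

Lemma asum_le F H : (forall i, cmod (F i) <= cmod (H i)) -> asum H -> asum F.
Proof. by move=> h [A HA]; exists A; apply: sbd_le HA. Qed.

Lemma asumD F H : asum F -> asum H -> asum (fun i => F i + H i).
Proof. by move=> [A FA] [B HB]; exists (A + B); apply: sbd_le (sbdD FA HB) => // i; exact: cmodD. Qed.

Lemma asumZ F c : asum F -> asum (fun i => c * F i).
Proof.
move=> [A FA]; exists (cmod c * A); apply: sbd_le (sbdZ (cmod_ge0 c) FA) => // i.
by rewrite cmodM.
Qed.

Lemma asum_conj F : asum F -> asum (fun i => (F i)^*).
Proof. by apply: asum_le => i; rewrite cmod_conj. Qed.

Lemma csumD F H : asum F -> asum H -> csum (fun i => F i + H i) = csum F + csum H.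
Proof.
move=> FA HA; apply: csumE => [|e e0]; first exact: asumD.
have e20 : 0 < e / 2 by rewrite divr_gt0.
have [s us hs] := csumsP FA e20; have [t ut ht] := csumsP HA e20.
exists (undup (s ++ t)) => [|r ur sr]; first exact: undup_uniq.
have {}hs := hs r ur (sub_undup_catl sr).
have {}ht := ht r ur (sub_undup_catr sr).
rewrite big_split /= opprD addrACA (le_trans (cmodD _ _))//; lra.
Qed.

Lemma csumZ F c : asum F -> csum (fun i => c * F i) = c * csum F.
Proof.
move=> FA; apply: csumE => [|e e0]; first exact: asumZ.
have c0 := cmod_ge0 c.
have e20 : 0 < e / (cmod c + 1) by rewrite divr_gt0// ltr_wpDl.
have [s us hs] := csumsP FA e20; exists s => // t ut st.
rewrite -mulr_sumr -mulrBr cmodM (le_trans (ler_wpM2l c0 (hs t ut st)))//.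
rewrite mulrCA ler_piMr ?(ltW e0)// ler_pdivrMr ?ltr_wpDl//; lra.
Qed.

Lemma csum_conj F : asum F -> csum (fun i => (F i)^*) = (csum F)^*.
Proof.
move=> FA; apply: csumE => [|e e0]; first exact: asum_conj.
have [s us hs] := csumsP FA e0; exists s => // t ut st.
by rewrite -rmorph_sum -rmorphB /= cmod_conj hs.
Qed.

Lemma cmod_csum F A : sbd (fun i => cmod (F i)) A -> cmod (csum F) <= A.
Proof.
move=> FA; apply/ler_addgt0Pr => e e0.
have [s us hs] := csumsP (Asum FA) e0.
have {}hs := hs s us (fun i h => h).
rewrite (le_trans (cmod_dist _ (\sum_(i <- s) F i)))// cmod_distC lerD//.
by rewrite (le_trans (cmod_sum _ _))// FA.
Qed.

Lemma csum_fin F (s : seq I) : uniq s -> (forall i, i \notin s -> F i = 0) ->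
  asum F /\ csum F = \sum_(i <- s) F i.
Proof.
move=> us Fs.
have E t : uniq t -> {subset s <= t} -> \sum_(i <- t) F i = \sum_(i <- s) F i.
  move=> ut st; rewrite (bigID (mem s)) /= [X in _ + X]big1 ?addr0 => [|i /Fs//].
  rewrite -big_filter; apply: perm_big; apply: uniq_perm; rewrite ?filter_uniq// => i.
  by rewrite mem_filter andb_idr// => /st.
have FA : asum F.
  exists (\sum_(i <- s) cmod (F i)) => t ut.
  rewrite (bigID (mem s)) /= [X in _ + X]big1 ?addr0 => [|i /Fs ->]; last exact: cmod0.
  rewrite -big_filter ler_sum_subset ?filter_uniq// => [i|i]; first exact: cmod_ge0.
  by rewrite mem_filter => /andP[].
split=> //; apply: csumE => // e e0; exists s => // t ut st.
by rewrite E// subrr cmod0 ltW.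
Qed.

Lemma csum1 F i : (forall j, j != i -> F j = 0) -> csum F = F i.
Proof.
move=> h; have [|_ ->] := @csum_fin F [:: i] isT; last by rewrite big_seq1.
by move=> j; rewrite inE => /h.
Qed.

Lemma csum_ge0 F A : (forall i, 0 <= F i) -> sbd (fun i => complex.Re (F i)) A ->
  asum F /\ csum F = (fine (\esum_(i in [set: I]) (complex.Re (F i))%:E))%:C.
Proof.
move=> F0 FA.
have FE i : F i = (complex.Re (F i))%:C.
  by have := F0 i; rewrite lecE => /andP[/eqP/= + _]; case: (F i) => a b /= ->.
have R0 i : 0 <= complex.Re (F i) by have := F0 i; rewrite FE ler0c.
have FS : asum F by exists A; apply: sbd_le FA => // i; rewrite FE cmod_real ger0_norm.
split=> //; apply: csumE => // e e0.
have [s us hs] := sbd_sup R0 FA e0; exists s => // t ut st.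
rewrite (eq_bigr (fun i => (complex.Re (F i))%:C)) => [|i _]; last exact: FE.
rewrite -rmorph_sum -rmorphB /= cmod_real.
have := le_trans (ltW hs) (ler_sum_subset R0 us st); have := sbd_fine R0 FA ut.
by rewrite ler_norml => h1 h2; apply/andP; split; lra.
Qed.

End ComplexSums.

(** * Norm bounds on l^p *)

Section Powers.
Variable R : realType.
Implicit Types (a s r C : R).

(** The convex function [a ^ r] lies above its tangent at [s]. For [r > 1] this is Young's
    inequality with exponents [r] and [r / (r - 1)]. *)
Lemma young_tangent a s r : 0 <= a -> 0 <= s -> 1 <= r ->
  r * (a * s `^ (r - 1)) <= a `^ r + (r - 1) * s `^ r.
Proof.
move=> a0 s0 r1; have [->|rn1] := eqVneq r 1.
  by rewrite subrr powRr0 mul0r addr0 powRr1// mulr1 mul1r.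
have r_gt1 : 1 < r by rewrite lt_neqAle eq_sym rn1.
have r0 : 0 < r by lra.
have q0 : 0 < r - 1 by lra.
have := @conjugate_powR _ a (s `^ (r - 1)) r (r / (r - 1)) a0 (powR_ge0 _ _) r0.
rewrite divr_gt0// => /(_ isT).
have -> : r^-1 + (r / (r - 1))^-1 = 1 by field; rewrite !gt_eqF.
move=> /(_ erefl); rewrite -powRrM.
have -> : (r - 1) * (r / (r - 1)) = r by field; rewrite gt_eqF.
have -> : s `^ r / (r / (r - 1)) = (r - 1) * s `^ r / r by field; rewrite !gt_eqF.
rewrite -mulrDl ler_pdivlMr// => h.
by rewrite mulrC.
Qed.

(** Tangent inequalities at the point [s = S / C] are averaged with the weights [w]. A total weight
    below [C] suffices because the power function vanishes at 0. *)
Lemma jensen_finite (I : Type) (l : seq I) (w a : I -> R) r C :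
  1 <= r -> 0 < C -> (forall i, 0 <= w i) -> (forall i, 0 <= a i) ->
  \sum_(i <- l) w i <= C ->
  C * ((\sum_(i <- l) w i * a i) / C) `^ r <= \sum_(i <- l) w i * a i `^ r.
Proof.
move=> r1 C0 w0 a0 wC; set S := \sum_(i <- l) w i * a i.
have S0 : 0 <= S by apply: sumr_ge0 => i _; rewrite mulr_ge0.
set s := S / C; have s0 : 0 <= s by rewrite divr_ge0// ltW.
have : \sum_(i <- l) w i * (r * (a i * s `^ (r - 1))) <=
       \sum_(i <- l) w i * (a i `^ r + (r - 1) * s `^ r).
  by apply: ler_sum => i _; rewrite ler_wpM2l// young_tangent.
rewrite (eq_bigr (fun i => (w i * a i) * (r * s `^ (r - 1)))) => [|i _]; last by ring.
rewrite [X in _ <= X](eq_bigr (fun i => w i * a i `^ r + w i * ((r - 1) * s `^ r))) => [|i _]; last by ring.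
rewrite -mulr_suml big_split /= -mulr_suml -/S.
have -> : S = s * C by rewrite /s divfK// gt_eqF.
have -> : s * C * (r * s `^ (r - 1)) = r * C * s `^ r.
  have [->|sn0] := eqVneq s 0; first by rewrite !mul0r powR0 ?mulr0// gt_eqF// (lt_le_trans ltr01).
  rewrite -[s in s * C]powRr1//.
  have -> : s `^ r = s `^ 1 * s `^ (r - 1) by rewrite -powRD ?subrKC// sn0 implybT.
  ring.
have : (\sum_(i <- l) w i) * ((r - 1) * s `^ r) <= C * ((r - 1) * s `^ r).
  by rewrite ler_wpM2r// mulr_ge0 ?powR_ge0// subr_ge0.
lra.
Qed.

End Powers.

Section NormBounds.
Variables (R : realType) (X : countType) (m : X -> R).
Hypothesis m_ge0 : forall x, 0 <= m x.
Local Notation fn := (X -> R[i]).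
Implicit Types (f g h : fn) (p : \bar R) (M N r : R).

(** Finiteness and size of a norm in one hypothesis with a real bound, so that estimates stay out of
    the extended reals; [0 <= M] allows passing to r-th powers and back. *)
Variant nb p f M : Prop := Nb of 0 <= M & (lp_norm m p f <= M%:E)%E.

Let ge0F f r x : 0 <= cmod (f x) `^ r * m x.
Proof. by rewrite mulr_ge0 ?powR_ge0. Qed.

Lemma nb_fin r f M : 1 <= r ->
  (nb r%:E f M <-> 0 <= M /\ sbd (fun x => cmod (f x) `^ r * m x) (M `^ r)).
Proof.
move=> r1; have r0 : 0 < r by lra.
have r0' : 0 <= r^-1 by rewrite invr_ge0 ltW.
split=> -[M0 h]; split=> //; move: h; rewrite /lp_norm => h.
  apply/sbdP => //.
  have := @gt0_ler_poweR _ r (ltW r0) _ _ _ _ h.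
  rewrite -poweRrM mulVf ?gt_eqF// poweRe1; last by apply: esum_ge0 => x _; rewrite lee_fin.
  by rewrite poweR_EFin; apply; rewrite in_itv /= ?poweR_ge0 ?leey ?lee_fin// M0.
move/(sbdP _ (ge0F f r)) : h => h.
have := @gt0_ler_poweR _ r^-1 r0' _ _ _ _ h.
rewrite [X in (_ <= X)%E]poweR_EFin -powRrM divff ?gt_eqF// powRr1//.
apply; rewrite in_itv /= ?leey ?lee_fin ?powR_ge0// andbT esum_ge0// => x _.
by rewrite lee_fin.
Qed.

Lemma lp_norm_fin r f :
  lp_norm m r%:E f = poweR (\esum_(x in [set: X]) (cmod (f x) `^ r * m x)%:E) r^-1.
Proof. by []. Qed.

Lemma nb_oo f M : nb +oo%E f M <-> 0 <= M /\ forall x, cmod (f x) <= M.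
Proof.
split=> -[M0 h]; split=> //=.
  by move=> x; rewrite -lee_fin (le_trans _ h)//; apply: ereal_sup_ubound; exists x.
by apply: ge_ereal_sup => _ [x ->]; rewrite lee_fin.
Qed.

Lemma nb2P f M : nb 2%:E f M <-> 0 <= M /\ sbd (fun x => cmod (f x) ^+ 2 * m x) (M ^+ 2).
Proof.
have -> : (fun x => cmod (f x) ^+ 2 * m x) = (fun x => cmod (f x) `^ 2 * m x).
  by apply/funext => x; rewrite powR_mulrn ?cmod_ge0.
split=> [/nb_fin-/(_ (ltac:(lra)))[M0]|[M0 h]]; first by rewrite powR_mulrn.
by apply/nb_fin; [lra|rewrite powR_mulrn].
Qed.

Lemma nb_ge0 p f M : nb p f M -> 0 <= M.
Proof. by case. Qed.

Variable p : \bar R.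
Hypothesis p1 : (1 <= p)%E.

Lemma nb_mono f g M N : (forall x, cmod (f x) <= cmod (g x)) -> M <= N ->
  nb p g M -> nb p f N.
Proof.
move=> fg MN; case: p p1 => [r|_|//]; [rewrite lee_fin => r1|].
  move/(nb_fin _ _ r1) => [M0 h]; apply/(nb_fin _ _ r1); split; first exact: le_trans MN.
  apply: sbd_le h => [x|].
    by rewrite ler_wpM2r// ge0_ler_powR ?nnegrE ?cmod_ge0//; lra.
  by rewrite ge0_ler_powR ?nnegrE//; lra.
by move/nb_oo => [M0 h]; apply/nb_oo; split=> [|x]; [lra|rewrite (le_trans (fg x))// (le_trans (h x))].
Qed.

Lemma nb_le f M N : M <= N -> nb p f M -> nb p f N.
Proof. exact: nb_mono. Qed.

Lemma nb0 : nb p (fun=> 0) 0.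
Proof.
case: p p1 => [r|_|//]; [rewrite lee_fin => r1|].
  apply/(nb_fin _ _ r1); split=> // s us; rewrite big1 ?powR_ge0// => i _.
  by rewrite cmod0 powR0 ?mul0r// gt_eqF// (lt_le_trans ltr01).
by apply/nb_oo; split=> // x; rewrite cmod0.
Qed.

Lemma nbZ c f M : nb p f M -> nb p (fun x => c * f x) (cmod c * M).
Proof.
case: p p1 => [r|_|//]; [rewrite lee_fin => r1|].
  move/(nb_fin _ _ r1) => [M0 h]; apply/(nb_fin _ _ r1); split; first by rewrite mulr_ge0 ?cmod_ge0.
  rewrite powRM ?cmod_ge0//; apply: sbd_le (sbdZ (powR_ge0 _ _) h) => // x.
  by rewrite cmodM powRM ?cmod_ge0// mulrA.
move/nb_oo => [M0 h]; apply/nb_oo; split=> [|x]; first by rewrite mulr_ge0 ?cmod_ge0.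
by rewrite cmodM ler_wpM2l ?cmod_ge0.
Qed.

Lemma nbN f M : nb p f M -> nb p (fun x => - f x) M.
Proof. by apply: nb_mono => // x; rewrite cmodN. Qed.

Lemma nb_inf f M : 0 <= M -> (forall e : R, 0 < e -> nb p f (M + e)) -> nb p f M.
Proof.
by move=> M0 h; split=> //; apply/lee_addgt0Pr => e e0; have [] := h _ e0; rewrite EFinD.
Qed.

End NormBounds.

Section NormBoundsTheory.
Variables (R : realType) (X : countType) (m : X -> R).
Hypothesis m_ge0 : forall x, 0 <= m x.
Local Notation fn := (X -> R[i]).
Implicit Types (f g h : fn) (M N r : R).
Variable p : \bar R.
Hypothesis p1 : (1 <= p)%E.
Local Notation nb := (nb m).

(** Minkowski's inequality as convexity: [f + g] is [M + N] times the convex combination of [f / M]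
    and [g / N] with weights proportional to [M] and [N], to which Jensen applies pointwise. *)
Lemma nbD f g M N : nb p f M -> nb p g N -> nb p (fun x => f x + g x) (M + N).
Proof.
case: p p1 => [r|_|//]; [move=> p1'; have := p1'; rewrite lee_fin => r1|].
  (* Both bounds are divided by below; they are enlarged by [e / 2], and [nb_inf] removes the
     excess. *)
  wlog : M N / 0 < M /\ 0 < N.
    move=> H fM gN; have M0 := nb_ge0 fM; have N0 := nb_ge0 gN.
    apply: nb_inf => [|e e0]; first by rewrite addr_ge0.
    have -> : M + N + e = (M + e / 2) + (N + e / 2) by field.
    by apply: H; [split; lra|apply: (nb_le m_ge0 p1') fM; lra|apply: (nb_le m_ge0 p1') gN; lra].
  move=> [M0 N0]; move=> /(nb_fin m_ge0 _ _ r1) [_ fM] /(nb_fin m_ge0 _ _ r1) [_ gN].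
  apply/(nb_fin m_ge0 _ _ r1); split; first by rewrite addr_ge0// ltW.
  have C0 : 0 < M + N by rewrite addr_gt0.
  have key x : cmod (f x + g x) `^ r <=
      (M + N) `^ r * (M + N)^-1 * (M * (cmod (f x) / M) `^ r + N * (cmod (g x) / N) `^ r).
    have := @jensen_finite _ bool [:: true; false] (fun b => if b then M else N)
      (fun b => if b then cmod (f x) / M else cmod (g x) / N) r (M + N) r1 C0.
    rewrite !big_cons !big_nil !addr0 !(mulrC M) !(mulrC N) !divfK ?gt_eqF// => H.
    have {}H := H (ltac:(by case; rewrite ltW)) (ltac:(by case; rewrite divr_ge0 ?cmod_ge0 ?ltW)) (lexx _).
    have E : (cmod (f x) + cmod (g x)) `^ r = (M + N) `^ r * ((cmod (f x) + cmod (g x)) / (M + N)) `^ r.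
      rewrite -powRM ?divr_ge0 ?addr_ge0 ?cmod_ge0 ?ltW//; congr (_ `^ _).
      by field; rewrite gt_eqF.
    apply: (@le_trans _ _ ((cmod (f x) + cmod (g x)) `^ r)).
      by rewrite ge0_ler_powR ?nnegrE ?addr_ge0 ?cmod_ge0 ?cmodD//; lra.
    rewrite E -mulrA ler_wpM2l ?powR_ge0// ler_pdivlMl//.
  have := sbdZ (c := (M + N) `^ r * (M + N)^-1) _ (sbdD (sbdZ (c := M * M^-1 `^ r) _ fM) (sbdZ (c := N * N^-1 `^ r) _ gN)).
  move=> /(_ _ _ _)H.
  have {H} := H (ltac:(by rewrite mulr_ge0 ?powR_ge0 ?invr_ge0 ?ltW)) (ltac:(by rewrite mulr_ge0 ?powR_ge0 ?ltW)) (ltac:(by rewrite mulr_ge0 ?powR_ge0 ?ltW)).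
  apply: sbd_le => [x|].
    rewrite (le_trans (ler_wpM2r (m_ge0 x) (key x)))//.
    rewrite !powRM ?cmod_ge0 ?invr_ge0 ?(ltW M0) ?(ltW N0)//.
    by rewrite le_eqVlt; apply/orP; left; apply/eqP; ring.
  rewrite -!mulrA -!powRM ?invr_ge0 ?(ltW M0) ?(ltW N0)// !mulVf ?gt_eqF// !powR1 !mulr1 mulVf ?gt_eqF//.
  by rewrite mulr1.
move/nb_oo => [M0 h] /nb_oo [N0 h']; apply/nb_oo; split=> [|x]; first by rewrite addr_ge0.
by rewrite (le_trans (cmodD _ _))// lerD.
Qed.

Lemma nbB f g M N : nb p f M -> nb p g N -> nb p (fun x => f x - g x) (M + N).
Proof. by move=> fM gN; apply: nbD => //; exact: (nbN m_ge0 p1). Qed.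

(** At a point of positive mass evaluation is continuous on l^p; for exponent [r] the constant is
    [m x] to the power [-1/r]. This is what turns norm convergence into pointwise convergence
    throughout. *)
Lemma nb_pt x : 0 < m x -> exists2 C : R, 0 < C & forall f M, nb p f M -> cmod (f x) <= C * M.
Proof.
move=> mx; case: p p1 => [r|_|//]; [rewrite lee_fin => r1|]; last first.
  by exists 1 => // f M /nb_oo[_ h]; rewrite mul1r.
exists (m x `^ (- r^-1)); first by rewrite powR_gt0.
have r0 : 0 < r by lra.
move=> f M /(nb_fin m_ge0 _ _ r1)[M0 /sbd1-/(_ x) h].
have : cmod (f x) `^ r <= (m x `^ (- r^-1) * M) `^ r.
  rewrite powRM ?powR_ge0// -powRrM mulNr mulVf ?gt_eqF// powR_inv1 ?(ltW mx)// mulrC.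
  by rewrite ler_pdivlMr.
move=> {}h; rewrite leNgt; apply/negP => lt.
have := @gt0_ltr_powR _ r r0 _ _ _ _ lt.
by rewrite !nnegrE mulr_ge0 ?powR_ge0// cmod_ge0 => /(_ isT isT); rewrite ltNge h.
Qed.

Definition restr (s : seq X) f : fn := fun x => if x \in s then f x else 0.

Lemma restr_le s f x : cmod (restr s f x) <= cmod (f x).
Proof. by rewrite /restr; case: ifP => // _; rewrite cmod0 cmod_ge0. Qed.

Lemma nb_restr s f : exists M, nb p (restr s f) M.
Proof.
suff [M h] : exists M, nb p (restr (undup s) f) M.
  exists M; suff <- : restr (undup s) f = restr s f by [].
  by apply/funext => x; rewrite /restr mem_undup.
have := undup_uniq s; move: (undup s) => {}s us.
case: p p1 => [r|_|//]; [rewrite lee_fin => r1|].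
  have r0 : 0 < r by lra.
  set A := \sum_(x <- s) cmod (f x) `^ r * m x.
  have A0 : 0 <= A by apply: sumr_ge0 => x _; rewrite mulr_ge0 ?powR_ge0.
  exists (A `^ r^-1); apply/(nb_fin m_ge0 _ _ r1); split; first exact: powR_ge0.
  rewrite -powRrM mulVf ?gt_eqF// powRr1// => t ut.
  rewrite (bigID (mem s)) /= [X in _ + X]big1 ?addr0 => [|x xs]; last first.
    by rewrite /restr (negbTE xs) cmod0 powR0 ?mul0r// gt_eqF.
  rewrite (eq_bigr (fun x => cmod (f x) `^ r * m x)) => [|x xs]; last by rewrite /restr xs.
  rewrite -big_filter ler_sum_subset ?filter_uniq// => [x|x]; first by rewrite mulr_ge0 ?powR_ge0.
  by rewrite mem_filter => /andP[].
exists (\sum_(x <- s) cmod (f x)); apply/nb_oo; split=> [|x].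
  by apply: sumr_ge0 => x _; exact: cmod_ge0.
rewrite /restr; case: ifPn => [xs|_]; last by rewrite cmod0 sumr_ge0// => i _; exact: cmod_ge0.
by rewrite (perm_big _ (perm_to_rem xs)) big_cons lerDl sumr_ge0// => i _; exact: cmod_ge0.
Qed.

Lemma nb_restr_lim f M : 0 <= M -> (forall s, uniq s -> nb p (restr s f) M) -> nb p f M.
Proof.
move=> M0; case: p p1 => [r|_|//]; [rewrite lee_fin => r1|] => h.
  apply/(nb_fin m_ge0 _ _ r1); split=> // s us.
  have /(nb_fin m_ge0 _ _ r1) [_ /(_ s us)] := h s us; apply: le_trans.
  by rewrite le_eqVlt; apply/orP; left; apply/eqP/eq_big_seq => x xs; rewrite /restr xs.
apply/nb_oo; split=> // x.
by have /nb_oo [_ /(_ x)] := h [:: x] isT; rewrite /restr inE eqxx.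
Qed.

(** A Fatou lemma: the norm is a supremum over restrictions to finite sets, and on a finite set
    uniform closeness controls the norm. *)
Lemma nb_lim f M : 0 <= M -> (forall (s : seq X) (e : R), 0 < e -> exists2 g, nb p g (M + e) &
   forall x, x \in s -> cmod (f x - g x) <= e) -> nb p f M.
Proof.
move=> M0 h; apply: nb_restr_lim => // s us.
have [C C1] := nb_restr s (fun=> 1).
have C0 := nb_ge0 C1.
apply: nb_inf => // e e0.
(* [C] bounds the norm of the indicator of [s]: the excess [e / (1 + C)] in the norm of [g] and the
   pointwise error add up to [e]. *)
have e10 : 0 < e / (1 + C) by rewrite divr_gt0// ltr_pwDl.
have [g gM gs] := h s _ e10.
have -> : restr s f = (fun x => restr s g x + restr s (fun x => f x - g x) x).
  by apply/funext => x; rewrite /restr; case: ifP => // _; rewrite ?addr0// addrC subrK.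
have -> : M + e = (M + e / (1 + C)) + cmod (e / (1 + C))%:C * C.
  by rewrite cmod_real ger0_norm ?ltW//; field; rewrite gt_eqF// ltr_pwDl.
apply: nbD; first by apply: (nb_mono m_ge0 p1) gM => // x; exact: restr_le.
apply: (nb_mono m_ge0 p1) (lexx _) (nbZ m_ge0 p1 _ C1) => x.
rewrite /restr; case: ifP => xs; last by rewrite mulr0 !cmod0.
by rewrite mulr1 cmod_real ger0_norm ?(ltW e10)// gs.
Qed.

Lemma nb_seq_lim (u : nat -> fn) f M :
  (forall n, nb p (u n) M) ->
  (forall x (e : R), 0 < e -> exists n0, forall n, (n0 <= n)%N -> cmod (f x - u n x) <= e) ->
  nb p f M.
Proof.
move=> uM uf; apply: nb_lim => [|s e e0]; first exact: nb_ge0 (uM 0%N).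
have [n hn] : exists n, forall n', (n <= n')%N -> forall x, x \in s -> cmod (f x - u n' x) <= e.
  elim: s => [|x s [n IH]]; first by exists 0%N.
  have [k hk] := uf x _ e0; exists (maxn n k) => n'; rewrite geq_max => /andP[nn' kn'] y.
  by rewrite inE => /orP[/eqP ->|ys]; [exact: hk|exact: IH].
exists (u n); last by move=> x; exact: hn.
by apply: (nb_le m_ge0 p1) (uM n); rewrite lerDl ltW.
Qed.

Lemma lpP f : lp m p f <-> exists M, nb p f M.
Proof.
split; last by case=> M [_ h]; rewrite /lp /= (le_lt_trans h)// ltry.
rewrite /lp /=; move E : (lp_norm m p f) => [a| |]// _.
  by exists (Num.max 0 a); split; rewrite ?E ?lee_fin le_max lexx ?orbT.
by exists 0; split=> //; rewrite E leNye.
Qed.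

Lemma Cc_restr f : Cc f -> exists2 s, uniq s & f = restr s f.
Proof.
move=> /finite_seqP[s Es]; exists (undup s); first exact: undup_uniq.
apply/funext => x; rewrite /restr mem_undup; case: ifPn => // xs.
apply/eqP; apply: contraNT xs => fx.
by have : [set x | f x != 0] x by []; rewrite Es.
Qed.

Lemma restr_Cc s f : Cc (restr s f).
Proof.
apply: (@sub_finite_set _ _ [set` s]); last exact: finite_seq.
by move=> x /=; rewrite /restr; case: ifPn => //; rewrite eqxx.
Qed.

Lemma nb_Cc f : Cc f -> exists M, nb p f M.
Proof. by move=> /Cc_restr[s _ ->]; exact: nb_restr. Qed.

End NormBoundsTheory.

(** * Density of finitely supported functions *)

Section Density.
Variables (R : realType) (X : countType) (m : X -> R).
Hypothesis m_ge0 : forall x, 0 <= m x.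
Variable r : R.
Hypothesis r1 : 1 <= r.

Lemma nb_dens (f : X -> R[i]) M (e : R) : nb m r%:E f M -> 0 < e ->
  exists2 s, uniq s & nb m r%:E (fun x => f x - restr s f x) e.
Proof.
move=> /(nb_fin m_ge0 _ _ r1)[M0 h] e0.
have F0 x : 0 <= cmod (f x) `^ r * m x by rewrite mulr_ge0 ?powR_ge0.
(* The list [s] carries all but less than the r-th power of [e] of the total sum, and a list
   disjoint from [s] can only use up this remainder. *)
have [s us hs] := sbd_sup F0 h (powR_gt0 r e0).
exists s => //; apply/(nb_fin m_ge0 _ _ r1); split; first exact: ltW.
move=> t ut.
have r0 : r != 0 by rewrite gt_eqF// (lt_le_trans ltr01).
rewrite (bigID (mem s)) /= [X in X + _]big1 ?add0r => [|x xs]; last first.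
  by rewrite /restr xs subrr cmod0 powR0// mul0r.
rewrite (eq_bigr (fun x => cmod (f x) `^ r * m x)) => [|x xs]; last by rewrite /restr (negbTE xs) subr0.
have := sbd_fine F0 h (_ : uniq (s ++ [seq x <- t | x \notin s])).
rewrite cat_uniq us filter_uniq// andbT => H.
have {H} := H (ltac:(by apply/hasPn => x; rewrite mem_filter => /andP[])).
rewrite big_cat big_filter /=; lra.
Qed.

End Density.

(** Meaningful on l^2 only, since [inner] rests on sums with junk values elsewhere; hence the [l2]
    hypotheses carried by the rules below. *)
HB.lock Definition n2 (R : realType) (X : countType) (m : X -> R) (f : X -> R[i]) : R :=
  Num.sqrt (complex.Re (inner m f f)).

(** * The weighted Hilbert space l^2 *)

Section InnerProduct.
Variables (R : realType) (X : countType) (m : X -> R).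
Hypothesis m_ge0 : forall x, 0 <= m x.
Local Notation fn := (X -> R[i]).
Local Notation nb2 := (nb m 2%:E).
Implicit Types (f g h : fn) (M N : R).

Variant l2 f : Prop := L2 M of nb2 f M.

Lemma le12 : (1 <= 2%:E :> \bar R)%E.
Proof. by rewrite lee_fin ler1n. Qed.
Hint Resolve le12 : core.

(** Cauchy-Schwarz from the pointwise inequality [a b <= N/(2M) a^2 + M/(2N) b^2], in which each of
    the two terms sums to at most [M N / 2]. *)
Lemma sbd_inner f g M N : nb2 f M -> nb2 g N ->
  sbd (fun x => cmod (f x * (g x)^* * (m x)%:C)) (M * N).
Proof.
move=> fM gN.
have pos M' N' : 0 < M' -> 0 < N' -> nb2 f M' -> nb2 g N' ->
    sbd (fun x => cmod (f x * (g x)^* * (m x)%:C)) (M' * N').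
  move=> M0 N0 /(nb2P m_ge0) [_ f2] /(nb2P m_ge0) [_ g2].
  have := sbdD (sbdZ (c := N' / (2 * M')) _ f2) (sbdZ (c := M' / (2 * N')) _ g2).
  have c1 : 0 <= N' / (2 * M') by rewrite divr_ge0 ?mulr_ge0 ?(ltW M0) ?(ltW N0).
  have c2 : 0 <= M' / (2 * N') by rewrite divr_ge0 ?mulr_ge0 ?(ltW M0) ?(ltW N0).
  move=> /(_ c1 c2); apply: sbd_le => [x|]; last first.
    by rewrite le_eqVlt; apply/orP; left; apply/eqP; field; rewrite !gt_eqF.
  rewrite !cmodM cmod_conj cmod_real ger0_norm// !mulrA -mulrDl ler_wpM2r//.
  set a := cmod (f x); set b := cmod (g x).
  have -> : N' / (2 * M') * a * a + M' / (2 * N') * b * b =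
     a * b + (2 * M' * N')^-1 * (N' * a - M' * b) ^+ 2 by field; rewrite !gt_eqF.
  by rewrite lerDl mulr_ge0 ?sqr_ge0// invr_ge0 !mulr_ge0 ?(ltW M0) ?(ltW N0).
have M0 := nb_ge0 fM; have N0 := nb_ge0 gN.
apply: sbd_inf => e e0.
(* With this [d] both bounds become positive and [(M + d)(N + d) <= M N + e]. *)
pose d := Num.min 1 (e / (M + N + 1)).
have d0 : 0 < d by rewrite lt_min ltr01 divr_gt0//; lra.
have d1 : d <= 1 by rewrite ge_min lexx.
have d2 : d * (M + N + 1) <= e by rewrite -ler_pdivlMr ?ge_min ?lexx ?orbT//; lra.
have := pos (M + d) (N + d) (ltac:(lra)) (ltac:(lra)).
have le1 : M <= M + d by lra.
have le2 : N <= N + d by lra.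
move=> /(_ (nb_le m_ge0 le12 le1 fM) (nb_le m_ge0 le12 le2 gN)); apply: sbd_le => //.
have : d * d <= d by rewrite ler_piMl// ltW.
lra.
Qed.

Lemma innerE f g : inner m f g = csum (fun x => f x * (g x)^* * (m x)%:C).
Proof. by []. Qed.

Lemma asum_inner f g : l2 f -> l2 g -> asum (fun x => f x * (g x)^* * (m x)%:C).
Proof. by move=> [M fM] [N gN]; exists (M * N); exact: sbd_inner. Qed.

Lemma cmod_inner f g M N : nb2 f M -> nb2 g N -> cmod (inner m f g) <= M * N.
Proof. by move=> fM gN; apply: cmod_csum; exact: sbd_inner. Qed.

Lemma l2D f g : l2 f -> l2 g -> l2 (fun x => f x + g x).
Proof. by move=> [M fM] [N gN]; exists (M + N); exact: (nbD m_ge0 le12). Qed.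

Lemma l2Z c f : l2 f -> l2 (fun x => c * f x).
Proof. by move=> [M fM]; exists (cmod c * M); exact: (nbZ m_ge0 le12). Qed.

Lemma l2N f : l2 f -> l2 (fun x => - f x).
Proof. by move=> [M fM]; exists M; exact: (nbN m_ge0 le12). Qed.

Lemma l2B f g : l2 f -> l2 g -> l2 (fun x => f x - g x).
Proof. by move=> f2 g2; apply: l2D => //; exact: l2N. Qed.

Lemma l20 : l2 (fun=> 0).
Proof. by exists 0; exact: (nb0 m_ge0 le12). Qed.

Lemma l2_lp f : lp m 2%:E f <-> l2 f.
Proof. by split=> [/lpP[M]|[M]]; [exists M|move=> fM; apply/lpP; exists M]. Qed.

Lemma l2_Cc f : Cc f -> l2 f.
Proof. by move=> /(nb_Cc m_ge0 le12)[M]; exists M. Qed.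

Lemma innerDl f g h : l2 f -> l2 g -> l2 h ->
  inner m (fun x => f x + g x) h = inner m f h + inner m g h.
Proof.
move=> f2 g2 h2; rewrite /inner -csumD; [|exact: asum_inner|exact: asum_inner].
by apply: eq_csum => x; rewrite !mulrDl.
Qed.

Lemma innerZl c f g : l2 f -> l2 g -> inner m (fun x => c * f x) g = c * inner m f g.
Proof.
move=> f2 g2; rewrite /inner -csumZ; last exact: asum_inner.
by apply: eq_csum => x; rewrite !mulrA.
Qed.

Lemma innerNl f g : l2 f -> l2 g -> inner m (fun x => - f x) g = - inner m f g.
Proof.
move=> f2 g2; rewrite -mulN1r -innerZl//; congr (inner m _ g).
by apply/funext => x; rewrite mulN1r.
Qed.

Lemma innerBl f g h : l2 f -> l2 g -> l2 h ->
  inner m (fun x => f x - g x) h = inner m f h - inner m g h.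
Proof. by move=> f2 g2 h2; rewrite innerDl ?innerNl//; exact: l2N. Qed.

Lemma inner_conj f g : l2 f -> l2 g -> (inner m f g)^* = inner m g f.
Proof.
move=> f2 g2; rewrite /inner -csum_conj; last exact: asum_inner.
apply: eq_csum => x; case: (f x) => a b; case: (g x) => c d.
by apply/eqP; rewrite eq_complex /=; apply/andP; split; apply/eqP; ring.
Qed.

Lemma innerDr f g h : l2 f -> l2 g -> l2 h ->
  inner m h (fun x => f x + g x) = inner m h f + inner m h g.
Proof.
move=> f2 g2 h2; rewrite -inner_conj ?innerDl ?rmorphD /= ?inner_conj//; exact: l2D.
Qed.

Lemma innerZr c f g : l2 f -> l2 g -> inner m g (fun x => c * f x) = c^* * inner m g f.
Proof.
move=> f2 g2; rewrite -inner_conj ?innerZl ?rmorphM /= ?inner_conj//; exact: l2Z.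
Qed.

Lemma innerNr f g : l2 f -> l2 g -> inner m g (fun x => - f x) = - inner m g f.
Proof.
move=> f2 g2; rewrite -inner_conj ?innerNl ?rmorphN /= ?inner_conj//; exact: l2N.
Qed.

Lemma innerBr f g h : l2 f -> l2 g -> l2 h ->
  inner m h (fun x => f x - g x) = inner m h f - inner m h g.
Proof. by move=> f2 g2 h2; rewrite innerDr ?innerNr//; exact: l2N. Qed.

Local Notation n2 := (n2 m).

Let FE f x : f x * (f x)^* * (m x)%:C = (cmod (f x) ^+ 2 * m x)%:C.
Proof. by rewrite mulcJ -rmorphM. Qed.

Lemma inner_nb f : l2 f -> exists2 A : R, 0 <= A &
  inner m f f = A%:C /\ forall M, 0 <= M -> (nb2 f M <-> A <= M ^+ 2).
Proof.
move=> [M /(nb2P m_ge0) [M0 h]].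
have F0 x : 0 <= cmod (f x) ^+ 2 * m x by rewrite mulr_ge0 ?sqr_ge0.
exists (fine (\esum_(x in [set: X]) (cmod (f x) ^+ 2 * m x)%:E)).
  exact: sbd_ge0 (sbd_fine F0 h).
split.
  have [|_] := @csum_ge0 R X (fun x => (cmod (f x) ^+ 2 * m x)%:C) (M ^+ 2) _ h.
    by move=> x; rewrite ler0c.
  by move=> <-; apply: eq_csum => x; exact: FE.
move=> N N0; rewrite nb2P//; split=> [[_ h']|h'].
  rewrite -lee_fin fineK; first exact/sbdP.
  rewrite ge0_fin_numE ?esum_ge0//; last by move=> x _; rewrite lee_fin.
  by apply/sbd_fin => //; exists (M ^+ 2).
by split=> //; apply: sbd_le h' (sbd_fine F0 h).
Qed.

Lemma n2_ge0 f : 0 <= n2 f.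
Proof. by rewrite n2.unlock sqrtr_ge0. Qed.

Lemma inner_n2 f : l2 f -> inner m f f = (n2 f ^+ 2)%:C.
Proof. by move=> /inner_nb[A A0 [E _]]; rewrite n2.unlock E /= sqr_sqrtr. Qed.

Lemma nb_n2 f : l2 f -> nb2 f (n2 f).
Proof. by move=> /inner_nb[A A0 [E ->]]; rewrite ?n2_ge0// n2.unlock E /= sqr_sqrtr. Qed.

Lemma n2_le f M : nb2 f M -> n2 f <= M.
Proof.
move=> fM; have [A A0 [E H]] : exists2 A : R, 0 <= A &
  inner m f f = A%:C /\ forall M, 0 <= M -> (nb2 f M <-> A <= M ^+ 2).
  by apply: inner_nb; exists M.
rewrite n2.unlock E /= -[leRHS](ger0_norm (nb_ge0 fM)) -sqrtr_sqr ler_wsqrtr//.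
by apply/H => //; exact: nb_ge0 fM.
Qed.

Lemma nb_n2P f M : l2 f -> n2 f <= M -> nb2 f M.
Proof. by move=> f2 fM; apply: (nb_le m_ge0 le12 fM); exact: nb_n2. Qed.

Lemma cmod_inner_n2 f g : l2 f -> l2 g -> cmod (inner m f g) <= n2 f * n2 g.
Proof. by move=> f2 g2; apply: cmod_inner; exact: nb_n2. Qed.

Lemma n2D f g : l2 f -> l2 g -> n2 (fun x => f x + g x) <= n2 f + n2 g.
Proof. by move=> f2 g2; apply: n2_le; apply: (nbD m_ge0 le12); exact: nb_n2. Qed.

Lemma n2Z c f : l2 f -> n2 (fun x => c * f x) = cmod c * n2 f.
Proof.
move=> f2; rewrite n2.unlock innerZl ?innerZr//; last exact: l2Z.
rewrite mulrA mulcJ inner_n2// -rmorphM /= -exprMn sqrtr_sqr ger0_norm//.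
  by rewrite sqrtr_sqr ger0_norm ?n2_ge0.
by rewrite mulr_ge0 ?cmod_ge0 ?n2_ge0.
Qed.

Lemma n2N f : l2 f -> n2 (fun x => - f x) = n2 f.
Proof.
move=> f2; rewrite -[RHS]mul1r -(cmod1 R) -cmodN -n2Z//; congr n2.
by apply/funext => x; rewrite mulN1r.
Qed.

Lemma n2B f g : l2 f -> l2 g -> n2 (fun x => f x - g x) <= n2 f + n2 g.
Proof. by move=> f2 g2; rewrite -(n2N g2); apply: n2D => //; exact: l2N. Qed.

Lemma n2_distC f g : l2 f -> l2 g -> n2 (fun x => f x - g x) = n2 (fun x => g x - f x).
Proof.
move=> f2 g2; rewrite -[LHS]n2N; last exact: l2B.
by congr n2; apply/funext => x; rewrite opprB.
Qed.

Lemma n20 : n2 (fun=> 0) = 0.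
Proof. by apply/eqP; rewrite eq_le n2_ge0 andbT n2_le//; exact: (nb0 m_ge0 le12). Qed.

Lemma n2_mono f g : (forall x, cmod (f x) <= cmod (g x)) -> l2 g -> l2 f /\ n2 f <= n2 g.
Proof.
move=> fg g2; have h : nb2 f (n2 g) by apply: (nb_mono m_ge0 le12 fg (lexx _)); exact: nb_n2.
by split; [exists (n2 g)|exact: n2_le].
Qed.

Lemma parallelogram f g : l2 f -> l2 g ->
  n2 (fun x => f x + g x) ^+ 2 + n2 (fun x => f x - g x) ^+ 2 = 2 * n2 f ^+ 2 + 2 * n2 g ^+ 2.
Proof.
move=> f2 g2; have fg := l2D f2 g2; have fmg := l2B f2 g2.
have E u : l2 u -> n2 u ^+ 2 = complex.Re (inner m u u) by move=> u2; rewrite inner_n2.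
rewrite !E// innerDl// innerDr// innerDr// innerBl// innerBr// innerBr// !(ReB, ReD, ReN); ring.
Qed.

Lemma n2_sqrD f g : l2 f -> l2 g -> n2 (fun x => f x + g x) ^+ 2 =
  n2 f ^+ 2 + 2 * complex.Re (inner m f g) + n2 g ^+ 2.
Proof.
move=> f2 g2; have fg := l2D f2 g2.
have E u : l2 u -> n2 u ^+ 2 = complex.Re (inner m u u) by move=> u2; rewrite inner_n2.
rewrite !E// innerDl// innerDr// innerDr// -[inner m g f]inner_conj// !ReD Re_conj; ring.
Qed.

End InnerProduct.
#[global] Hint Extern 0 (is_true (1 <= 2%:E)%E) => exact: le12 : core.

(** * Integral kernels and the Schur test *)

Section Kernels.
Variables (R : realType) (X : countType) (m : X -> R).
Hypothesis m_gt0 : forall x, 0 < m x.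
Local Notation fn := (X -> R[i]).
Implicit Types (f g h : fn) (M N : R) (k : X -> X -> R[i]).

Let m_ge0 x : 0 <= m x. Proof. exact: ltW. Qed.

Definition point_mass (y : X) : fn := fun x => if x == y then 1 else 0.

Definition kop k f : fn := fun x => csum (fun y => k x y * f y * (m y)%:C).

(** Symmetry makes the row bound a column bound as well, so that one constant bounds the operator on
    all l^p at once. *)
Record schur_kernel k (C : R) : Prop := SchurKernel {
  schur_gt0 : 0 < C ;
  schur_sym : forall x y, k x y = k y x ;
  schur_bound : forall x, sbd (fun y => cmod (k x y) * m y) C }.

Lemma delta_Cc y : Cc (point_mass y).
Proof.
apply: (@sub_finite_set _ _ [set y]); last exact: finite_set1.
by move=> x /=; rewrite /point_mass; have [->//|_] := eqVneq x y; rewrite eqxx.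
Qed.

Lemma restr_cons y s f : y \notin s ->
  restr (y :: s) f = (fun x => f y * point_mass y x + restr s f x).
Proof.
move=> ys; apply/funext => x; rewrite /restr /point_mass inE.
have [->|xy] := eqVneq x y; first by rewrite (negbTE ys) mulr1 addr0.
by rewrite mulr0 add0r.
Qed.

Lemma restr_nil f : restr [::] f = (fun=> 0).
Proof. by apply/funext => x. Qed.

Section Schur.
Variables (p : \bar R) (p1 : (1 <= p)%E) (k : X -> X -> R[i]) (C : R).
Hypothesis kC : schur_kernel k C.

(** Schur test for finite parts of the rows: Jensen in each row, with weights [|k x y| m y] of total
    at most [C], then exchange of sums and the column bound. It comes before convergence of the
    rows, which is deduced from it in [asum_kop]. *)
Lemma schur_part f M (s : seq X) : uniq s -> nb m p f M ->
  nb m p (fun x => \sum_(y <- s) k x y * f y * (m y)%:C) (C * M).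
Proof.
have C0 := schur_gt0 kC; have ksym := schur_sym kC; have kb := schur_bound kC.
have tri x : cmod (\sum_(y <- s) k x y * f y * (m y)%:C) <=
    \sum_(y <- s) (cmod (k x y) * m y) * cmod (f y).
  rewrite (le_trans (cmod_sum _ _))// ler_sum// => y _.
  by rewrite !cmodM cmod_real ger0_norm// mulrAC.
move=> us; case: p p1 => [r|_|//]; [rewrite lee_fin => r1|]; last first.
  move=> /nb_oo[M0 h]; apply/nb_oo; split=> [|x]; first by rewrite mulr_ge0// ltW.
  rewrite (le_trans (tri x))//.
  apply: (@le_trans _ _ (\sum_(y <- s) (cmod (k x y) * m y) * M)).
    by apply: ler_sum => y _; rewrite ler_wpM2l ?mulr_ge0 ?cmod_ge0.
  by rewrite -mulr_suml ler_wpM2r// kb.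
move=> /(nb_fin m_ge0 _ _ r1)[M0 h]; apply/(nb_fin m_ge0 _ _ r1).
split=> [|t ut]; first by rewrite mulr_ge0// ltW.
have r0 : 0 <= r by rewrite (le_trans ler01).
(* Jensen accounts for the prefactor [C^r / C]; the column sums supply the missing [C]. *)
apply: (@le_trans _ _ (\sum_(x <- t) (C `^ r * C^-1) *
    \sum_(y <- s) (cmod (k y x) * m x) * (cmod (f y) `^ r * m y))).
  apply: ler_sum => x _.
  have := @jensen_finite R X s (fun y => cmod (k x y) * m y) (fun y => cmod (f y)) r C r1 C0.
  move=> /(_ (fun y => mulr_ge0 (cmod_ge0 _) (m_ge0 y)) (fun y => cmod_ge0 _) (kb x s us)).
  set S := \sum_(y <- s) _ => H.
  have S0 : 0 <= S by apply: sumr_ge0 => y _; rewrite !mulr_ge0 ?cmod_ge0.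
  have le1 : cmod (\sum_(y <- s) k x y * f y * (m y)%:C) `^ r <= S `^ r.
    by rewrite ge0_ler_powR ?nnegrE ?cmod_ge0 ?tri.
  have SE : S `^ r = C `^ r * (S / C) `^ r.
    by rewrite -powRM ?divr_ge0 ?(ltW C0)// mulrCA divff ?gt_eqF// mulr1.
  rewrite (le_trans (ler_wpM2r (m_ge0 x) le1))// SE -!mulrA ler_wpM2l ?powR_ge0//.
  rewrite ler_pdivlMl// mulrA (le_trans (ler_wpM2r (m_ge0 x) H))// mulr_suml ler_sum// => y _.
  by rewrite (ksym x y) le_eqVlt; apply/orP; left; apply/eqP; ring.
rewrite -mulr_sumr exchange_big /= powRM ?(ltW C0)//.
rewrite -mulrA ler_wpM2l ?powR_ge0// mulrC ler_pdivrMr//.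
apply: (@le_trans _ _ (\sum_(y <- s) C * (cmod (f y) `^ r * m y))).
  apply: ler_sum => y _; rewrite -mulr_suml ler_wpM2r ?mulr_ge0 ?powR_ge0//.
  exact: kb.
by rewrite -mulr_sumr mulrC ler_wpM2r ?(ltW C0)// h.
Qed.

End Schur.

Lemma schur_abs k C : schur_kernel k C -> schur_kernel (fun x y => (cmod (k x y))%:C) C.
Proof.
move=> [C0 ksym kb]; split=> // [x y|x]; first by rewrite ksym.
by apply: sbd_le (kb x) => // y; rewrite cmod_real ger0_norm ?cmod_ge0.
Qed.

Section SchurOperator.
Variables (p : \bar R) (p1 : (1 <= p)%E) (k : X -> X -> R[i]) (C : R).
Hypothesis kC : schur_kernel k C.

(** [schur_part] for [|k|] and [|f|] bounds the partial sums in norm, and evaluation at [x] makes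
    this a bound on absolute partial sums. *)
Lemma asum_kop f M x : nb m p f M -> asum (fun y => k x y * f y * (m y)%:C).
Proof.
move=> fM; have [D D0 HD] := nb_pt m_ge0 p1 (m_gt0 x).
exists (D * (C * M)) => s us.
have fM' : nb m p (fun y => (cmod (f y))%:C) M.
  by apply: (nb_mono m_ge0 p1) fM => // y; rewrite cmod_real ger0_norm ?cmod_ge0.
apply: le_trans (HD _ _ (schur_part p1 (schur_abs kC) us fM')).
rewrite (eq_bigr (fun y => (cmod (k x y) * cmod (f y) * m y)%:C)) => [|y _]; last by rewrite !rmorphM.
rewrite -rmorph_sum cmod_real ger0_norm; last first.
  by apply: sumr_ge0 => y _; rewrite !mulr_ge0 ?cmod_ge0.
by apply: ler_sum => y _; rewrite !cmodM cmod_real ger0_norm.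
Qed.

Lemma nb_kop f M : nb m p f M -> nb m p (kop k f) (C * M).
Proof.
move=> fM; have C0 := schur_gt0 kC.
apply: (nb_lim m_ge0 p1) => [|s e e0]; first by rewrite mulr_ge0 ?(nb_ge0 fM)// ltW.
have [t ut ht] : exists2 t : seq X, uniq t & forall t', uniq t' -> {subset t <= t'} ->
   forall x, x \in s -> cmod (\sum_(y <- t') k x y * f y * (m y)%:C - kop k f x) <= e.
  elim: s => [|x s [t ut IH]]; first by exists [::].
  have [t' ut' h] := csumsP (asum_kop x fM) e0.
  exists (undup (t ++ t')) => [|r ur sr z]; first exact: undup_uniq.
  by rewrite inE => /orP[/eqP ->|zs]; [exact: h ur (sub_undup_catr sr)|exact: IH ur (sub_undup_catl sr) z zs].
exists (fun x => \sum_(y <- t) k x y * f y * (m y)%:C).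
  by apply: (nb_le m_ge0 p1) (schur_part p1 kC ut fM); rewrite lerDl ltW.
by move=> x xs; rewrite cmod_distC ht.
Qed.

Lemma kop_lin a f g M N : nb m p f M -> nb m p g N ->
  kop k (fun x => a * f x + g x) = (fun x => a * kop k f x + kop k g x).
Proof.
move=> fM gN; apply/funext => x; rewrite /kop.
have fa := asum_kop x fM; have ga := asum_kop x gN.
rewrite -csumZ// -csumD//; last exact: asumZ.
by apply: eq_csum => y; ring.
Qed.

Lemma kop_pt x : exists2 D : R, 0 < D & forall f M, nb m p f M -> cmod (kop k f x) <= D * M.
Proof.
have [D D0 HD] := nb_pt m_ge0 p1 (m_gt0 x).
exists (D * C) => [|f M fM]; first by rewrite mulr_gt0 ?(schur_gt0 kC).
by rewrite -mulrA HD//; exact: nb_kop.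
Qed.

End SchurOperator.

Lemma kop_delta k x y : kop k (point_mass y) x = k x y * (m y)%:C.
Proof.
rewrite /kop (@csum1 _ _ _ y) => [|z /negbTE zy]; rewrite /point_mass ?eqxx ?mulr1//.
by rewrite zy mulr0 mul0r.
Qed.

Section Extension.
Variables (r : R) (r1 : 1 <= r).
Local Notation p := (r%:E).

Let p1 : (1 <= p)%E. Proof. by rewrite lee_fin. Qed.

(** Point masses span a dense subspace for finite exponents. Identities between operators on l^r are
    thus reduced to point masses, where the l^2 theory is available. [L] is a function of arbitrary
    families, so linearity and boundedness are asked on l^r only. *)
Lemma ext_delta (L : fn -> R[i]) (K : R) :
  (forall a f g M N, nb m p f M -> nb m p g N -> L (fun x => a * f x + g x) = a * L f + L g) ->
  (forall f M, nb m p f M -> cmod (L f) <= K * M) ->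
  (forall y, L (point_mass y) = 0) -> forall f M, nb m p f M -> L f = 0.
Proof.
move=> Llin Lb Ld f M fM.
have Lr s : uniq s -> L (restr s f) = 0.
  elim: s => [|y s IH] /=.
    by rewrite restr_nil => _; apply: cmod_eq0; apply/eqP; rewrite eq_le cmod_ge0 andbT -(mulr0 K) Lb//; exact: nb0.
  move=> /andP[ys us]; rewrite restr_cons//.
  have [N hN] := nb_restr m_ge0 p1 s f.
  have [D hD] := nb_Cc m_ge0 p1 (delta_Cc y).
  by rewrite (Llin _ _ _ _ _ hD hN) Ld mulr0 add0r IH.
apply: cmod_le0 => e e0.
have e10 : 0 < e / (`|K| + 1) by rewrite divr_gt0// ltr_wpDl.
have [s us hs] := nb_dens m_ge0 r1 fM e10.
have [N hN] := nb_restr m_ge0 p1 s f.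
have -> : f = (fun x => 1 * (f x - restr s f x) + restr s f x).
  by apply/funext => x; rewrite mul1r subrK.
rewrite (Llin _ _ _ _ _ hs hN) Lr// addr0 mul1r (le_trans (Lb _ _ hs))//.
apply: (@le_trans _ _ ((`|K| + 1) * (e / (`|K| + 1)))).
  by rewrite ler_wpM2r ?(ltW e10)// (le_trans (ler_norm K))// lerDl.
by rewrite mulrC divfK// gt_eqF// ltr_wpDl.
Qed.

Lemma ext_delta2 (A B : fn -> fn) :
  (forall a f g M N, nb m p f M -> nb m p g N -> A (fun x => a * f x + g x) = (fun x => a * A f x + A g x)) ->
  (forall a f g M N, nb m p f M -> nb m p g N -> B (fun x => a * f x + g x) = (fun x => a * B f x + B g x)) ->
  (forall x, exists K : R, forall f M, nb m p f M -> cmod (A f x) <= K * M) ->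
  (forall x, exists K : R, forall f M, nb m p f M -> cmod (B f x) <= K * M) ->
  (forall y, A (point_mass y) = B (point_mass y)) -> forall f M, nb m p f M -> A f = B f.
Proof.
move=> Alin Blin Ab Bb AB f M fM; apply/funext => x.
have [K hK] := Ab x; have [K' hK'] := Bb x.
apply/eqP; rewrite -subr_eq0; apply/eqP.
apply: (@ext_delta (fun f => A f x - B f x) (K + K') _ _ _ f M fM) => [a u v M1 M2 u1 v2|u M1 uM|y].
- by rewrite (Alin _ _ _ _ _ u1 v2) (Blin _ _ _ _ _ u1 v2); ring.
- by rewrite mulrDl (le_trans (cmodB _ _))// lerD ?hK ?hK'.
- by rewrite AB subrr.
Qed.

End Extension.

Section Pairing.

Lemma sbd_pairing f g M N : nb m 1%:E f M -> nb m +oo%E g N ->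
  sbd (fun x => cmod (f x * g x * (m x)%:C)) (M * N).
Proof.
move=> /(nb_fin m_ge0 _ _ (lexx 1))[M0 h] /nb_oo[N0 h'].
have := sbdZ N0 h; rewrite powRr1// mulrC; apply: sbd_le => // x.
rewrite powRr1 ?cmod_ge0// !cmodM cmod_real ger0_norm// [N * _]mulrC mulrAC ler_wpM2l//.
by rewrite mulr_ge0 ?cmod_ge0.
Qed.

Lemma cmod_pairing f g M N : nb m 1%:E f M -> nb m +oo%E g N -> cmod (pairing m f g) <= M * N.
Proof. by move=> fM gN; apply: cmod_csum; exact: sbd_pairing. Qed.

Lemma pairing_linl a f h g M M' N : nb m 1%:E f M -> nb m 1%:E h M' -> nb m +oo%E g N ->
  pairing m (fun x => a * f x + h x) g = a * pairing m f g + pairing m h g.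
Proof.
move=> fM hM gN.
have fa := Asum (sbd_pairing fM gN); have ha := Asum (sbd_pairing hM gN).
rewrite /pairing -csumZ// -csumD//; last exact: asumZ.
by apply: eq_csum => x; ring.
Qed.

Lemma pairing_linr a f g h M N N' : nb m 1%:E f M -> nb m +oo%E g N -> nb m +oo%E h N' ->
  pairing m f (fun x => a * g x + h x) = a * pairing m f g + pairing m f h.
Proof.
move=> fM gN hN.
have fa := Asum (sbd_pairing fM gN); have ha := Asum (sbd_pairing fM hN).
rewrite /pairing -csumZ// -csumD//; last exact: asumZ.
by apply: eq_csum => x; ring.
Qed.

Lemma pairing_delta y g : pairing m (point_mass y) g = g y * (m y)%:C.
Proof.
rewrite /pairing (@csum1 _ _ _ y) => [|z /negbTE zy]; rewrite /point_mass ?eqxx ?mul1r//.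
by rewrite zy !mul0r.
Qed.

(** For fixed bounded [g] both sides are bounded functionals of [f] in l^1, so no double series has
    to be exchanged: at a point mass the identity is the symmetry of [k]. *)
Lemma pairing_kop k C f g M N : schur_kernel k C -> nb m 1%:E f M -> nb m +oo%E g N ->
  pairing m (kop k f) g = pairing m f (kop k g).
Proof.
move=> kC fM gN; apply/eqP; rewrite -subr_eq0; apply/eqP.
have p1 : (1 <= 1%:E :> \bar R)%E by [].
have py : (1 <= +oo :> \bar R)%E by rewrite leey.
pose L f := pairing m (kop k f) g - pairing m f (kop k g).
rewrite -/(L f); apply: (@ext_delta 1 (lexx 1) L (C * N + C * N)) fM => [a u v M1 M2 u1 v2|u M1 u1|y].
- rewrite /L (kop_lin p1 kC _ u1 v2) (pairing_linl _ (nb_kop p1 kC u1) (nb_kop p1 kC v2) gN).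
  by rewrite (pairing_linl _ u1 v2 (nb_kop py kC gN)); ring.
- rewrite /L (le_trans (cmodB _ _))// mulrDl lerD//.
    by rewrite -mulrA [N * _]mulrC mulrA cmod_pairing//; exact: nb_kop.
  by rewrite mulrC cmod_pairing//; exact: nb_kop.
- rewrite /L pairing_delta; apply/eqP; rewrite subr_eq0; apply/eqP.
  rewrite /pairing /kop mulrC -csumZ; last exact: (asum_kop py kC y gN).
  apply: eq_csum => x; rewrite -/(kop k (point_mass y) x) kop_delta (schur_sym kC x y); ring.
Qed.

End Pairing.
End Kernels.

Opaque inner csum kop pairing lp_norm.

(** * Projections in form spaces *)

Section Completeness.
Variables (R : realType).

Lemma real_cauchy (a : nat -> R) :
  (forall e : R, 0 < e -> exists n0, forall n k, (n0 <= n)%N -> (n0 <= k)%N -> `|a n - a k| <= e) ->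
  exists l, forall e : R, 0 < e -> exists n0, forall n, (n0 <= n)%N -> `|l - a n| <= e.
Proof.
move=> h; have : cvg (a @ \oo).
  apply/cauchy_cvgP/cauchy_exP => e e0; have e20 : 0 < e / 2 by rewrite divr_gt0.
  have [n0 hn] := h _ e20; exists (a n0).
  exists n0 => // n /= nn; rewrite /ball /=.
  by rewrite (le_lt_trans (hn n0 n _ nn))// ltr_pdivrMr// ltr_pMr// ltr1n.
move=> /cvgrPdist_le ac; exists (lim (a @ \oo)) => e e0.
by have [n0 _ hn] := ac e e0; exists n0 => n nn; exact: hn.
Qed.

Lemma archi_inv (e : R) : 0 < e -> exists n : nat, (n.+1%:R : R)^-1 <= e.
Proof.
move=> e0; have ei : 0 <= e^-1 by rewrite invr_ge0 ltW.
exists (Num.bound e^-1); have hn := archi_boundP ei.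
by rewrite invf_ple ?posrE ?ltr0n// (le_trans (ltW hn))// ler_nat.
Qed.

Definition pcvg (X : Type) (u : nat -> X -> R[i]) (f : X -> R[i]) := forall x (e : R), 0 < e ->
  exists n0, forall n, (n0 <= n)%N -> cmod (f x - u n x) <= e.

Lemma complex_cauchy (z : nat -> R[i]) :
  (forall e : R, 0 < e -> exists n0, forall n k, (n0 <= n)%N -> (n0 <= k)%N -> cmod (z n - z k) <= e) ->
  exists l, forall e : R, 0 < e -> exists n0, forall n, (n0 <= n)%N -> cmod (l - z n) <= e.
Proof.
move=> h.
have [a ha] : exists l, forall e : R, 0 < e -> exists n0, forall n, (n0 <= n)%N -> `|l - complex.Re (z n)| <= e.
  apply: real_cauchy => e /h[n0 hn]; exists n0 => n k nn kn.
  by rewrite -ReB (le_trans (Re_le_cmod _))// hn.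
have [b hb] : exists l, forall e : R, 0 < e -> exists n0, forall n, (n0 <= n)%N -> `|l - complex.Im (z n)| <= e.
  apply: real_cauchy => e /h[n0 hn]; exists n0 => n k nn kn.
  rewrite (_ : _ - _ = complex.Im (z n - z k)) ?(le_trans (Im_le_cmod _)) ?hn//.
  by case: (z n); case: (z k).
exists (a +i* b) => e e0; have e20 : 0 < e / 2 by rewrite divr_gt0.
have [n1 h1] := ha _ e20; have [n2 h2] := hb _ e20; exists (maxn n1 n2) => n.
rewrite geq_max => /andP[/h1 l1 /h2 l2]; rewrite (le_trans (cmod_le_ReIm _))//.
have -> : e = e / 2 + e / 2 by field.
by move: l1 l2; case: (z n) => c d /=; exact: lerD.
Qed.

End Completeness.

Section Projection.
Variables (R : realType) (X : Type) (I : countType) (mu : I -> R).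
Hypothesis mu_ge0 : forall i, 0 <= mu i.
Local Notation fn := (X -> R[i]).
Local Notation n2 := (n2 mu).
Local Notation l2 := (l2 mu).
Variable Phi : fn -> (I -> R[i]).
Implicit Types (f g : fn) (a c : R[i]).
Hypothesis PhiL : forall (a : R[i]) (f g : fn), Phi (fun x => a * f x + g x) = (fun i => a * Phi f i + Phi g i).
Hypothesis Phi_pt : forall x, exists2 K : R, 0 < K & forall f M, nb mu 2%:E (Phi f) M -> cmod (f x) <= K * M.
Hypothesis Phi_cvg : forall (u : nat -> fn) (f : fn), pcvg u f -> pcvg (fun n => Phi (u n)) (Phi f).

Lemma PhiB f g : Phi (fun x => f x - g x) = (fun i => Phi f i - Phi g i).
Proof.
have -> : (fun x => f x - g x) = (fun x => -1 * g x + f x).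
  by apply/funext => x; rewrite mulN1r addrC.
by rewrite PhiL; apply/funext => i; rewrite mulN1r addrC.
Qed.

Lemma PhiD f g : Phi (fun x => f x + g x) = (fun i => Phi f i + Phi g i).
Proof.
have -> : (fun x => f x + g x) = (fun x => 1 * f x + g x).
  by apply/funext => x; rewrite mul1r.
by rewrite PhiL; apply/funext => i; rewrite mul1r.
Qed.

Lemma Phi0 : Phi (fun=> 0) = (fun=> 0).
Proof.
have -> : (fun=> 0) = (fun x : X => (0 : R[i]) - 0) by apply/funext => x; rewrite subrr.
by rewrite PhiB; apply/funext => i; rewrite subrr.
Qed.

Lemma PhiZ a f : Phi (fun x => a * f x) = (fun i => a * Phi f i).
Proof.
have -> : (fun x => a * f x) = (fun x => a * f x + 0) by apply/funext => x; rewrite addr0.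
by rewrite PhiL Phi0; apply/funext => i; rewrite addr0.
Qed.

(** Point evaluations are bounded by the norm of [Phi f], so a Cauchy sequence converges pointwise,
    and lower semicontinuity of the norm makes the limit a norm limit. For [Phi = gr] this is the
    closedness of the form. *)
Lemma Phi_complete (u : nat -> fn) : (forall n, l2 (Phi (u n))) ->
  (forall e : R, 0 < e -> exists n0, forall n k, (n0 <= n)%N -> (n0 <= k)%N ->
     nb mu 2%:E (Phi (fun x => u n x - u k x)) e) ->
  exists f, [/\ pcvg u f, l2 (Phi f) & forall e : R, 0 < e -> exists n0, forall n, (n0 <= n)%N ->
     nb mu 2%:E (Phi (fun x => f x - u n x)) e].
Proof.
move=> u2 uc.
have /choice[f uf] : forall x, exists l : R[i], forall e : R, 0 < e ->
    exists n0, forall n, (n0 <= n)%N -> cmod (l - u n x) <= e.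
  move=> x; apply: complex_cauchy => e e0.
  have [K K0 HK] := Phi_pt x; have eK : 0 < e / K by rewrite divr_gt0.
  have [n0 hn] := uc _ eK; exists n0 => n k nn kn.
  by rewrite (le_trans (HK _ _ (hn n k nn kn)))// mulrC divfK// gt_eqF.
have tail : forall e : R, 0 < e -> exists n0, forall n, (n0 <= n)%N ->
     nb mu 2%:E (Phi (fun x => f x - u n x)) e.
  move=> e e0; have [n0 hn] := uc _ e0; exists n0 => n nn.
  apply: (nb_seq_lim mu_ge0 (le12 R) (u := fun k => Phi (fun x => u (n0 + k)%N x - u n x))) => [k|].
    by apply: hn => //; rewrite leq_addr.
  apply: (Phi_cvg (u := fun k x => u (n0 + k)%N x - u n x)) => x d d0.
  have [k hk] := uf x d d0; exists k => j kj.
  have -> : f x - u n x - (u (n0 + j)%N x - u n x) = f x - u (n0 + j)%N x by ring.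
  by apply: hk; rewrite (leq_trans kj)// leq_addl.
exists f; split=> //.
have [n0 /(_ n0 (leqnn _)) h] := tail 1 ltr01.
have -> : Phi f = (fun i => Phi (fun x => f x - u n0 x) i + Phi (u n0) i).
  by rewrite PhiB; apply/funext => i; rewrite subrK.
by apply: l2D => //; exists 1.
Qed.

Lemma orth_min (k v : I -> R[i]) : l2 k -> l2 v ->
  (forall c, n2 k <= n2 (fun i => k i - c * v i)) -> inner mu k v = 0.
Proof.
move=> k2 v2 h; set z := inner mu k v.
have [//|zn0] := eqVneq z 0; exfalso.
have z0 : 0 < cmod z.
  by rewrite lt_def cmod_ge0 andbT; apply: contra_neq zn0 => /cmod_eq0.
(* Moving by [c = t z] changes the squared distance by [- t |z|^2 (2 - t |v|^2)]; this [t] keeps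
   [t |v|^2] at most 1, so the change is strictly negative. *)
pose t : R := (n2 v ^+ 2 + 1)^-1.
have d0 : 0 < n2 v ^+ 2 + 1 by rewrite ltr_wpDl// sqr_ge0.
have t0 : 0 < t by rewrite invr_gt0.
have E (w : R[i]) : n2 (fun i => k i + w * v i) ^+ 2 =
    n2 k ^+ 2 + 2 * complex.Re (w^* * z) + cmod w ^+ 2 * n2 v ^+ 2.
  by rewrite n2_sqrD// ?n2Z// ?innerZr// ?exprMn//; exact: l2Z.
have := h (t%:C * z); rewrite -(ler_pXn2r (ltn0Sn 1)) ?nnegrE ?n2_ge0//.
have -> : (fun i => k i - t%:C * z * v i) = (fun i => k i + - (t%:C * z) * v i).
  by apply/funext => i; rewrite mulNr.
rewrite (E (- (t%:C * z))) cmodN cmodM cmod_real (ger0_norm (ltW t0)).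
have -> : complex.Re ((- (t%:C * z))^* * z) = - (t * cmod z ^+ 2).
  by rewrite cmod_sqr; case: (z) => a b /=; ring.
rewrite !exprMn -subr_ge0.
have -> : n2 k ^+ 2 + 2 * - (t * cmod z ^+ 2) + t ^+ 2 * cmod z ^+ 2 * n2 v ^+ 2 - n2 k ^+ 2 =
   - (t * cmod z ^+ 2 * (2 - t * n2 v ^+ 2)) by ring.
rewrite oppr_ge0 leNgt mulr_gt0 ?mulr_gt0 ?exprn_gt0// subr_gt0.
rewrite (@le_lt_trans _ _ 1) ?ltr1n// /t ler_pdivrMl// mulr1 lerDl//.
Qed.

Variables (S : set fn) (P : fn -> fn) (h : I -> R[i]).
Hypothesis S0 : S (fun=> 0).
Hypothesis SL : forall (a : R[i]) (f g : fn), S f -> S g -> S (fun x => a * f x + g x).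
Hypothesis S2 : forall f, S f -> l2 (Phi f).
Hypothesis h2 : l2 h.
Hypothesis PS : forall f, S f -> S (P f) /\
  n2 (fun i => h i - Phi (P f) i) <= n2 (fun i => h i - Phi f i).

(** Nearest point to [h] in the closure of the image of the subspace [S]. The minimizing sequence is
    passed through [P], which does not increase the distance, so that the limit inherits closed
    constraints satisfied by all [P s]. It is used with [Phi = gr] for resolvents and with [Phi] the
    identity for ranges of [L - lam]. *)
Lemma projection : exists w : fn, [/\ l2 (Phi w),
  forall e : R, 0 < e -> exists2 s, S s & nb mu 2%:E (Phi (fun x => w x - P s x)) e &
  forall s, S s -> inner mu (fun i => h i - Phi w i) (Phi s) = 0].
Proof.
pose A := [set n2 (fun i => h i - Phi s i) | s in S].
have A0 : A !=set0 by exists (n2 (fun i => h i - Phi (fun=> 0) i)); exists (fun=> 0).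
have Alb : has_lbound A by exists 0 => _ [s _ <-]; exact: n2_ge0.
have hA : has_inf A by split.
set D := inf A.
have D0 : 0 <= D by apply: lb_le_inf => // _ [s _ <-]; exact: n2_ge0.
have hs2 s : S s -> l2 (fun i => h i - Phi s i) by move=> sS; apply: l2B => //; exact: S2.
have DS s : S s -> D <= n2 (fun i => h i - Phi s i).
  by move=> sS; apply: ge_inf => //; exists s.
have /choice[s hs] : forall n : nat, exists s : fn, S s /\ n2 (fun i => h i - Phi (P s) i) <= D + (n.+1%:R)^-1.
  move=> n; have n0 : 0 < (n.+1%:R : R)^-1 by rewrite invr_gt0 ltr0n.
  have [_ [s sS <-] hs] := inf_adherent n0 hA.
  by exists s; split=> //; have [_ le] := PS sS; rewrite (le_trans le)// ltW.
pose u n := P (s n).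
have uS n : S (u n) by have [sS _] := hs n; have [] := PS sS.
have ub n : n2 (fun i => h i - Phi (u n) i) <= D + (n.+1%:R)^-1 by have [_] := hs n.
have uc : forall e : R, 0 < e -> exists n0, forall n k, (n0 <= n)%N -> (n0 <= k)%N ->
     nb mu 2%:E (Phi (fun x => u n x - u k x)) e.
  (* Two members at distance at most [D + d] have midpoint at distance at least [D]; by the
     parallelogram law their squared distance is at most [4 (D + d)^2 - 4 D^2 <= d (8 D + 4)], as
     [d <= 1]. *)
  move=> e e0; pose d := Num.min 1 (e ^+ 2 / (8 * D + 4)).
  have d0 : 0 < d by rewrite lt_min ltr01 divr_gt0 ?exprn_gt0//; lra.
  have d1 : d <= 1 by rewrite ge_min lexx.
  have d2 : d * (8 * D + 4) <= e ^+ 2 by rewrite -ler_pdivlMr ?ge_min ?lexx ?orbT//; lra.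
  have [n0 hn0] := archi_inv d0.
  exists n0 => n k nn kn.
  have ubd j : (n0 <= j)%N -> n2 (fun i => h i - Phi (u j) i) <= D + d.
    by move=> nj; rewrite (le_trans (ub j))// lerD2l (le_trans _ hn0)// lef_pV2 ?posrE// ler_nat ltnS.
  have a2 := hs2 _ (uS n); have b2 := hs2 _ (uS k).
  have nk2 : l2 (Phi (fun x => u n x - u k x)) by rewrite PhiB; apply: l2B => //; exact: S2.
  apply: nb_n2P => //; rewrite -(ler_pXn2r (ltn0Sn 1)) ?nnegrE ?n2_ge0 ?(ltW e0)//.
  have := parallelogram mu_ge0 b2 a2.
  have -> : (fun i => h i - Phi (u k) i - (h i - Phi (u n) i)) = Phi (fun x => u n x - u k x).
    by rewrite PhiB; apply/funext => i; ring.
  have half2 : (2%:R^-1 : R)%:C * 2 = 1 :> R[i].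
    by rewrite -(rmorph_nat (real_complex R) 2) -rmorphM mulVf ?rmorph1.
  pose mid := fun x => (2%:R^-1 : R)%:C * u n x + (2%:R^-1 : R)%:C * u k x.
  have midS : S mid.
    apply: SL => //; have -> : (fun x => (2%:R^-1 : R)%:C * u k x) = (fun x => (2%:R^-1 : R)%:C * u k x + 0).
      by apply/funext => x; rewrite addr0.
    exact: SL.
  have -> : (fun i => h i - Phi (u k) i + (h i - Phi (u n) i)) = (fun i => 2%:R%:C * (h i - Phi mid i)).
    rewrite /mid PhiL PhiZ rmorph_nat; apply/funext => i.
    rewrite mulrBr mulrDr !mulrA ![2 * _%:C]mulrC half2; ring.
  rewrite n2Z//; last exact: hs2.
  rewrite cmod_real ger0_norm// => E.
  have l1 := DS _ midS; have k1 := ubd _ nn; have k2 := ubd _ kn.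
  have sq (a b : R) : 0 <= a -> a <= b -> a ^+ 2 <= b ^+ 2.
    by move=> a0 ab; rewrite ler_pXn2r ?nnegrE//; lra.
  have q1 := sq _ _ D0 l1; have q2 := sq _ _ (n2_ge0 _ _) k1; have q3 := sq _ _ (n2_ge0 _ _) k2.
  have : d * d <= d by rewrite ler_piMl// ltW.
  move: E q1 q2 q3 d2; rewrite !expr2; nra.
have [w [uw w2 wt]] := Phi_complete (fun n => S2 (uS n)) uc.
have wD v : S v -> D <= n2 (fun i => h i - Phi w i - Phi v i).
  move=> vS; apply/ler_addgt0Pr => e e0; have [n0 /(_ n0 (leqnn _)) hn] := wt _ e0.
  have uvS : S (fun x => u n0 x + v x).
    have -> : (fun x => u n0 x + v x) = (fun x => 1 * u n0 x + v x) by apply/funext => x; rewrite mul1r.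
    exact: SL.
  apply: (le_trans (DS _ uvS)); rewrite PhiD.
  have -> : (fun i => h i - (Phi (u n0) i + Phi v i)) =
      (fun i => (h i - Phi w i - Phi v i) + Phi (fun x => w x - u n0 x) i).
    by rewrite PhiB; apply/funext => i; ring.
  have v2 := S2 vS.
  have l1 : l2 (fun i => h i - Phi w i - Phi v i) by apply: l2B => //; exact: l2B.
  have l3 : l2 (Phi (fun x => w x - u n0 x)) by exists e.
  by rewrite (le_trans (n2D mu_ge0 l1 l3))// lerD2l n2_le.
exists w; split=> // [e e0|v vS].
  have [n0 /(_ n0 (leqnn _)) hn] := wt _ e0; exists (s n0) => //.
  by have [] := hs n0.
have hw2 : l2 (fun i => h i - Phi w i) by exact: l2B.
apply: orth_min => // [|c]; first exact: S2.
apply: (@le_trans _ _ D); last first.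
  have := wD (fun x => c * v x); rewrite PhiZ; apply.
  have -> : (fun x => c * v x) = (fun x => c * v x + 0) by apply/funext => x; rewrite addr0.
  exact: SL.
apply/ler_addgt0Pr => e e0; have e20 : 0 < e / 2 by rewrite divr_gt0.
have [n0 hn] := wt _ e20.
have [n1 hn1] := archi_inv e20.
set n := maxn n0 n1.
have -> : (fun i => h i - Phi w i) = (fun i => (h i - Phi (u n) i) - Phi (fun x => w x - u n x) i).
  by rewrite PhiB; apply/funext => i; ring.
have hn' := hn n (leq_maxl _ _).
have l3 : l2 (Phi (fun x => w x - u n x)) by exists (e / 2).
rewrite (le_trans (n2B mu_ge0 (hs2 _ (uS n)) l3))//.
have k1 := n2_le mu_ge0 hn'; have k2 := ub n.
have k3 : (n.+1%:R : R)^-1 <= n1.+1%:R^-1 by rewrite lef_pV2 ?posrE// ler_nat ltnS leq_maxr.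
have aux (a b c0 c1 d : R) : a <= D + c0 -> b <= d / 2 -> c0 <= c1 -> c1 <= d / 2 -> a + b <= D + d by lra.
exact: aux k2 k1 k3 hn1.
Qed.

End Projection.

(** * Radial truncation of complex values *)

Section Truncation.
Variables (R : realType) (M : R).
Hypothesis M_gt0 : 0 < M.
Implicit Types z w : R[i].

Definition trunc z : R[i] := if cmod z <= M then z else (M / cmod z)%:C * z.

Lemma trunc_le z : cmod (trunc z) <= M.
Proof.
rewrite /trunc; case: ifPn => //; rewrite -ltNge => zM.
have z0 : 0 < cmod z by exact: lt_trans zM.
by rewrite cmodM cmod_real ger0_norm ?divr_ge0 ?(ltW M_gt0) ?(ltW z0)// divfK// gt_eqF.
Qed.

Lemma cmod_sqrB z w : cmod (z - w) ^+ 2 = cmod z ^+ 2 + cmod w ^+ 2 - 2 * complex.Re (z * w^*).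
Proof. by rewrite !cmod_sqr; case: z => a b; case: w => c d /=; ring. Qed.

Lemma Re_mul_conj_le z w : complex.Re (z * w^*) <= cmod z * cmod w.
Proof. by rewrite (le_trans (ler_norm _))// (le_trans (Re_le_cmod _))// cmodM cmod_conj. Qed.

Let aux_one z w : cmod z <= M -> M < cmod w -> cmod (z - (M / cmod w)%:C * w) <= cmod (z - w).
Proof.
move=> zM Mw; have w0 : 0 < cmod w by exact: lt_trans Mw.
rewrite -(ler_pXn2r (ltn0Sn 1)) ?nnegrE ?cmod_ge0// !cmod_sqrB.
have -> : complex.Re (z * ((M / cmod w)%:C * w)^*) = M / cmod w * complex.Re (z * w^*).
  by case: (z) => a1 b1; case: (w) => c1 d1 /=; ring.
rewrite cmodM cmod_real ger0_norm ?divr_ge0 ?(ltW M_gt0) ?(ltW w0)// divfK ?gt_eqF//.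
have := Re_mul_conj_le z w; set rho := complex.Re _; set a := cmod z; set c := cmod w in w0 *.
move=> ra; have a0 : 0 <= a by exact: cmod_ge0.
have h : (c - M) * (rho / c) <= (c - M) * a.
  by rewrite ler_wpM2l ?ler_pdivrMr// subr_ge0 ltW.
rewrite -subr_ge0.
have -> : a ^+ 2 + c ^+ 2 - 2 * rho - (a ^+ 2 + M ^+ 2 - 2 * (M / c * rho)) =
  c ^+ 2 - M ^+ 2 - 2 * ((c - M) * (rho / c)) by field; rewrite gt_eqF.
have : 0 <= (c - M) * (c + M - 2 * a).
  by rewrite mulr_ge0 ?subr_ge0 ?(ltW Mw)//; move: zM Mw; rewrite -/a -/c; lra.
move: h; rewrite !expr2; nra.
Qed.

(** [trunc] is the nearest-point projection onto a disc, hence 1-Lipschitz. Truncating a function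
    therefore does not increase any difference [f x - f y], and so does not increase the form. *)
Lemma trunc_contr z w : cmod (trunc z - trunc w) <= cmod (z - w).
Proof.
rewrite /trunc; case: ifPn => zM; case: ifPn => // wM.
- by apply: aux_one => //; rewrite ltNge.
- by rewrite cmod_distC (cmod_distC z); apply: aux_one => //; rewrite ltNge.
move: zM wM; rewrite -!ltNge => zM wM.
have z0 : 0 < cmod z by exact: lt_trans zM.
have w0 : 0 < cmod w by exact: lt_trans wM.
rewrite -(ler_pXn2r (ltn0Sn 1)) ?nnegrE ?cmod_ge0// !cmod_sqrB.
have -> : complex.Re ((M / cmod z)%:C * z * ((M / cmod w)%:C * w)^*) =
    M / cmod z * (M / cmod w) * complex.Re (z * w^*).
  by case: (z) => a1 b1; case: (w) => c1 d1 /=; ring.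
rewrite !cmodM !cmod_real !ger0_norm ?divr_ge0 ?(ltW M_gt0) ?(ltW w0) ?(ltW z0)// !divfK ?gt_eqF//.
have := Re_mul_conj_le z w; set rho := complex.Re _; set a := cmod z in z0 zM *; set c := cmod w in w0 wM *.
move=> ra.
have M2 : M ^+ 2 <= a * c by rewrite expr2 ler_pM ?ltW.
have h : (a * c - M ^+ 2) * (rho / (a * c)) <= (a * c - M ^+ 2) * 1.
  by rewrite ler_wpM2l ?subr_ge0// ler_pdivrMr ?mulr_gt0// mul1r.
rewrite -subr_ge0.
have -> : a ^+ 2 + c ^+ 2 - 2 * rho - (M ^+ 2 + M ^+ 2 - 2 * (M / a * (M / c) * rho)) =
  a ^+ 2 + c ^+ 2 - 2 * M ^+ 2 - 2 * ((a * c - M ^+ 2) * (rho / (a * c))) by field; rewrite !gt_eqF.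
have : 0 <= (a - c) ^+ 2 by exact: sqr_ge0.
move: h; rewrite !expr2; nra.
Qed.

Lemma trunc0 : trunc 0 = 0.
Proof. by rewrite /trunc mulr0 if_same. Qed.

Lemma trunc_id z : cmod z <= M -> trunc z = z.
Proof. by rewrite /trunc => ->. Qed.

End Truncation.

(** * Sums over disjoint unions *)

Section SumTypes.
Variables (R : realType) (I J : choiceType).

Definition lefts (t : seq (I + J)) : seq I := pmap (fun k => if k is inl i then Some i else None) t.
Definition rights (t : seq (I + J)) : seq J := pmap (fun k => if k is inr i then Some i else None) t.

Lemma mem_lefts t i : (i \in lefts t) = (inl i \in t).
Proof. by elim: t => [//|[k|k] t IH] /=; rewrite !inE ?IH. Qed.

Lemma mem_rights t i : (i \in rights t) = (inr i \in t).
Proof. by elim: t => [//|[k|k] t IH] /=; rewrite !inE ?IH. Qed.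

Lemma uniq_lefts t : uniq t -> uniq (lefts t).
Proof. by elim: t => [//|[k|k] t IH] /= /andP[kt /IH ut]//; rewrite mem_lefts kt. Qed.

Lemma uniq_rights t : uniq t -> uniq (rights t).
Proof. by elim: t => [//|[k|k] t IH] /= /andP[kt /IH ut]//; rewrite mem_rights kt. Qed.

Lemma sum_split (V : zmodType) (F : I + J -> V) t :
  \sum_(k <- t) F k = \sum_(i <- lefts t) F (inl i) + \sum_(j <- rights t) F (inr j).
Proof.
elim: t => [|[k|k] t IH]; first by rewrite !big_nil addr0.
  by rewrite [lefts _]/= [rights _]/= !big_cons IH addrA.
by rewrite [lefts _]/= [rights _]/= !big_cons IH addrCA.
Qed.

Lemma sbd_split (F : I + J -> R) A B : sbd (fun i => F (inl i)) A -> sbd (fun j => F (inr j)) B -> sbd F (A + B).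
Proof. by move=> FA FB t ut; rewrite sum_split lerD ?FA ?FB ?uniq_lefts ?uniq_rights. Qed.

Lemma sbd_inl (F : I + J -> R) A : sbd F A -> sbd (fun i => F (inl i)) A.
Proof. by move=> FA t ut; have := FA (map inl t); rewrite big_map map_inj_uniq; [exact|move=> ? ? []]. Qed.

Lemma sbd_inr (F : I + J -> R) A : sbd F A -> sbd (fun i => F (inr i)) A.
Proof. by move=> FA t ut; have := FA (map inr t); rewrite big_map map_inj_uniq; [exact|move=> ? ? []]. Qed.

Lemma csum_split (F : I + J -> R[i]) : asum F -> csum F = csum (fun i => F (inl i)) + csum (fun j => F (inr j)).
Proof.
move=> Fa; apply: csumE => // e e0; have e20 : 0 < e / 2 by rewrite divr_gt0.
have [A FA] := Fa.
have [s us hs] := csumsP (Asum (sbd_inl FA)) e20.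
have [t ut ht] := csumsP (Asum (sbd_inr FA)) e20.
exists (map inl s ++ map inr t) => [|r ur sr].
  rewrite cat_uniq !map_inj_uniq ?us ?ut//= ?andbT; try by move=> ? ? [].
  by apply/hasPn => k /mapP[j _ ->]; apply/negP => /mapP[].
rewrite sum_split opprD addrACA (le_trans (cmodD _ _))//.
have h1 := hs (lefts r) (uniq_lefts ur) _.
have h2 := ht (rights r) (uniq_rights ur) _.
have {}h1 := h1 (fun i (is1 : i \in s) => ltac:(by rewrite mem_lefts sr// mem_cat map_f)).
have {}h2 := h2 (fun i (is1 : i \in t) => ltac:(by rewrite mem_rights sr// mem_cat [X in _ || X]map_f ?orbT)).
lra.
Qed.

Lemma esum_split (F : I + J -> \bar R) : (forall k, (0 <= F k)%E) ->
  (\esum_(k in [set: I + J]) F k = \esum_(i in [set: I]) F (inl i) + \esum_(j in [set: J]) F (inr j))%E.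
Proof.
move=> F0; rewrite (esumID (range inl))// !setTI.
have -> : ~` range inl = range (@inr I J).
  apply/seteqP; split=> [[i|j] /= h|_ [j _ <-] [i _]//]; last by exists j.
  by exfalso; apply: h; exists i.
rewrite !esum_image//; by move=> ? ? _ _ [].
Qed.

Lemma esumZ_gt0 (F : I -> \bar R) (a : R) : 0 < a -> (forall k, (0 <= F k)%E) ->
  (\esum_(k in [set: I]) (a%:E * F k) = a%:E * \esum_(k in [set: I]) F k)%E.
Proof.
have le (b : R) (H : I -> \bar R) : 0 < b -> (forall k, (0 <= H k)%E) ->
    (\esum_(k in [set: I]) (b%:E * H k) <= b%:E * \esum_(k in [set: I]) H k)%E.
  move=> b0 H0; apply: ge_ereal_sup => _ [S finS <-].
  rewrite -ge0_mule_fsumr// lee_pmul2l// ?lte_fin//.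
  by apply: ereal_sup_ubound; exists S.
move=> a0 F0; apply/eqP; rewrite eq_le le//=.
have ai : 0 < a^-1 by rewrite invr_gt0.
rewrite -(@lee_pmul2l _ a^-1%:E)// ?lte_fin// muleA -EFinM mulVf ?gt_eqF// mul1e.
rewrite (le_trans _ (le _ _ ai _))//; last by move=> k; rewrite mule_ge0// lee_fin ltW.
by apply: le_esum => k _; rewrite muleA -EFinM mulVf ?gt_eqF// mul1e.
Qed.

End SumTypes.

(** * The form and its operator on l^2 *)

Section Forms.
Variables (R : realType) (X : countType) (m : X -> R) (G : graph R X).
Hypothesis m_gt0 : forall x, 0 < m x.
Local Notation fn := (X -> R[i]).
Local Notation b := (edge_weight G).
Local Notation c := (killing G).
Implicit Types (f g h : fn) (t e M : R) (a : R[i]).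

Let m_ge0 x : 0 <= m x. Proof. exact: ltW. Qed.

Let R01 : 0 <= 1 :> R. Proof. exact: ler01. Qed.

Definition form_index : countType := ((X * X) + (X + X))%type.

(* [gr] embeds the form domain isometrically: the l^2 norm of [gr f] with weight
   [form_weight t] is [t Q(f,f) + |f|^2]. *)
Definition form_weight t (k : form_index) : R :=
  match k with
  | inl xy => t * (2^-1 * b xy.1 xy.2)
  | inr (inl x) => t * c x
  | inr (inr x) => m x
  end.

Definition gr f (k : form_index) : R[i] :=
  match k with
  | inl xy => f xy.1 - f xy.2
  | inr (inl x) => f x
  | inr (inr x) => f x
  end.

Lemma form_weight_ge0 t : 0 <= t -> forall k, 0 <= form_weight t k.
Proof.
move=> t0 [[x y]|[x|x]] //=; first by rewrite !mulr_ge0 ?edge_weight_ge0 ?invr_ge0.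
by rewrite mulr_ge0 ?killing_ge0.
Qed.

Lemma gr_lin a f g : gr (fun x => a * f x + g x) = (fun k => a * gr f k + gr g k).
Proof. by apply/funext => -[[x y]|[x|x]] //=; ring. Qed.

Lemma gr_cvg (u : nat -> fn) f : pcvg u f -> pcvg (fun n => gr (u n)) (gr f).
Proof.
move=> uf [[x y]|[x|x]] e e0; try exact: uf.
have e20 : 0 < e / 2 by rewrite divr_gt0.
have [n1 h1] := uf x _ e20; have [k2 h2] := uf y _ e20; exists (maxn n1 k2) => n.
rewrite geq_max => /andP[/h1 l1 /h2 l2] /=.
have -> : f x - f y - (u n x - u n y) = (f x - u n x) - (f y - u n y) by ring.
rewrite (le_trans (cmodB _ _))//; lra.
Qed.

Lemma nb_gr t f M : 0 <= t -> nb (form_weight t) 2%:E (gr f) M -> nb m 2%:E f M.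
Proof.
move=> t0 /(nb2P (form_weight_ge0 t0))[M0 h]; apply/(nb2P m_ge0); split=> //.
exact: sbd_inr (sbd_inr h).
Qed.

Lemma gr_pt t : 0 <= t -> forall x, exists2 K : R, 0 < K &
  forall f M, nb (form_weight t) 2%:E (gr f) M -> cmod (f x) <= K * M.
Proof.
move=> t0 x; have [K K0 HK] := nb_pt m_ge0 (le12 R) (m_gt0 x).
by exists K => // f M /(nb_gr t0); exact: HK.
Qed.

Lemma nb_weight (I : countType) (w w' : I -> R) (C : R) (f : I -> R[i]) M :
  (forall i, 0 <= w i) -> (forall i, 0 <= w' i) -> 0 <= C -> (forall i, w' i <= C ^+ 2 * w i) ->
  nb w 2%:E f M -> nb w' 2%:E f (C * M).
Proof.
move=> w0 w0' C0 ww /(nb2P w0)[M0 h]; apply/(nb2P w0'); split; first exact: mulr_ge0.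
rewrite exprMn; apply: sbd_le (sbdZ (sqr_ge0 C) h) => // i.
by rewrite [leRHS]mulrCA ler_wpM2l ?sqr_ge0.
Qed.

(** The square of [t / s + 1] dominates both the ratio [t / s] of the edge and killing weights and
    the ratio 1 of the masses. So all positive [t] give equivalent norms. *)
Lemma form_weight_change s t f M : 0 < s -> 0 <= t -> nb (form_weight s) 2%:E (gr f) M ->
  nb (form_weight t) 2%:E (gr f) ((t / s + 1) * M).
Proof.
move=> s0 t0; have q0 : 0 <= t / s by rewrite divr_ge0// ltW.
apply: nb_weight; [exact/form_weight_ge0/ltW|exact: form_weight_ge0|lra|].
have le (y : R) : 0 <= y -> t * y <= (t / s + 1) ^+ 2 * (s * y).
  move=> y0; have -> : t * y = (t / s) * (s * y) by field; rewrite gt_eqF.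
  by rewrite ler_wpM2r ?mulr_ge0 ?(ltW s0)//; rewrite expr2; nra.
move=> [[x y]|[x|x]] /=; first by apply: le; rewrite mulr_ge0 ?invr_ge0 ?edge_weight_ge0.
  by apply: le; exact: killing_ge0.
by rewrite ler_peMl//; rewrite expr2; nra.
Qed.

Lemma l2_gr_weight s t f : 0 < s -> 0 <= t -> l2 (form_weight s) (gr f) -> l2 (form_weight t) (gr f).
Proof. by move=> s0 t0 [M fM]; exists ((t / s + 1) * M); exact: form_weight_change. Qed.

Lemma l2_gr t f : 0 <= t -> l2 (form_weight t) (gr f) -> l2 m f.
Proof. by move=> t0 [M /(nb_gr t0) fM]; exists M. Qed.

(* [Defs.energy] parses as [1/2 (sum over edges + killing sum)]: the killing term carries
   an extra factor 1/2, which replaces the form norm by an equivalent one. *)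
Definition energy_weight (k : form_index) : R :=
  match k with
  | inl xy => 2^-1 * b xy.1 xy.2
  | inr (inl x) => 2^-1 * c x
  | inr (inr x) => m x
  end.

Lemma energy_weight_ge0 k : 0 <= energy_weight k.
Proof.
by case: k => [[x y]|[x|x]] //=; rewrite mulr_ge0 ?edge_weight_ge0 ?killing_ge0 ?invr_ge0.
Qed.

Lemma form_norm_lp f : form_norm m G f = lp_norm energy_weight 2%:E (gr f).
Proof.
have p2 (z : R[i]) : cmod z `^ 2 = cmod z ^+ 2 by rewrite powR_mulrn ?cmod_ge0.
rewrite /form_norm !lp_norm_fin.
congr (poweR _ _).
rewrite -poweRrM mulVf ?pnatr_eq0// poweRe1; last first.
  by apply: esum_ge0 => x _; rewrite lee_fin mulr_ge0 ?powR_ge0.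
rewrite esum_split; last by move=> k; rewrite lee_fin mulr_ge0 ?powR_ge0 ?energy_weight_ge0.
rewrite esum_split; last by move=> k; rewrite lee_fin mulr_ge0 ?powR_ge0 ?energy_weight_ge0.
have A0 : (0 <= \esum_(xy in [set: X * X]) (b xy.1 xy.2 * cmod (f xy.1 - f xy.2) ^+ 2)%:E)%E.
  by apply: esum_ge0 => k _; rewrite lee_fin mulr_ge0 ?edge_weight_ge0 ?sqr_ge0.
have B0 : (0 <= \esum_(x in [set: X]) (c x * cmod (f x) ^+ 2)%:E)%E.
  by apply: esum_ge0 => k _; rewrite lee_fin mulr_ge0 ?killing_ge0 ?sqr_ge0.
rewrite /energy ge0_muleDr//; rewrite -addeA; congr (_ + (_ + _))%E.
- rewrite -esumZ_gt0 ?invr_gt0//; last first.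
    by move=> k; rewrite lee_fin mulr_ge0 ?edge_weight_ge0 ?sqr_ge0.
  by apply: eq_esum => -[x y] _ /=; rewrite -EFinM p2; congr (_%:E); ring.
- rewrite -esumZ_gt0 ?invr_gt0//; last first.
    by move=> k; rewrite lee_fin mulr_ge0 ?killing_ge0 ?sqr_ge0.
  by apply: eq_esum => x _ /=; rewrite -EFinM p2; congr (_%:E); ring.
Qed.

(** [energy_weight] has only half the killing weight, so the constant must have square at least
    2. *)
Lemma form_norm_lt f e : 0 < e -> (form_norm m G f < e%:E)%E ->
  nb (form_weight 1) 2%:E (gr f) (2 * e).
Proof.
move=> e0; rewrite form_norm_lp => h.
have : nb energy_weight 2%:E (gr f) e by split; exact: ltW.
apply: nb_weight => //; [exact: energy_weight_ge0|exact: form_weight_ge0|].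
move=> [[x y]|[x|x]] /=; rewrite ?mul1r.
- by rewrite ler_peMl ?mulr_ge0 ?invr_ge0 ?edge_weight_ge0//; rewrite expr2; lra.
- have := killing_ge0 G x; rewrite expr2; lra.
- have := m_ge0 x; rewrite expr2; lra.
Qed.

Lemma lt_form_norm f e e' : e < e' -> nb (form_weight 1) 2%:E (gr f) e -> (form_norm m G f < e'%:E)%E.
Proof.
move=> ee' h; rewrite form_norm_lp; have : nb energy_weight 2%:E (gr f) (1 * e).
  apply: nb_weight h => //; [exact: form_weight_ge0|exact: energy_weight_ge0|].
  move=> [[x y]|[x|x]] /=; rewrite expr1n !mul1r//.
  have := killing_ge0 G x; lra.
by rewrite mul1r => -[_ h']; rewrite (le_lt_trans h')// lte_fin.
Qed.

Lemma energy_delta y : l2 (form_weight 1) (gr (point_mass R y)).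
Proof.
have [B hB] : exists B, sbd (fun z => b y z) B.
  by apply/sbd_fin; [exact: edge_weight_ge0|exact: edge_weight_summable].
have w0 := form_weight_ge0 R01.
have p1 (w : R) : 0 <= w -> sbd (fun x : X => if x == y then w else 0) w.
  move=> w0' s us; rewrite -big_mkcond /=; have [ys|ys] := boolP (y \in s).
    rewrite (perm_big _ (perm_to_rem ys)) big_cons eqxx big1_seq => [|x /andP[/eqP ->]].
      by rewrite /= addr0.
    by rewrite mem_rem_uniq// inE eqxx.
  by rewrite big1_seq// => x /andP[/eqP -> ys']; rewrite ys' in ys.
have d1 (w : X -> R) x : 0 <= w x -> cmod (point_mass R y x) ^+ 2 * w x <= if x == y then w y else 0.
  by rewrite /point_mass; have [->|_] := eqVneq x y; rewrite ?cmod1 ?cmod0 ?expr1n ?expr0n ?mul1r ?mul0r.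
have e1 : sbd (fun q : X * X => if q.1 == y then b y q.2 else 0) B.
  move=> s us; rewrite -big_mkcond -big_filter -(big_map snd xpredT) /=; apply: hB.
  rewrite map_inj_in_uniq ?filter_uniq// => -[x1 y1] [x2 y2].
  by rewrite !mem_filter /= => /andP[/eqP -> _] /andP[/eqP -> _] ->.
have e2 : sbd (fun q : X * X => if q.2 == y then b y q.1 else 0) B.
  move=> s us; rewrite -big_mkcond -big_filter -(big_map fst xpredT) /=; apply: hB.
  rewrite map_inj_in_uniq ?filter_uniq// => -[x1 y1] [x2 y2].
  by rewrite !mem_filter /= => /andP[/eqP -> _] /andP[/eqP -> _] ->.
suff [A hA] : exists A, sbd (fun k => cmod (gr (point_mass R y) k) ^+ 2 * form_weight 1 k) A.
  exists (Num.sqrt A); apply/(nb2P w0); split; first exact: sqrtr_ge0.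
  by rewrite sqr_sqrtr//; exact: sbd_ge0 hA.
(* Only edges at [y] contribute, and each occurs in both orientations; [B] bounds the sum of [b y z]
   over [z]. *)
exists ((B + B) + (c y + m y)); apply: sbd_split; last first.
  apply: sbd_split.
    apply: sbd_le (p1 _ (@killing_ge0 _ _ G y)) => // x /=; rewrite mul1r; apply: d1.
    exact: killing_ge0.
  by apply: sbd_le (p1 _ (m_ge0 y)) => // x /=; exact: d1.
apply: sbd_le (sbdD e1 e2) => // -[x z] /=.
have b0 := edge_weight_ge0 G; rewrite mul1r /point_mass.
have [->|xy] := eqVneq x y; have [->|zy] := eqVneq z y.
- by rewrite subrr cmod0 expr0n mul0r addr_ge0.
- by rewrite subr0 cmod1 expr1n mul1r addr0 ler_piMl// invf_le1 ?ltr0n// ler1n.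
- by rewrite sub0r cmodN cmod1 expr1n mul1r add0r edge_weight_sym ler_piMl// invf_le1 ?ltr0n// ler1n.
- by rewrite subrr cmod0 expr0n mul0r addr0.
Qed.

Lemma Cc_gr t f : 0 <= t -> Cc f -> l2 (form_weight t) (gr f).
Proof.
move=> t0 /Cc_restr[s us ->]; apply: (l2_gr_weight ltr01 t0).
have w0 := form_weight_ge0 R01.
elim: s us => [_|y s IH /= /andP[ys us]].
  rewrite restr_nil (_ : gr _ = fun=> 0); first exact: l20.
  by apply/funext => -[[x y]|[x|x]] //=; rewrite subrr.
rewrite restr_cons// gr_lin; apply: l2D => //; last exact: IH.
by apply: l2Z => //; exact: energy_delta.
Qed.

Lemma Cc_lin a f g : Cc f -> Cc g -> Cc (fun x => a * f x + g x).
Proof.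
move=> Cf Cg; apply: (@sub_finite_set _ _ ([set x | f x != 0] `|` [set x | g x != 0])).
  move=> x /=; have [->|fx _] := eqVneq (f x) 0; last by left.
  by rewrite mulr0 add0r => gx; right.
by rewrite finite_setU.
Qed.

Lemma Cc0 : Cc (fun _ : X => 0 : R[i]).
Proof. by rewrite -(restr_nil (fun=> 0)); exact: restr_Cc. Qed.

(** Approximability in the form norm by finitely supported functions already forces square
    summability and finite energy, because these functions have finite form norm. *)
Lemma form_domainP f : form_domain m G f <-> forall e, 0 < e ->
  exists2 phi, Cc phi & nb (form_weight 1) 2%:E (gr (fun x => f x - phi x)) e.
Proof.
split=> [[_ _ h] e e0|h].
  have e20 : 0 < e / 2 by rewrite divr_gt0.
  have [phi Cphi /(form_norm_lt e20)] := h _ e20; rewrite mulrC divfK ?pnatr_eq0// => hphi.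
  by exists phi.
have w0 := form_weight_ge0 R01.
have fl2 : l2 (form_weight 1) (gr f).
  have [phi Cphi hphi] := h 1 ltr01.
  have -> : f = (fun x => 1 * (f x - phi x) + phi x) by apply/funext => x; rewrite mul1r subrK.
  rewrite gr_lin; apply: l2D => //; last exact: Cc_gr.
  by apply: l2Z => //; exists 1.
split.
- by apply/lpP; have [M hM] := l2_gr R01 fl2; exists M.
- have [M hM] := fl2; have MM : M < M + 1 by rewrite ltrDl.
  have {hM} := lt_form_norm MM hM; rewrite /form_norm => hM.
  have : (poweR (energy G f + poweR (lp_norm m 2%:E f) 2) 2^-1 < +oo)%E by rewrite (lt_trans hM)// ltry.
  move=> /lty_poweRy; rewrite invr_eq0 pnatr_eq0 => /(_ isT); apply: le_lt_trans.
  by rewrite leeDl// poweR_ge0.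
- move=> e e0; have e20 : 0 < e / 2 by rewrite divr_gt0.
  have [phi Cphi hphi] := h _ e20; exists phi => //; apply: lt_form_norm hphi.
  by rewrite ltr_pdivrMr// ltr_pMr// ltr1n.
Qed.

End Forms.

(** * The operator of the form, and its resolvent as a minimizer *)

Section Laplacian.
Variables (R : realType) (X : countType) (m : X -> R) (G : graph R X).
Hypothesis m_gt0 : forall x, 0 < m x.
Local Notation fn := (X -> R[i]).
Local Notation FD := (form_domain m G).
Local Notation W := (form_weight m G).
Local Notation lap := (laplacian2 m G).
Implicit Types (f g h u v : fn) (t e M : R) (a : R[i]).

Let m_ge0 x : 0 <= m x. Proof. exact: ltW. Qed.
Let R01 : 0 <= 1 :> R. Proof. exact: ler01. Qed.
Let W0 t : 0 <= t -> forall k, 0 <= W t k. Proof. exact: form_weight_ge0. Qed.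
Let W10 : forall k, 0 <= W 1 k. Proof. exact: W0. Qed.

Lemma grB f g : gr (fun x => f x - g x) = (fun k => gr f k - gr g k).
Proof. by apply/funext => -[[x y]|[x|x]] //=; ring. Qed.

Lemma FD_gr t f : 0 <= t -> FD f -> l2 (W t) (gr f).
Proof.
move=> t0 /(form_domainP G m_gt0) h; apply: (l2_gr_weight m_gt0 ltr01 t0).
have [phi Cphi hphi] := h 1 ltr01.
have -> : f = (fun x => 1 * (f x - phi x) + phi x) by apply/funext => x; rewrite mul1r subrK.
rewrite gr_lin; apply: (l2D W10); last exact: Cc_gr.
by apply: (l2Z W10); exists 1.
Qed.

Lemma FD_l2 f : FD f -> l2 m f.
Proof. by move=> /(FD_gr R01); exact: l2_gr. Qed.

Lemma FD_lin a f g : FD f -> FD g -> FD (fun x => a * f x + g x).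
Proof.
move=> /(form_domainP G m_gt0) hf /(form_domainP G m_gt0) hg; apply/(form_domainP G m_gt0) => e e0.
have a0 := cmod_ge0 a.
have e10 : 0 < e / (cmod a + 1) by rewrite divr_gt0// ltr_wpDl.
have [p1 C1 h1] := hf _ e10; have [p2 C2 h2] := hg _ e10.
exists (fun x => a * p1 x + p2 x); first exact: Cc_lin.
have -> : (fun x => a * f x + g x - (a * p1 x + p2 x)) = (fun x => a * (f x - p1 x) + (g x - p2 x)).
  by apply/funext => x; ring.
rewrite gr_lin.
have -> : e = cmod a * (e / (cmod a + 1)) + e / (cmod a + 1) by field; rewrite gt_eqF// ltr_wpDl.
by apply: (nbD W10 (le12 R)) => //; exact: (nbZ W10 (le12 R)).
Qed.

Lemma Cc_FD f : Cc f -> FD f.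
Proof.
move=> Cf; apply/(form_domainP G m_gt0) => e e0; exists f => //.
apply: (nb_le W10 (le12 R) (ltW e0)).
rewrite (_ : gr _ = fun=> 0); first exact: (nb0 W10 (le12 R)).
by apply/funext => -[[x y]|[x|x]] //=; rewrite !subrr ?subrr.
Qed.

Lemma FD_eqD f g : FD f -> FD g -> FD (fun x => f x + g x).
Proof.
move=> fD gD; rewrite (_ : (fun x => _) = (fun x => 1 * f x + g x)); first exact: FD_lin.
by apply/funext => x; rewrite mul1r.
Qed.

Lemma FDB f g : FD f -> FD g -> FD (fun x => f x - g x).
Proof.
move=> fD gD; rewrite (_ : (fun x => _) = (fun x => -1 * g x + f x)); first exact: FD_lin.
by apply/funext => x; rewrite mulN1r addrC.
Qed.

(** Unlike [energy], [qform] carries the full killing weight, in agreement with [form_weight]. *)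
Lemma formE t f g : 0 <= t -> l2 (W 1) (gr f) -> l2 (W 1) (gr g) ->
  inner (W t) (gr f) (gr g) = t%:C * qform G f g + inner m f g.
Proof.
move=> t0 f1 g1.
have ft := l2_gr_weight m_gt0 ltr01 t0 f1; have gt := l2_gr_weight m_gt0 ltr01 t0 g1.
have [A FA] := asum_inner (W0 t0) ft gt.
have [A1 FA1] := asum_inner W10 f1 g1.
rewrite !innerE csum_split; last by exists A.
rewrite csum_split; last by exists A; exact: (sbd_inr FA).
rewrite /= addrA; congr (_ + _).
rewrite /qform mulrDr; congr (_ + _).
  rewrite mulrA -csumZ.
    apply: eq_csum => -[x y] /=; rewrite !rmorphM /= -[2^-1 in RHS](_ : (2^-1 : R)%:C = _); last first.
      by rewrite fmorphV rmorph_nat.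
    ring.
  have := asumZ (2%:R%:C) (Asum (sbd_inl FA1)); apply: asum_le => -[x y] /=.
  rewrite !cmodM !cmod_real !cmod_conj mul1r.
  rewrite le_eqVlt; apply/orP; left; apply/eqP.
  rewrite normrM (ger0_norm (_ : 0 <= 2)) ?ler0n// (ger0_norm (_ : 0 <= 2^-1)) ?invr_ge0 ?ler0n//.
  by field.
rewrite -csumZ.
  by apply: eq_csum => x /=; rewrite !rmorphM /=; ring.
apply: asum_le (Asum (sbd_inl (sbd_inr FA1))) => x /=.
by rewrite !cmodM !cmod_real !cmod_conj mul1r le_eqVlt; apply/orP; left; apply/eqP; ring.
Qed.

(** With [inner m f h] added on both sides the form becomes the inner product of an l^2 space, so
    that symmetry, positivity and approximation are Hilbert space statements. *)
Lemma lapP f g : lap (f, g) <->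
  [/\ FD f, l2 m g & forall h, FD h -> inner (W 1) (gr f) (gr h) = inner m g h + inner m f h].
Proof.
split=> [[/= fD /l2_lp g2 h]|[fD g2 h]]; split=> //=.
- by move=> k kD; rewrite formE ?mul1r ?h//; exact: FD_gr.
- exact/l2_lp.
- move=> k kD; have := h k kD; rewrite formE ?mul1r; [|by []|exact: FD_gr|exact: FD_gr].
  exact: addIr.
Qed.

Lemma lap_l2 f g : lap (f, g) -> l2 m f /\ l2 m g.
Proof. by move=> /lapP[fD g2 _]; split=> //; exact: FD_l2. Qed.

Lemma lap_lin a f g f' g' : lap (f, g) -> lap (f', g') ->
  lap (fun x => a * f x + f' x, fun x => a * g x + g' x).
Proof.
move=> /lapP[fD g2 h] /lapP[fD' g2' h']; apply/lapP; split; first exact: FD_lin.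
  by apply: (l2D m_ge0) => //; exact: (l2Z m_ge0).
move=> k kD; have k2 := FD_l2 kD; have f2 := FD_l2 fD; have f2' := FD_l2 fD'.
have K := FD_gr R01 kD; have F := FD_gr R01 fD; have F' := FD_gr R01 fD'.
have aF := l2Z W10 a F; have af := l2Z m_ge0 a f2; have ag := l2Z m_ge0 a g2.
rewrite gr_lin (innerDl W10 aF F' K) (innerZl W10 _ F K) h// h'//.
rewrite (innerDl m_ge0 ag g2' k2) (innerZl m_ge0 _ g2 k2).
by rewrite (innerDl m_ge0 af f2' k2) (innerZl m_ge0 _ f2 k2); ring.
Qed.

Lemma lap_sym f g f' g' : lap (f, g) -> lap (f', g') -> inner m g f' = inner m f g'.
Proof.
move=> /lapP[fD g2 h] /lapP[fD' g2' h'].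
have f2 := FD_l2 fD; have f2' := FD_l2 fD'.
have F := FD_gr R01 fD; have F' := FD_gr R01 fD'.
have := h _ fD'; have := h' _ fD.
rewrite -(inner_conj W10 F F') -(inner_conj m_ge0 f2 g2') -(inner_conj m_ge0 f2 f2').
move=> E1 E2; move: E1; rewrite E2 rmorphD /=; move/eqP; rewrite -subr_eq0.
have -> : (inner m g f')^* + (inner m f f')^* - ((inner m f g')^* + (inner m f f')^*) =
  (inner m g f' - inner m f g')^* by rewrite rmorphB /=; ring.
by rewrite conjc_eq0 subr_eq0 => /eqP.
Qed.

Lemma n2_gr f : FD f -> n2 m f <= n2 (W 1) (gr f).
Proof.
move=> fD; apply: (n2_le m_ge0); apply: (nb_gr m_gt0 R01).
exact: (nb_n2 W10 (FD_gr R01 fD)).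
Qed.

Lemma lap_pos f g : lap (f, g) -> inner m g f = (n2 (W 1) (gr f) ^+ 2 - n2 m f ^+ 2)%:C.
Proof.
move=> /lapP[fD g2 h]; have := h _ fD.
rewrite (inner_n2 W10 (FD_gr R01 fD)) (inner_n2 m_ge0 (FD_l2 fD)) => E.
by rewrite rmorphB /= E addrK.
Qed.

Lemma lap_pos_ge0 f g : lap (f, g) -> 0 <= n2 (W 1) (gr f) ^+ 2 - n2 m f ^+ 2.
Proof.
move=> /lapP[fD _ _]; rewrite subr_ge0 ler_pXn2r ?nnegrE ?n2_ge0//; exact: n2_gr.
Qed.

(** Pairing [f + t L f] with [f] gives [|f|^2 + t Q(f, f)], which is at least [|f|^2]. *)
Lemma lap_contr f g t : 0 <= t -> lap (f, g) -> n2 m f <= n2 m (fun x => f x + t%:C * g x).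
Proof.
move=> t0 L; have [f2 g2] := lap_l2 L.
have tg2 := l2Z m_ge0 t%:C g2; have s2 := l2D m_ge0 f2 tg2.
have E : inner m (fun x => f x + t%:C * g x) f = (n2 m f ^+ 2 + t * (n2 (W 1) (gr f) ^+ 2 - n2 m f ^+ 2))%:C.
  by rewrite (innerDl m_ge0 f2 tg2 f2) (innerZl m_ge0 _ g2 f2) (lap_pos L) (inner_n2 m_ge0 f2) -rmorphM -rmorphD.
have := cmod_inner_n2 m_ge0 s2 f2; rewrite E cmod_real ger0_norm; last first.
  by rewrite addr_ge0 ?sqr_ge0// mulr_ge0// (lap_pos_ge0 L).
move=> le; have := lap_pos_ge0 L; set q := _ - _ => q0.
have [->|fn0] := eqVneq (n2 m f) 0; first exact: n2_ge0.
have f0 : 0 < n2 m f by rewrite lt_def fn0 n2_ge0.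
by rewrite -(ler_pM2r f0) -expr2; apply: le_trans le; rewrite lerDl mulr_ge0.
Qed.

Lemma n2_eq0 f : l2 m f -> n2 m f <= 0 -> f = (fun=> 0).
Proof.
move=> f2 f0; apply/funext => x; have [K K0 HK] := nb_pt m_ge0 (le12 R) (m_gt0 x).
apply: cmod_eq0; apply/eqP; rewrite eq_le cmod_ge0 andbT.
by rewrite -(mulr0 K) HK//; exact: (nb_n2P m_ge0).
Qed.

Lemma lap_uniq f g f' g' t : 0 <= t -> lap (f, g) -> lap (f', g') ->
  (forall x, f x + t%:C * g x = f' x + t%:C * g' x) -> f = f'.
Proof.
move=> t0 L L' E; have D := lap_lin (-1) L' L.
have [d2 _] := lap_l2 D; have := lap_contr t0 D.
rewrite [X in n2 m X <= n2 m _ -> _](_ : _ = fun x => -1 * f' x + f x)//.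
rewrite [X in _ <= n2 m X](_ : _ = fun=> 0); last first.
  apply/funext => x; have -> : -1 * f' x + f x + t%:C * (-1 * g' x + g x) =
    (f x + t%:C * g x) - (f' x + t%:C * g' x) by ring.
  by rewrite E subrr.
rewrite (n20 m_ge0) => /(n2_eq0 d2) /funeqP h; apply/funext => x.
by apply/eqP; rewrite -subr_eq0 addrC -mulN1r; apply/eqP; exact: h.
Qed.

Lemma inner_delta f y : inner m f (point_mass R y) = f y * (m y)%:C.
Proof.
have c1 : (1 : R[i])^* = 1 by exact: conj_realC.
have c0 : (0 : R[i])^* = 0 by exact: conj_realC.
rewrite innerE (@csum1 _ _ _ y) => [|z /negbTE zy]; rewrite /point_mass ?eqxx ?c1 ?mulr1//.
by rewrite zy c0 mulr0 mul0r.
Qed.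

Lemma m_neq0 y : (m y)%:C != 0 :> R[i].
Proof. by rewrite (inj_eq (@complexI R)) gt_eqF. Qed.

Section Resolvent.
Variables (t : R) (t_gt0 : 0 < t) (f : fn) (f2 : l2 m f).

(** Placing [f] in the mass component alone makes the squared distance from [target] to [gr u] equal
    to [t Q(u, u) + |f - u|^2], whose minimizer is [(1 + t L)^-1 f]. *)
Definition target (k : form_index X) : R[i] := if k is inr (inr x) then f x else 0.

Lemma target_l2 : l2 (W t) target.
Proof.
have [M /(nb2P m_ge0)[M0 h]] := f2; exists M; apply/(nb2P (W0 (ltW t_gt0))); split=> //.
rewrite -[M ^+ 2]add0r; apply: sbd_split => [s us|]; first by rewrite big1// => i _; rewrite cmod0 expr0n mul0r.
rewrite -[M ^+ 2]add0r; apply: sbd_split => [s us|//]; by rewrite big1// => i _; rewrite cmod0 expr0n mul0r.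
Qed.

Lemma inner_target h : l2 (W t) (gr h) -> inner (W t) target (gr h) = inner m f h.
Proof.
move=> h2; have [A FA] := asum_inner (W0 (ltW t_gt0)) target_l2 h2.
rewrite !innerE csum_split; last by exists A.
rewrite csum_split; last by exists A; exact: (sbd_inr FA).
have z (I : countType) (F : I -> R[i]) : csum (fun i => 0 * F i) = 0.
  have [|_ ->] := @csum_fin R I (fun i => 0 * F i) [::] isT; last by rewrite big_nil.
  by move=> i _; rewrite mul0r.
rewrite (_ : csum _ = 0); last by rewrite -[RHS](z _ (fun xy => (gr h (inl xy))^* * (W t (inl xy))%:C)); apply: eq_csum => k; rewrite mulrA.
rewrite (_ : csum _ = 0); last by rewrite -[RHS](z _ (fun x => (gr h (inr (inl x)))^* * (W t (inr (inl x)))%:C)); apply: eq_csum => k; rewrite mulrA.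
by rewrite !add0r.
Qed.

(** The projection gives orthogonality to finitely supported functions; approximation in the form
    norm extends it to the form domain. That the minimizer is a limit of the functions [P s] puts it
    into the form domain. *)
Lemma resolvent_proj (P : fn -> fn) :
  (forall s, Cc s -> Cc (P s) /\
     n2 (W t) (fun k => target k - gr (P s) k) <= n2 (W t) (fun k => target k - gr s k)) ->
  exists u, [/\ FD u, (forall v, FD v -> inner (W t) (fun k => target k - gr u k) (gr v) = 0) &
    forall e, 0 < e -> exists2 s, Cc s & nb (W t) 2%:E (gr (fun x => u x - P s x)) e].
Proof.
move=> PC; have t0 := ltW t_gt0.
have [u [u2 ua uo]] := projection (W0 t0) (@gr_lin R X) (gr_pt G m_gt0 t0) (@gr_cvg R X)
   (Cc0 R X) (@Cc_lin R X) (fun f Cf => Cc_gr G m_gt0 t0 Cf) target_l2 PC.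
have uD : FD u.
  apply/(form_domainP G m_gt0) => e e0.
  have c0 : 0 < 1 / t + 1 by rewrite addr_gt0// divr_gt0.
  have e10 : 0 < e / (1 / t + 1) by rewrite divr_gt0.
  have [s Cs hs] := ua _ e10; exists (P s); first by have [] := PC _ Cs.
  have := form_weight_change m_gt0 t_gt0 R01 hs; rewrite mulrC divfK// gt_eqF//.
exists u; split=> // v vD.
have r2 : l2 (W t) (fun k => target k - gr u k) by apply: (l2B (W0 t0)) => //; exact: target_l2.
apply: cmod_le0 => e e0.
have n0 := n2_ge0 (W t) (fun k => target k - gr u k).
have d0 : 0 < n2 (W t) (fun k => target k - gr u k) + 1 by rewrite ltr_wpDl.
have q0 : 0 < t / 1 + 1 by rewrite divr1 addr_gt0.
have e10 : 0 < e / (n2 (W t) (fun k => target k - gr u k) + 1) / (t / 1 + 1) by rewrite !divr_gt0.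
have [s Cs hs] := (form_domainP G m_gt0 v).1 vD _ e10.
have {hs} := form_weight_change m_gt0 ltr01 t0 hs; rewrite mulrC divfK ?gt_eqF// => hs.
have s2 : l2 (W t) (gr s) by exact: Cc_gr.
have vs2 : l2 (W t) (gr (fun x => v x - s x)) by eexists; exact: hs.
have -> : gr v = (fun k => gr (fun x => v x - s x) k + gr s k).
  by rewrite grB; apply/funext => k; rewrite subrK.
rewrite (innerDr (W0 t0) vs2 s2 r2) (uo s Cs) addr0.
rewrite (le_trans (cmod_inner (W0 t0) (nb_n2 (W0 t0) r2) hs))//.
rewrite mulrCA ler_piMr ?(ltW e0)// ler_pdivrMr// mul1r lerDl//.
Qed.

Lemma resolvent_weak u : FD u ->
  (forall v, FD v -> inner (W t) (fun k => target k - gr u k) (gr v) = 0) ->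
  lap (u, fun x => (t^-1)%:C * (f x - u x)).
Proof.
move=> uD uo; have t0 := ltW t_gt0; have u2 := FD_l2 uD.
have g2 : l2 m (fun x => (t^-1)%:C * (f x - u x)).
  by apply: (l2Z m_ge0); exact: (l2B m_ge0).
split=> //=; first exact/l2_lp.
move=> h hD; have h2 := FD_l2 hD; have := uo h hD.
have U := FD_gr t0 uD; have H := FD_gr t0 hD.
rewrite (innerBl (W0 t0) (target_l2) U H) (inner_target H) (formE t0 (FD_gr R01 uD) (FD_gr R01 hD)).
move=> /eqP; rewrite subr_eq0 => /eqP E.
rewrite (innerZl m_ge0 _ (l2B m_ge0 f2 u2) h2) (innerBl m_ge0 f2 u2 h2) E addrK mulrA -rmorphM.
by rewrite mulVf ?gt_eqF// rmorph1 mul1r.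
Qed.

(** The estimate compares the minimizer with the competitor [f], at which the functional is
    [t Q(f, f)]. It gives the convergence of [(1 + t L)^-1 f] to [f] as [t] tends to 0
    ([J_close]). *)
Lemma resolvent_exists : exists u, lap (u, fun x => (t^-1)%:C * (f x - u x)) /\
  (FD f -> n2 m (fun x => f x - u x) ^+ 2 <= t * n2 (W 1) (gr f) ^+ 2).
Proof.
have t0 := ltW t_gt0.
have [|u [uD uo _]] := @resolvent_proj (fun s => s); first by [].
exists u; split; first exact: resolvent_weak.
move=> fD; have F := FD_gr t0 fD; have U := FD_gr t0 uD; have T := target_l2.
have d2 : l2 (W t) (gr (fun x => u x - f x)) by exact: FD_gr t0 (FDB uD fD).
have r2 : l2 (W t) (fun k => target k - gr u k) by exact: (l2B (W0 t0)).
have := n2_sqrD (W0 t0) r2 d2; rewrite (uo _ (FDB uD fD)) mulr0 addr0.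
rewrite (_ : (fun k => _ + _) = (fun k => target k - gr f k)); last first.
  by rewrite grB; apply/funext => k; ring.
move=> E.
have n1 : n2 m (fun x => f x - u x) ^+ 2 <= n2 (W t) (gr (fun x => u x - f x)) ^+ 2.
  rewrite (n2_distC m_ge0 f2 (FD_l2 uD)) ler_pXn2r ?nnegrE ?n2_ge0//.
  by apply: (n2_le m_ge0); apply: (nb_gr m_gt0 t0); exact: (nb_n2 (W0 t0)).
have n3 : n2 (W t) (fun k => target k - gr f k) <= Num.sqrt t * n2 (W 1) (gr f).
  apply: (n2_le (W0 t0)); apply/(nb2P (W0 t0)); split; first by rewrite mulr_ge0 ?sqrtr_ge0 ?n2_ge0.
  have /(nb2P W10) [_ h] := nb_n2 W10 (FD_gr R01 fD).
  rewrite exprMn sqr_sqrtr//; apply: sbd_le (sbdZ t0 h) => // k.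
  case: k => [[x y]|[x|x]] /=.
  - by rewrite sub0r cmodN le_eqVlt; apply/orP; left; apply/eqP; ring.
  - by rewrite sub0r cmodN le_eqVlt; apply/orP; left; apply/eqP; ring.
  - by rewrite subrr cmod0 expr0n mul0r mulr_ge0// mulr_ge0 ?sqr_ge0.
have n4 : n2 (W t) (fun k => target k - gr f k) ^+ 2 <= t * n2 (W 1) (gr f) ^+ 2.
  by rewrite -[X in X * _](sqr_sqrtr t0) -exprMn ler_pXn2r ?nnegrE ?n2_ge0// mulr_ge0 ?sqrtr_ge0 ?n2_ge0.
by apply: (le_trans n1); apply: le_trans n4; rewrite E lerDr sqr_ge0.
Qed.

(* Truncating the members of a minimizing sequence at height [M] does not increase the
   functional, so the minimizer is also bounded by [M]. *)
Lemma resolvent_bounded M : 0 < M -> (forall x, cmod (f x) <= M) ->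
  exists2 u, lap (u, fun x => (t^-1)%:C * (f x - u x)) & forall x, cmod (u x) <= M.
Proof.
move=> M0 fM; have t0 := ltW t_gt0.
have [s Cs|u [uD uo ua]] := @resolvent_proj (fun s x => trunc M (s x)).
  have CT : Cc (fun x => trunc M (s x)).
    by apply: sub_finite_set Cs => x /=; apply: contra_neq => ->; rewrite trunc0.
  split=> //.
  have [|_ //] := @n2_mono _ _ _ (W0 t0) (fun k => target k - gr (fun x => trunc M (s x)) k)
    (fun k => target k - gr s k) _ (l2B (W0 t0) target_l2 (Cc_gr G m_gt0 t0 Cs)).
  move=> [[x y]|[x|x]] /=.
  - by rewrite !sub0r !cmodN trunc_contr.
  - by have := trunc_contr M0 0 (s x); rewrite trunc0.
  - by rewrite -{1}(trunc_id (fM x)) trunc_contr.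
exists u; first exact: resolvent_weak.
move=> x; apply/ler_addgt0Pr => e e0.
have [K K0 HK] := gr_pt G m_gt0 t0 x.
have e10 : 0 < e / K by rewrite divr_gt0.
have [s Cs /HK hs] := ua _ e10.
rewrite (le_trans (cmod_dist _ (trunc M (s x))))// lerD ?trunc_le//.
by rewrite (le_trans hs)// mulrC divfK// gt_eqF.
Qed.

End Resolvent.

Lemma conj_nb (I : countType) (w : I -> R) (w0 : forall i, 0 <= w i) (q : \bar R) (f : I -> R[i]) M :
  (1 <= q)%E -> nb w q f M -> nb w q (fun i => (f i)^*) M.
Proof. by move=> q1; apply: (nb_mono w0 q1) => // i; rewrite cmod_conj. Qed.

Lemma inner_conjC (I : countType) (w : I -> R) (w0 : forall i, 0 <= w i) (f g : I -> R[i]) :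
  l2 w f -> l2 w g -> inner w (fun i => (f i)^*) (fun i => (g i)^*) = (inner w f g)^*.
Proof.
move=> f2 g2; rewrite !innerE -csum_conj; last exact: asum_inner.
apply: eq_csum => i; case: (f i) => a1 b1; case: (g i) => c1 d1.
by apply/eqP; rewrite eq_complex /=; apply/andP; split; apply/eqP; ring.
Qed.

Lemma l2_conj (I : countType) (w : I -> R) (w0 : forall i, 0 <= w i) (f : I -> R[i]) :
  l2 w f -> l2 w (fun i => (f i)^*).
Proof. by move=> [M fM]; exists M; exact: conj_nb. Qed.

Lemma gr_conj f : gr (fun x => (f x)^*) = (fun k => (gr f k)^*).
Proof. by apply/funext => -[[x y]|[x|x]] //=; rewrite rmorphB. Qed.

Lemma FD_conj f : FD f -> FD (fun x => (f x)^*).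
Proof.
move=> /(form_domainP G m_gt0) h; apply/(form_domainP G m_gt0) => e e0.
have [s Cs hs] := h _ e0; exists (fun x => (s x)^*).
  by apply: sub_finite_set Cs => x /=; apply: contra_neq => ->; rewrite rmorph0.
rewrite (_ : (fun x => _ - _) = (fun x => (f x - s x)^*)); last by apply/funext => x; rewrite rmorphB.
by rewrite gr_conj; exact: conj_nb.
Qed.

(** The form has real coefficients. Together with selfadjointness this makes the kernels of
    functions of [L] symmetric rather than Hermitian, as [schur_kernel] asks. *)
Lemma lap_conj f g : lap (f, g) -> lap (fun x => (f x)^*, fun x => (g x)^*).
Proof.
move=> /lapP[fD g2 h]; apply/lapP; split; [exact: FD_conj|exact: l2_conj|].
move=> k kD; have kD' := FD_conj kD.
have -> : k = (fun x => ((k x)^*)^*) by apply/funext => x; rewrite conjCK.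
rewrite !gr_conj (inner_conjC W10 (FD_gr R01 fD) (l2_conj W10 (FD_gr R01 kD))).
have k2' := FD_l2 kD'.
rewrite (inner_conjC m_ge0 g2 k2') (inner_conjC m_ge0 (FD_l2 fD) k2') -rmorphD -h//.
by rewrite gr_conj.
Qed.

End Laplacian.

Opaque form_domain laplacian2 gr form_weight.

(** * Resolvents and the heat semigroup on l^2 *)

(* [J m G t] is the resolvent [(1 + t L)^-1] on l^2. *)
HB.lock Definition J (R : realType) (X : countType) (m : X -> R) (G : graph R X) (t : R)
    (f : X -> R[i]) : X -> R[i] :=
  xget f [set u | laplacian2 m G (u, fun x => (t^-1)%:C * (f x - u x))].

Section ResolventOperators.
Variables (R : realType) (X : countType) (m : X -> R) (G : graph R X).
Hypothesis m_gt0 : forall x, 0 < m x.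
Local Notation fn := (X -> R[i]).
Local Notation lap := (laplacian2 m G).
Local Notation J := (J m G).
Local Notation n2w := n2.
Local Notation n2 := (n2 m).
Local Notation l2 := (l2 m).
Implicit Types (f g h u v : fn) (s t e M : R) (a : R[i]).

Let m_ge0 x : 0 <= m x. Proof. exact: ltW. Qed.

Lemma JP t f : 0 < t -> l2 f -> lap (J t f, fun x => (t^-1)%:C * (f x - J t f x)).
Proof.
move=> t0 f2; rewrite J.unlock; case: xgetP => [u -> //|]; have [u [uL _]] := resolvent_exists G m_gt0 t0 f2.
by move=> /(_ u) [].
Qed.

Lemma realK t (z : R[i]) : 0 < t -> t%:C * ((t^-1)%:C * z) = z.
Proof. by move=> t0; rewrite mulrA -rmorphM divff ?gt_eqF// rmorph1 mul1r. Qed.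

Lemma J_eq t u g f : 0 < t -> l2 f -> lap (u, g) -> (forall x, f x = u x + t%:C * g x) -> J t f = u.
Proof.
move=> t0 f2 uL E; apply: (lap_uniq m_gt0 (ltW t0) (JP t0 f2) uL) => x.
by rewrite realK// -E addrC subrK.
Qed.

Lemma lap_lapP t f : 0 < t -> l2 f -> exists2 g, lap (J t f, g) & forall x, f x = J t f x + t%:C * g x.
Proof.
move=> t0 f2; exists (fun x => (t^-1)%:C * (f x - J t f x)); first exact: JP.
by move=> x; rewrite realK// addrC subrK.
Qed.

Lemma J_l2 t f : 0 < t -> l2 f -> l2 (J t f).
Proof. by move=> t0 f2; have [] := lap_l2 m_gt0 (JP t0 f2). Qed.

Lemma J_contr t f : 0 < t -> l2 f -> n2 (J t f) <= n2 f.
Proof.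
move=> t0 f2; have := lap_contr m_gt0 (ltW t0) (JP t0 f2).
rewrite [X in _ <= n2 X](_ : _ = f)//.
by apply/funext => x; rewrite realK// addrC subrK.
Qed.

Lemma J_lin t a f g : 0 < t -> l2 f -> l2 g ->
  J t (fun x => a * f x + g x) = (fun x => a * J t f x + J t g x).
Proof.
move=> t0 f2 g2; have [f' Lf Ef] := lap_lapP t0 f2; have [g' Lg Eg] := lap_lapP t0 g2.
apply: (J_eq t0 _ (lap_lin m_gt0 a Lf Lg)); first by apply: (l2D m_ge0) => //; exact: l2Z.
by move=> x; rewrite Ef Eg; ring.
Qed.

Lemma lap_ext f g f' g' : f =1 f' -> g =1 g' -> lap (f, g) -> lap (f', g').
Proof. by move=> /funext -> /funext ->. Qed.

Lemma lap_B a f g f' g' : lap (f, g) -> lap (f', g') ->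
  lap (fun x => f x + a * f' x, fun x => g x + a * g' x).
Proof.
by move=> L L'; apply: lap_ext (lap_lin m_gt0 a L' L) => x; rewrite addrC.
Qed.

Lemma J_lap t f g : 0 < t -> lap (f, g) ->
  lap (J t f, J t g) /\ forall x, f x = J t f x + t%:C * J t g x.
Proof.
move=> t0 L; have [f2 g2] := lap_l2 m_gt0 L; have [w Lw Ew] := lap_lapP t0 g2.
have L' := lap_B (- t%:C) L Lw.
have E : J t f = (fun x => f x + - t%:C * J t g x).
  apply: (J_eq t0 f2 L') => x; rewrite Ew; ring.
rewrite E; split; last by move=> x; ring.
by apply: lap_ext L' => x //; rewrite Ew; ring.
Qed.

Lemma J_comm s t f : 0 < s -> 0 < t -> l2 f -> J s (J t f) = J t (J s f).
Proof.
move=> s0 t0 f2; have [w Lw Ew] := lap_lapP t0 f2; have [L' _] := J_lap s0 Lw.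
have [Jf2 w2] := lap_l2 m_gt0 Lw.
symmetry; apply: (J_eq t0 (J_l2 s0 f2) L') => x.
have -> : J s f = J s (fun x => t%:C * w x + J t f x).
  by congr (J s _); apply/funext => y; rewrite Ew addrC.
by rewrite J_lin// addrC.
Qed.

(** From [(1 + s L)(1 + t L) = 1 + (s + t) L + s t L^2]. The difference is of second order in the
    steps, which is what makes the Euler scheme converge. *)
Lemma J_prod s t f g h : 0 < s -> 0 < t -> lap (f, g) -> lap (g, h) -> forall x,
  J (s + t) f x - J s (J t f) x = (s * t)%:C * J (s + t) (J s (J t h)) x.
Proof.
move=> s0 t0 L1 L2 x; have st0 : 0 < s + t by rewrite addr_gt0.
have [L1' E1] := J_lap t0 L1; have [L2' E2] := J_lap t0 L2.
have [L1'' E1'] := J_lap s0 L1'; have [L2'' E2'] := J_lap s0 L2'.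
have [b1 b2] := lap_l2 m_gt0 L1''; have [_ b3] := lap_l2 m_gt0 L2''.
set b := J s (J t f) in L1'' b1 *.
have E : f = (fun x => (s * t)%:C * J s (J t h) x + (b x + (s + t)%:C * J s (J t g) x)).
  have stM : (s * t)%:C = s%:C * t%:C :> R[i] by rewrite rmorphM.
  have stD : (s + t)%:C = s%:C + t%:C :> R[i] by rewrite rmorphD.
  by apply/funext => y; rewrite (E1 y) (E1' y) (E2' y) -/b stM stD; ring.
rewrite [in J (s + t) f]E J_lin//; last by apply: (l2D m_ge0) => //; exact: l2Z.
have -> : J (s + t) (fun x => b x + (s + t)%:C * J s (J t g) x) = b.
  by apply: (J_eq st0 _ L1'') => //; apply: (l2D m_ge0) => //; exact: l2Z.
ring.
Qed.

Lemma J_bounded t f M : 0 < t -> l2 f -> 0 < M -> (forall x, cmod (f x) <= M) ->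
  forall x, cmod (J t f x) <= M.
Proof.
move=> t0 f2 M0 fM; have [u uL uM] := resolvent_bounded G m_gt0 t0 f2 M0 fM.
rewrite (_ : J t f = u)//; apply: (J_eq t0 f2 uL) => x; by rewrite realK// addrC subrK.
Qed.

Lemma J_sym t f g : 0 < t -> l2 f -> l2 g -> inner m (J t f) g = inner m f (J t g).
Proof.
move=> t0 f2 g2; have [f' Lf Ef] := lap_lapP t0 f2; have [g' Lg Eg] := lap_lapP t0 g2.
have [Jf f'2] := lap_l2 m_gt0 Lf; have [Jg g'2] := lap_l2 m_gt0 Lg.
rewrite [in LHS](_ : g = fun x => J t g x + t%:C * g' x); last exact/funext.
rewrite [in RHS](_ : f = fun x => J t f x + t%:C * f' x); last exact/funext.
have tc : (t%:C)^* = t%:C :> R[i] by exact: conj_realC.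
rewrite (innerDr m_ge0 Jg (l2Z m_ge0 _ g'2) Jf) (innerZr m_ge0 _ g'2 Jf) tc.
by rewrite (innerDl m_ge0 Jf (l2Z m_ge0 _ f'2) Jg) (innerZl m_ge0 _ f'2 Jg) (lap_sym m_gt0 Lf Lg).
Qed.

Lemma J_close f e : form_domain m G f -> 0 < e -> exists2 t, 0 < t & n2 (fun x => f x - J t f x) <= e.
Proof.
move=> fD e0; have f2 := FD_l2 m_gt0 fD.
set K := n2w (form_weight m G 1) (gr f) ^+ 2.
have K0 : 0 <= K by exact: sqr_ge0.
have t0 : 0 < e ^+ 2 / (K + 1) by rewrite divr_gt0 ?exprn_gt0// ltr_wpDl.
exists (e ^+ 2 / (K + 1)) => //.
have [u [uL /(_ fD) h]] := resolvent_exists G m_gt0 t0 f2.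
rewrite (_ : J _ f = u); last by apply: (J_eq t0 f2 uL) => x; rewrite realK// addrC subrK.
rewrite -(ler_pXn2r (ltn0Sn 1)) ?nnegrE ?n2_ge0 ?(ltW e0)// (le_trans h)// -/K.
by rewrite -mulrA ler_piMr ?sqr_ge0// mulrC ler_pdivrMr ?ltr_wpDl// mul1r lerDl.
Qed.

(** A finitely supported function lies in the form domain, where small resolvents are close to the
    identity; applying two of them lands in the domain of [L^2]. *)
Lemma lap_domain_sqr_dense f e : l2 f -> 0 < e ->
  exists f' g h, [/\ lap (f', g), lap (g, h) & n2 (fun x => f x - f' x) <= e].
Proof.
move=> f2 e0; have e30 : 0 < e / 3 by rewrite divr_gt0.
have [M fM] := f2.
have [s us hs] := nb_dens m_ge0 (ler1n R 2) fM e30.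
have sD : form_domain m G (restr s f) by apply: Cc_FD => //; exact: restr_Cc.
have s2 := FD_l2 m_gt0 sD.
have [t t0 ht] := J_close sD e30.
have [w Lw Ew] := lap_lapP t0 s2.
have [JD _ _] := (lapP G m_gt0 _ _).1 Lw.
have [t' t0' ht'] := J_close JD e30.
have [L1 E1] := J_lap t0' Lw; have [J2 w2] := lap_l2 m_gt0 Lw.
have [h Lh _] := lap_lapP t0' w2.
exists (J t' (J t (restr s f))), (J t' w), h; split=> //.
have d1 : l2 (fun x => f x - restr s f x) by exact: l2B.
have d2 : l2 (fun x => restr s f x - J t (restr s f) x) by exact: l2B.
have [JJ2 _] := lap_l2 m_gt0 L1.
have d3 : l2 (fun x => J t (restr s f) x - J t' (J t (restr s f)) x) by exact: l2B.
rewrite (_ : (fun x => _ - _) = (fun x => (f x - restr s f x) + ((restr s f x - J t (restr s f) x) +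
  (J t (restr s f) x - J t' (J t (restr s f)) x)))); last by apply/funext => x; ring.
have -> : e = e / 3 + (e / 3 + e / 3) by field.
rewrite (le_trans (n2D m_ge0 d1 (l2D m_ge0 d2 d3)))// lerD//; first exact: n2_le.
by rewrite (le_trans (n2D m_ge0 d2 d3))// lerD.
Qed.

End ResolventOperators.

(** * Iterates of resolvents *)

Section EulerIterates.
Variables (R : realType) (X : countType) (m : X -> R) (G : graph R X).
Hypothesis m_gt0 : forall x, 0 < m x.
Local Notation fn := (X -> R[i]).
Local Notation lap := (laplacian2 m G).
Local Notation J := (J m G).
Local Notation n2 := (n2 m).
Local Notation l2 := (l2 m).
Implicit Types (f g h u v : fn) (s t e M : R) (a : R[i]) (n k N : nat).

Let m_ge0 x : 0 <= m x. Proof. exact: ltW. Qed.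

Lemma iter_l2 t N f : 0 < t -> l2 f -> l2 (iter N (J t) f).
Proof. by move=> t0 f2; elim: N => //= N; exact: J_l2. Qed.

Lemma iter_contr t N f : 0 < t -> l2 f -> n2 (iter N (J t) f) <= n2 f.
Proof. by move=> t0 f2; elim: N => //= N IH; rewrite (le_trans _ IH)// J_contr//; exact: iter_l2. Qed.

Lemma iter_lin t N a f g : 0 < t -> l2 f -> l2 g ->
  iter N (J t) (fun x => a * f x + g x) = (fun x => a * iter N (J t) f x + iter N (J t) g x).
Proof. by move=> t0 f2 g2; elim: N => //= N ->; rewrite J_lin//; exact: iter_l2. Qed.

Lemma iter_lap t N f g : 0 < t -> lap (f, g) -> lap (iter N (J t) f, iter N (J t) g).
Proof. by move=> t0 L; elim: N => //= N IH; have [] := J_lap m_gt0 t0 IH. Qed.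

Lemma iter_bounded t N f M : 0 < t -> l2 f -> 0 < M -> (forall x, cmod (f x) <= M) ->
  forall x, cmod (iter N (J t) f x) <= M.
Proof. by move=> t0 f2 M0 fM; elim: N => //= N IH; apply: J_bounded => //; exact: iter_l2. Qed.

Lemma iter_sym t N f g : 0 < t -> l2 f -> l2 g ->
  inner m (iter N (J t) f) g = inner m f (iter N (J t) g).
Proof.
move=> t0; elim: N f g => //= N IH f g f2 g2; rewrite J_sym//; last exact: iter_l2.
by rewrite IH//; [rewrite -iterS iterSr|exact: J_l2].
Qed.

Lemma iter_J_comm s t N f : 0 < s -> 0 < t -> l2 f -> iter N (J s) (J t f) = J t (iter N (J s) f).
Proof. by move=> s0 t0 f2; elim: N => //= N ->; rewrite J_comm//; exact: iter_l2. Qed.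

(** Replacing [J (s + t)] by [J s J t] costs [s t M] per factor, and contractivity keeps the errors
    from growing, so the [N] factors cost [N] times as much. *)
Lemma iter_J_diff s t N f g h M : 0 < s -> 0 < t -> lap (f, g) -> lap (g, h) -> n2 h <= M ->
  n2 (fun x => iter N (J (s + t)) f x - iter N (J s) (iter N (J t) f) x) <= N%:R * (s * t * M).
Proof.
move=> s0 t0 L1 L2 hM; have st0 : 0 < s + t by rewrite addr_gt0.
have [f2 g2] := lap_l2 m_gt0 L1; have [_ h2] := lap_l2 m_gt0 L2.
have stC : cmod (s * t)%:C = s * t by rewrite cmod_real ger0_norm// mulr_ge0 ?ltW.
elim: N => [|N IH]; first by rewrite mul0r (_ : (fun x => _) = fun=> 0) ?n20//; apply/funext => x; rewrite /= subrr.
set A := iter N (J (s + t)) f in IH *; set B := iter N (J s) (iter N (J t) f) in IH *.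
have A2 : l2 A by exact: iter_l2.
have B2 : l2 B by apply: iter_l2 => //; exact: iter_l2.
have LB := iter_lap N s0 (iter_lap N t0 L1); have LB' := iter_lap N s0 (iter_lap N t0 L2).
have [_ h'2] := lap_l2 m_gt0 LB'.
have E : iter N.+1 (J s) (iter N.+1 (J t) f) = J s (J t B).
  by rewrite /= iter_J_comm//; exact: iter_l2.
have AB2 : l2 (fun x => A x - B x) by exact: (l2B m_ge0).
set hN := iter N (J s) (iter N (J t) h) in LB' h'2.
have h3 : l2 (J (s + t) (J s (J t hN))) by do 3 (apply: J_l2 => //).
have -> : (fun x => iter N.+1 (J (s + t)) f x - iter N.+1 (J s) (iter N.+1 (J t) f) x) =
  (fun x => J (s + t) (fun x => A x - B x) x + (s * t)%:C * J (s + t) (J s (J t hN)) x).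
  apply/funext => x; rewrite E /= -/A -(J_prod m_gt0 s0 t0 LB LB') -/B.
  rewrite (_ : (fun x => A x - B x) = fun x => -1 * B x + A x); last by apply/funext => y; ring.
  by rewrite J_lin//; ring.
rewrite (le_trans (n2D m_ge0 (J_l2 G m_gt0 st0 AB2) (l2Z m_ge0 _ h3)))//.
rewrite -natr1 mulrDl mul1r lerD// ?(le_trans (J_contr G m_gt0 st0 AB2))//.
rewrite (n2Z m_ge0 _ h3) stC ler_wpM2l ?mulr_ge0 ?(ltW s0) ?(ltW t0)// (le_trans _ hM)//.
have h4 : l2 (J t hN) by exact: J_l2.
have h5 : l2 (J s (J t hN)) by exact: J_l2.
rewrite (le_trans (J_contr G m_gt0 st0 h5))// (le_trans (J_contr G m_gt0 s0 h4))//.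
rewrite (le_trans (J_contr G m_gt0 t0 h'2))//.
have h6 : l2 (iter N (J t) h) by exact: iter_l2.
by rewrite /hN (le_trans (iter_contr _ s0 h6))//; exact: iter_contr.
Qed.

Lemma iter_J_sub t k f g : 0 < t -> lap (f, g) ->
  n2 (fun x => iter k (J t) f x - f x) <= k%:R * t * n2 g.
Proof.
move=> t0 L; have [f2 g2] := lap_l2 m_gt0 L.
elim: k => [|k IH]; first by rewrite !mul0r (_ : (fun x => _) = fun=> 0) ?n20//; apply/funext => x; rewrite /= subrr.
have Lk := iter_lap k t0 L; have [fk2 gk2] := lap_l2 m_gt0 Lk.
have [_ E] := J_lap m_gt0 t0 Lk.
have Jg2 := J_l2 G m_gt0 t0 gk2.
have -> : (fun x => iter k.+1 (J t) f x - f x) =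
  (fun x => (iter k (J t) f x - f x) + - t%:C * J t (iter k (J t) g) x).
  by apply/funext => x; rewrite /= (E x); ring.
rewrite (le_trans (n2D m_ge0 (l2B m_ge0 fk2 f2) (l2Z m_ge0 _ Jg2)))//.
rewrite -natr1 mulrDl mul1r mulrDl lerD// (n2Z m_ge0 _ Jg2) cmodN cmod_real (ger0_norm (ltW t0)).
rewrite ler_wpM2l ?(ltW t0)// (le_trans (J_contr G m_gt0 t0 gk2))//; exact: iter_contr.
Qed.

(** One more factor adds at most [(k + 1) t^2 M] by [iter_J_sub] for [g], and
    [k^2 + (k + 1) <= (k + 1)^2]. *)
Lemma iter_J_taylor t k f g h M : 0 < t -> lap (f, g) -> lap (g, h) -> n2 h <= M ->
  n2 (fun x => iter k (J t) f x - f x + (k%:R * t)%:C * g x) <= (k%:R * t) ^+ 2 * M.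
Proof.
move=> t0 L L' hM; have [f2 g2] := lap_l2 m_gt0 L; have [_ h2] := lap_l2 m_gt0 L'.
have M0 : 0 <= M by apply: le_trans hM; exact: n2_ge0.
elim: k => [|k IH].
  rewrite !mul0r expr0n mul0r (_ : (fun x => _) = fun=> 0) ?n20//.
  by apply/funext => x; rewrite /= subrr mul0r addr0.
have Lk := iter_lap k t0 L; have [fk2 gk2] := lap_l2 m_gt0 Lk.
have [_ E] := J_lap m_gt0 t0 Lk.
have Jg2 := J_l2 G m_gt0 t0 gk2.
have kt : (k.+1%:R * t)%:C = (k%:R * t)%:C + t%:C :> R[i].
  by rewrite -rmorphD -natr1 mulrDl mul1r.
have -> : (fun x => iter k.+1 (J t) f x - f x + (k.+1%:R * t)%:C * g x) =
  (fun x => (iter k (J t) f x - f x + (k%:R * t)%:C * g x) + - t%:C * (iter k.+1 (J t) g x - g x)).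
  by apply/funext => x; rewrite kt /= (E x); ring.
have d1 : l2 (fun x => iter k (J t) f x - f x + (k%:R * t)%:C * g x).
  by apply: (l2D m_ge0); [exact: (l2B m_ge0)|exact: (l2Z m_ge0)].
have d2 : l2 (fun x => iter k.+1 (J t) g x - g x) by apply: (l2B m_ge0).
rewrite (le_trans (n2D m_ge0 d1 (l2Z m_ge0 _ d2)))//.
apply: (@le_trans _ _ ((k%:R * t) ^+ 2 * M + t * (k.+1%:R * t * M))).
  rewrite lerD// (n2Z m_ge0 _ d2) cmodN cmod_real (ger0_norm (ltW t0)) ler_wpM2l ?(ltW t0)//.
  by rewrite (le_trans (iter_J_sub k.+1 t0 L'))// ler_wpM2l// mulr_ge0// ltW.
have -> : (k%:R * t) ^+ 2 * M + t * (k.+1%:R * t * M) = (k%:R ^+ 2 + k.+1%:R) * (t ^+ 2 * M) by ring.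
have tM0 : 0 <= t ^+ 2 * M by apply: mulr_ge0 => //; exact: sqr_ge0.
rewrite exprMn -[leRHS]mulrA; apply: (ler_wpM2r tM0).
rewrite -natr1; have : 0 <= k%:R :> R by exact: ler0n.
by move: (k%:R : R) => q q0; rewrite !expr2; nra.
Qed.

End EulerIterates.

(** Dyadic step numbers: passing from [n] to [n + 1] replaces each [J (2 s)] by [J s J s], which is
    [iter_J_diff] with equal steps. *)
Definition euler (R : realType) (X : countType) (m : X -> R) (G : graph R X) (n : nat) (t : R)
    (f : X -> R[i]) : X -> R[i] :=
  iter (2 ^ n) (J m G (t / (2 ^ n)%:R)) f.

(* [heat m G t] is [exp (- t L) = lim_n (1 + t L / 2^n)^(-2^n)]. *)
HB.lock Definition heat (R : realType) (X : countType) (m : X -> R) (G : graph R X) (t : R)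
    (f : X -> R[i]) : X -> R[i] :=
  if t == 0 then f else
  xget f [set u | l2 m u /\ forall e, 0 < e -> exists n0, forall n, (n0 <= n)%N ->
                   n2 m (fun x => u x - euler m G n t f x) <= e].

(** * The heat semigroup on l^2 as a limit of Euler iterates *)

Section HeatSemigroup.
Variables (R : realType) (X : countType) (m : X -> R) (G : graph R X).
Hypothesis m_gt0 : forall x, 0 < m x.
Local Notation fn := (X -> R[i]).
Local Notation lap := (laplacian2 m G).
Local Notation J := (J m G).
Local Notation E := (euler m G).
Local Notation T := (heat m G).
Local Notation n2 := (n2 m).
Local Notation l2 := (l2 m).
Implicit Types (f g h u v : fn) (s t e M : R) (a : R[i]) (n k N : nat).

Let m_ge0 x : 0 <= m x. Proof. exact: ltW. Qed.

Let p2 n : 0 < (2 ^ n)%:R :> R. Proof. by rewrite ltr0n expn_gt0. Qed.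

Let step t n : 0 < t -> 0 < t / (2 ^ n)%:R. Proof. by move=> t0; rewrite divr_gt0. Qed.

Lemma euler_l2 n t f : 0 < t -> l2 f -> l2 (E n t f).
Proof. by move=> t0; apply: iter_l2 => //; exact: step. Qed.

Lemma euler_contr n t f : 0 < t -> l2 f -> n2 (E n t f) <= n2 f.
Proof. by move=> t0; apply: iter_contr => //; exact: step. Qed.

Lemma euler_lin n t a f g : 0 < t -> l2 f -> l2 g ->
  E n t (fun x => a * f x + g x) = (fun x => a * E n t f x + E n t g x).
Proof. by move=> t0; apply: iter_lin => //; exact: step. Qed.

Lemma euler_B n t f g : 0 < t -> l2 f -> l2 g ->
  E n t (fun x => f x - g x) = (fun x => E n t f x - E n t g x).
Proof.
move=> t0 f2 g2; rewrite (_ : (fun x => f x - g x) = fun x => -1 * g x + f x); last by apply/funext => x; ring.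
by rewrite euler_lin//; apply/funext => x; ring.
Qed.

Lemma pow2_inv_small e : 0 < e -> exists n0, forall n, (n0 <= n)%N -> (2 ^ n)%:R^-1 <= e.
Proof.
move=> e0; have [n0 hn0] := archi_inv e0; exists n0 => n nn.
rewrite (le_trans _ hn0)// lef_pV2 ?posrE ?ltr0n ?expn_gt0// ler_nat.
by rewrite (leq_ltn_trans nn)// ltn_expl.
Qed.

(** [iter_J_diff] yields a quarter of [t^2 M / 2^n]; the weaker bound is written as a difference so
    that consecutive bounds telescope. *)
Lemma euler_step n t f g h M : 0 < t -> lap (f, g) -> lap (g, h) -> n2 h <= M ->
  n2 (fun x => E n t f x - E n.+1 t f x) <= t ^+ 2 * M * ((2 ^ n)%:R^-1 - (2 ^ n.+1)%:R^-1).
Proof.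
move=> t0 L L' hM; have M0 : 0 <= M by apply: le_trans hM; exact: n2_ge0.
set s := t / (2 ^ n.+1)%:R; have s0 : 0 < s by exact: step.
have p2S : (2 ^ n.+1)%:R = 2 * (2 ^ n)%:R :> R by rewrite expnS natrM.
have := iter_J_diff m_gt0 (2 ^ n) s0 s0 L L' hM.
have -> : s + s = t / (2 ^ n)%:R by rewrite /s p2S; field; rewrite gt_eqF.
rewrite -iterD addnn -mul2n -expnS -/(E n t f) -/(E n.+1 t f) => le.
rewrite (le_trans le)// /s p2S.
have -> : (2 ^ n)%:R * (t / (2 * (2 ^ n)%:R) * (t / (2 * (2 ^ n)%:R)) * M) = t ^+ 2 * M * ((2 ^ n)%:R^-1 / 4) :> R.
  by field; rewrite gt_eqF.
apply: ler_wpM2l; first by rewrite mulr_ge0 ?sqr_ge0.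
have -> : (2 ^ n)%:R^-1 - (2 * (2 ^ n)%:R)^-1 = (2 ^ n)%:R^-1 / 2 :> R by field; rewrite gt_eqF.
have : 0 <= (2 ^ n)%:R^-1 :> R by rewrite invr_ge0 ltW.
lra.
Qed.

Lemma euler_cauchy_dom n k t f g h M : 0 < t -> lap (f, g) -> lap (g, h) -> n2 h <= M ->
  n2 (fun x => E n t f x - E (n + k)%N t f x) <= t ^+ 2 * M * ((2 ^ n)%:R^-1 - (2 ^ (n + k))%:R^-1).
Proof.
move=> t0 L L' hM; have [f2 g2] := lap_l2 m_gt0 L.
elim: k => [|k IH].
  rewrite addn0 subrr mulr0 (_ : (fun x => _) = fun=> 0) ?n20//.
  by apply/funext => x; rewrite subrr.
rewrite addnS; have := euler_step (n + k) t0 L L' hM.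
have -> : (fun x => E n t f x - E (n + k).+1 t f x) =
  (fun x => (E n t f x - E (n + k)%N t f x) + (E (n + k)%N t f x - E (n + k).+1 t f x)).
  by apply/funext => x; ring.
have d1 : l2 (fun x => E n t f x - E (n + k)%N t f x) by apply: (l2B m_ge0); exact: euler_l2.
have d2 : l2 (fun x => E (n + k)%N t f x - E (n + k).+1 t f x) by apply: (l2B m_ge0); exact: euler_l2.
move=> h1; rewrite (le_trans (n2D m_ge0 d1 d2))// (le_trans (lerD IH h1))//.
by rewrite le_eqVlt; apply/orP; left; apply/eqP; ring.
Qed.

(** All Euler iterates are contractions, so convergence extends from the dense domain of [L^2] to
    l^2. *)
Lemma euler_cauchy t f e : 0 < t -> l2 f -> 0 < e ->
  exists n0, forall n k, (n0 <= n)%N -> (n0 <= k)%N -> n2 (fun x => E n t f x - E k t f x) <= e.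
Proof.
move=> t0 f2 e0; have e40 : 0 < e / 4 by rewrite divr_gt0.
have [f' [g [h [L L' hf]]]] := lap_domain_sqr_dense G m_gt0 f2 e40.
have [f'2 _] := lap_l2 m_gt0 L.
pose K := t ^+ 2 * n2 h + 1; have K0 : 0 < K by rewrite ltr_wpDl// mulr_ge0 ?sqr_ge0 ?n2_ge0.
have eK : 0 < e / 4 / K by rewrite divr_gt0.
have [n0 hn0] := pow2_inv_small eK; exists n0 => n k nn kn.
have close j : (n0 <= j)%N -> n2 (fun x => E n0 t f' x - E j t f' x) <= e / 4.
  move=> nj; have := euler_cauchy_dom n0 (j - n0) t0 L L' (lexx _); rewrite subnKC// => /le_trans; apply.
  apply: (@le_trans _ _ (K * (e / 4 / K))); last by rewrite mulrC divfK// gt_eqF.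
  have p0 : 0 <= (2 ^ j)%:R^-1 :> R by rewrite invr_ge0 ltW.
  have l1 := hn0 n0 (leqnn _).
  apply: (@le_trans _ _ (t ^+ 2 * n2 h * (e / 4 / K))).
    by apply: ler_wpM2l; [rewrite mulr_ge0 ?sqr_ge0 ?n2_ge0|lra].
  by apply: ler_wpM2r; [exact: ltW|rewrite /K lerDl].
have d2 j : l2 (E j t (fun x => f x - f' x)) by apply: euler_l2 => //; exact: (l2B m_ge0).
have c2 j : n2 (E j t (fun x => f x - f' x)) <= e / 4.
  by rewrite (le_trans (euler_contr _ t0 _))//; exact: (l2B m_ge0).
have e2 j : l2 (fun x => E n0 t f' x - E j t f' x) by apply: (l2B m_ge0); exact: euler_l2.
have -> : (fun x => E n t f x - E k t f x) = (fun x =>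
   (E n t (fun x => f x - f' x) x - E k t (fun x => f x - f' x) x) +
   ((E n0 t f' x - E k t f' x) - (E n0 t f' x - E n t f' x))).
  by apply/funext => x; rewrite !euler_B//; ring.
have -> : e = (e / 4 + e / 4) + (e / 4 + e / 4) by field.
rewrite (le_trans (n2D m_ge0 (l2B m_ge0 (d2 n) (d2 k)) (l2B m_ge0 (e2 k) (e2 n))))//.
apply: lerD; rewrite (le_trans (n2B m_ge0 _ _))// lerD//; exact: close.
Qed.

Lemma heat_spec t f : 0 < t -> l2 f -> l2 (T t f) /\ forall e, 0 < e ->
  exists n0, forall n, (n0 <= n)%N -> n2 (fun x => T t f x - E n t f x) <= e.
Proof.
move=> t0 f2; rewrite heat.unlock gt_eqF//; case: xgetP => [u -> //|].
have [|u [uf u2 ut]] := @Phi_complete R X X m m_ge0 (fun f => f) (fun a f g => erefl)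
  (fun x => nb_pt m_ge0 (le12 R) (m_gt0 x)) (fun _ _ => id) (fun n => E n t f) (fun n => euler_l2 n t0 f2).
  move=> e e0; have [n0 hn0] := euler_cauchy t0 f2 e0; exists n0 => n k nn kn.
  by apply: (nb_n2P m_ge0); [apply: (l2B m_ge0); exact: euler_l2|exact: hn0].
move=> /(_ u) []; split=> // e e0; have [n0 hn0] := ut e e0; exists n0 => n nn.
by apply: (n2_le m_ge0); exact: hn0.
Qed.

Lemma heat_l2 t f : 0 <= t -> l2 f -> l2 (T t f).
Proof.
rewrite le_eqVlt => /orP[/eqP <- f2|t0 f2]; first by rewrite heat.unlock eqxx.
by have [] := heat_spec t0 f2.
Qed.

Lemma heat0 f : T 0 f = f.
Proof. by rewrite heat.unlock eqxx. Qed.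

Lemma l2_eq f g : l2 f -> l2 g -> (forall e, 0 < e -> n2 (fun x => f x - g x) <= e) -> f = g.
Proof.
move=> f2 g2 h; have := n2_eq0 m_gt0 (l2B m_ge0 f2 g2) _.
have h0 : n2 (fun x => f x - g x) <= 0 by apply/ler_addgt0Pr => e e0; rewrite add0r h.
move=> /(_ h0) /funeqP E0; apply/funext => x; apply/eqP; rewrite -subr_eq0; apply/eqP; exact: E0.
Qed.

Lemma heat_uniq t f u : 0 < t -> l2 f -> l2 u ->
  (forall e, 0 < e -> exists n0, forall n, (n0 <= n)%N -> n2 (fun x => u x - E n t f x) <= e) ->
  T t f = u.
Proof.
move=> t0 f2 u2 hu; have [T2 hT] := heat_spec t0 f2.
apply: l2_eq => // e e0; have e20 : 0 < e / 2 by rewrite divr_gt0.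
have [n1 h1] := hu _ e20; have [n2' h2] := hT _ e20; pose n := maxn n1 n2'.
have E2 : l2 (E n t f) by exact: euler_l2.
rewrite (_ : (fun x => _) = (fun x => (T t f x - E n t f x) - (u x - E n t f x))); last by apply/funext => x; ring.
rewrite (le_trans (n2B m_ge0 (l2B m_ge0 T2 E2) (l2B m_ge0 u2 E2)))//.
have -> : e = e / 2 + e / 2 by field.
by apply: lerD; [apply: h2; exact: leq_maxr|apply: h1; exact: leq_maxl].
Qed.

Lemma heat_lin t a f g : 0 <= t -> l2 f -> l2 g ->
  T t (fun x => a * f x + g x) = (fun x => a * T t f x + T t g x).
Proof.
rewrite le_eqVlt => /orP[/eqP <- f2 g2|t0 f2 g2]; first by rewrite !heat0.
have [Tf hf] := heat_spec t0 f2; have [Tg hg] := heat_spec t0 g2.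
apply: heat_uniq => //; [by apply: (l2D m_ge0) => //; exact: (l2Z m_ge0)|by apply: (l2D m_ge0) => //; exact: (l2Z m_ge0)|].
move=> e e0; have a0 := cmod_ge0 a.
have e10 : 0 < e / (cmod a + 1) by rewrite divr_gt0// ltr_wpDl.
have [n1 h1] := hf _ e10; have [k1 h2] := hg _ e10; exists (maxn n1 k1) => n.
rewrite geq_max => /andP[/h1 l1 /h2 l2'].
have E1 : l2 (E n t f) by exact: euler_l2.
have E2 : l2 (E n t g) by exact: euler_l2.
rewrite euler_lin// (_ : (fun x => _) = (fun x => a * (T t f x - E n t f x) + (T t g x - E n t g x))); last by apply/funext => x; ring.
have d1 := l2B m_ge0 Tf E1; have d2 := l2B m_ge0 Tg E2.
rewrite (le_trans (n2D m_ge0 (l2Z m_ge0 a d1) d2))// (n2Z m_ge0 _ d1).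
have -> : e = cmod a * (e / (cmod a + 1)) + e / (cmod a + 1) by field; rewrite gt_eqF// ltr_wpDl.
by rewrite lerD// ler_wpM2l.
Qed.

Lemma heat_B t f g : 0 <= t -> l2 f -> l2 g ->
  T t (fun x => f x - g x) = (fun x => T t f x - T t g x).
Proof.
move=> t0 f2 g2; rewrite (_ : (fun x => f x - g x) = fun x => -1 * g x + f x); last by apply/funext => x; ring.
by rewrite heat_lin//; apply/funext => x; ring.
Qed.

Lemma heat_approx t f e : 0 < t -> l2 f -> 0 < e -> exists n0, forall n, (n0 <= n)%N ->
  [/\ l2 (fun x => T t f x - E n t f x), n2 (fun x => T t f x - E n t f x) <= e & l2 (E n t f)].
Proof.
move=> t0 f2 e0; have [Tf h] := heat_spec t0 f2; have [n0 hn0] := h e e0.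
have E2 n : l2 (E n t f) by exact: euler_l2.
by exists n0 => n nn; split=> //; [exact: (l2B m_ge0)|exact: hn0].
Qed.

Lemma heat_le t f M : 0 < t -> l2 f -> (forall n, n2 (E n t f) <= M) -> n2 (T t f) <= M.
Proof.
move=> t0 f2 h; apply/ler_addgt0Pr => e e0; have [n /(_ n (leqnn _)) [d2 de E2]] := heat_approx t0 f2 e0.
rewrite (_ : T t f = fun x => E n t f x + (T t f x - E n t f x)); last by apply/funext => x; rewrite addrC subrK.
by rewrite (le_trans (n2D m_ge0 E2 d2))// lerD.
Qed.

Lemma heat_contr t f : 0 <= t -> l2 f -> n2 (T t f) <= n2 f.
Proof.
rewrite le_eqVlt => /orP[/eqP <- f2|t0 f2]; first by rewrite heat0.
by apply: heat_le => // n; exact: euler_contr.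
Qed.

(** At level [n] the iterates for [s + t] and the product of those for [s] and [t] differ by at most
    [s t |L^2 f| / 2^n]. *)
Lemma heatD_dom s t f g h : 0 < s -> 0 < t -> lap (f, g) -> lap (g, h) -> T (s + t) f = T s (T t f).
Proof.
move=> s0 t0 L L'; have st0 : 0 < s + t by rewrite addr_gt0.
have [f2 g2] := lap_l2 m_gt0 L.
have Tf := heat_l2 (ltW t0) f2; have TTf := heat_l2 (ltW s0) Tf.
apply: heat_uniq => // e e0; have e30 : 0 < e / 3 by rewrite divr_gt0.
have [n1 h1] := heat_approx s0 Tf e30; have [k1 h2] := heat_approx t0 f2 e30.
have M0 := n2_ge0 m h.
have K0 : 0 < s * t * n2 h + 1 by rewrite ltr_wpDl// !mulr_ge0 ?(ltW s0) ?(ltW t0).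
have [k2 h3] := pow2_inv_small (divr_gt0 e30 K0).
exists (maxn n1 (maxn k1 k2)) => n; rewrite !geq_max => /and3P[/h1[l1 l1' l1''] /h2[l2' l2'' l3] /h3 l4].
have le := iter_J_diff m_gt0 (2 ^ n) (step n s0) (step n t0) L L' (lexx _).
move: le; rewrite -mulrDl -/(E n (s + t) f) -/(E n t f) -/(E n s (E n t f)) => le.
have E3 : l2 (E n (s + t) f) by exact: euler_l2.
have E4 : l2 (E n s (E n t f)) by exact: euler_l2.
rewrite (_ : (fun x => _) = (fun x => (T s (T t f) x - E n s (T t f) x) +
  (E n s (fun x => T t f x - E n t f x) x - (E n (s + t) f x - E n s (E n t f) x)))); last first.
  by apply/funext => x; rewrite euler_B//; ring.
have d1 : l2 (E n s (fun x => T t f x - E n t f x)) by exact: euler_l2.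
have d2 := l2B m_ge0 E3 E4.
rewrite (le_trans (n2D m_ge0 l1 (l2B m_ge0 d1 d2)))//.
have -> : e = e / 3 + (e / 3 + e / 3) by field.
rewrite lerD// (le_trans (n2B m_ge0 d1 d2))// lerD//; first by rewrite (le_trans (euler_contr n s0 l2')).
rewrite (le_trans le)//.
have -> : (2 ^ n)%:R * (s / (2 ^ n)%:R * (t / (2 ^ n)%:R) * n2 h) = (s * t * n2 h) * (2 ^ n)%:R^-1 :> R.
  by field; rewrite gt_eqF.
apply: (@le_trans _ _ ((s * t * n2 h) * (e / 3 / (s * t * n2 h + 1)))).
  by apply: ler_wpM2l => //; rewrite !mulr_ge0 ?(ltW s0) ?(ltW t0).
rewrite mulrCA ler_piMr ?(ltW e30)// ler_pdivrMr// mul1r lerDl//.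
Qed.

Lemma heatD s t f : 0 <= s -> 0 <= t -> l2 f -> T (s + t) f = T s (T t f).
Proof.
rewrite le_eqVlt => /orP[/eqP <- t0 f2|s0]; first by rewrite add0r heat0.
rewrite le_eqVlt => /orP[/eqP <- f2|t0 f2]; first by rewrite addr0 heat0.
have st0 : 0 <= s + t by rewrite addr_ge0// ltW.
have Tf := heat_l2 (ltW t0) f2; have TTf := heat_l2 (ltW s0) Tf; have Tst := heat_l2 st0 f2.
apply: l2_eq => // e e0; have e20 : 0 < e / 2 by rewrite divr_gt0.
have [f' [g [h [L L' hf]]]] := lap_domain_sqr_dense G m_gt0 f2 e20.
have [f'2 _] := lap_l2 m_gt0 L.
have d2 : l2 (fun x => f x - f' x) by exact: (l2B m_ge0).
have Tf' := heat_l2 (ltW t0) f'2.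
rewrite (_ : (fun x => _) = (fun x => T (s + t) (fun x => f x - f' x) x - T s (T t (fun x => f x - f' x)) x)); last first.
  apply/funext => x; rewrite (heat_B (ltW t0))// (heat_B (ltW s0))// (heat_B st0)//.
  by rewrite (heatD_dom s0 t0 L L'); ring.
have d3 := heat_l2 (ltW t0) d2.
rewrite (le_trans (n2B m_ge0 (heat_l2 st0 d2) (heat_l2 (ltW s0) d3)))//.
have -> : e = e / 2 + e / 2 by field.
rewrite lerD ?(le_trans (heat_contr st0 d2))//.
by rewrite (le_trans (heat_contr (ltW s0) d3))// (le_trans (heat_contr (ltW t0) d2)).
Qed.

Lemma heat_pcvg t f : 0 < t -> l2 f -> pcvg (fun n => E n t f) (T t f).
Proof.
move=> t0 f2 x e e0; have [K K0 HK] := nb_pt m_ge0 (le12 R) (m_gt0 x).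
have [n0 hn] := heat_approx t0 f2 (divr_gt0 e0 K0); exists n0 => n /hn[d2 de _].
by rewrite (le_trans (HK _ _ (nb_n2P m_ge0 d2 de)))// mulrC divfK// gt_eqF.
Qed.

Lemma heat_bounded t f M : 0 <= t -> l2 f -> 0 < M -> (forall x, cmod (f x) <= M) ->
  forall x, cmod (T t f x) <= M.
Proof.
rewrite le_eqVlt => /orP[/eqP <- f2 M0 fM|t0 f2 M0 fM x]; first by rewrite heat0.
apply/ler_addgt0Pr => e e0; have [n /(_ n (leqnn _)) hn] := heat_pcvg t0 f2 x e0.
rewrite (le_trans (cmod_dist _ (E n t f x)))// lerD//.
by apply: iter_bounded => //; exact: step.
Qed.

Lemma heat_sym t f g : 0 <= t -> l2 f -> l2 g -> inner m (T t f) g = inner m f (T t g).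
Proof.
rewrite le_eqVlt => /orP[/eqP <- f2 g2|t0 f2 g2]; first by rewrite !heat0.
apply/eqP; rewrite -subr_eq0; apply/eqP/cmod_le0 => e e0.
pose K := n2 f + n2 g + 1; have K0 : 0 < K by rewrite /K; have := n2_ge0 m f; have := n2_ge0 m g; lra.
have eK := divr_gt0 e0 K0.
have [n1 h1] := heat_approx t0 f2 eK; have [k1 h2] := heat_approx t0 g2 eK.
have [a1 a2 a3] := h1 (maxn n1 k1) (leq_maxl _ _); have [b1 b2 b3] := h2 (maxn n1 k1) (leq_maxr _ _).
set n := maxn n1 k1 in a1 a2 a3 b1 b2 b3.
have Tf := heat_l2 (ltW t0) f2; have Tg := heat_l2 (ltW t0) g2.
have := iter_sym G m_gt0 (2 ^ n) (step n t0) f2 g2; rewrite -/(E n t f) -/(E n t g) => sy.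
have -> : inner m (T t f) g - inner m f (T t g) =
  inner m (fun x => T t f x - E n t f x) g - inner m f (fun x => T t g x - E n t g x).
  by rewrite (innerBl m_ge0 Tf a3 g2) (innerBr m_ge0 Tg b3 f2) sy; ring.
rewrite (le_trans (cmodB _ _))//.
rewrite (le_trans (lerD (cmod_inner_n2 m_ge0 a1 g2) (cmod_inner_n2 m_ge0 f2 b1)))//.
apply: (@le_trans _ _ (e / K * n2 g + n2 f * (e / K))).
  by rewrite lerD// ?ler_wpM2r ?ler_wpM2l ?n2_ge0.
have -> : e / K * n2 g + n2 f * (e / K) = e / K * (n2 f + n2 g) by ring.
apply: (@le_trans _ _ (e / K * K)); last by rewrite divfK// gt_eqF.
by apply: ler_wpM2l; [exact: ltW|rewrite /K lerDl].
Qed.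

Lemma heat_sub t f g : 0 < t -> lap (f, g) -> n2 (fun x => T t f x - f x) <= t * n2 g.
Proof.
move=> t0 L; have [f2 g2] := lap_l2 m_gt0 L; have Tf := heat_l2 (ltW t0) f2.
apply/ler_addgt0Pr => e e0; have [n /(_ n (leqnn _)) [d2 de E2]] := heat_approx t0 f2 e0.
rewrite (_ : (fun x => _) = fun x => (E n t f x - f x) + (T t f x - E n t f x)); last by apply/funext => x; ring.
rewrite (le_trans (n2D m_ge0 (l2B m_ge0 E2 f2) d2))// lerD//.
by have := iter_J_sub m_gt0 (2 ^ n) (step n t0) L; rewrite [_%:R * _]mulrC divfK ?gt_eqF.
Qed.

Lemma heat_taylor_dom t f g h : 0 < t -> lap (f, g) -> lap (g, h) ->
  n2 (fun x => T t f x - f x + t%:C * g x) <= t ^+ 2 * n2 h.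
Proof.
move=> t0 L L'; have [f2 g2] := lap_l2 m_gt0 L; have Tf := heat_l2 (ltW t0) f2.
apply/ler_addgt0Pr => e e0; have [n /(_ n (leqnn _)) [d2 de E2]] := heat_approx t0 f2 e0.
rewrite (_ : (fun x => _) = fun x => (E n t f x - f x + t%:C * g x) + (T t f x - E n t f x)); last by apply/funext => x; ring.
have d3 : l2 (fun x => E n t f x - f x + t%:C * g x).
  by apply: (l2D m_ge0); [exact: (l2B m_ge0)|exact: (l2Z m_ge0)].
rewrite (le_trans (n2D m_ge0 d3 d2))// lerD//.
have := iter_J_taylor m_gt0 (2 ^ n) (step n t0) L L' (lexx _).
by rewrite [_%:R * _]mulrC divfK ?gt_eqF.
Qed.

(** The domain of [L^2] is dense in the domain of [L] for the graph norm: [(1 + L) f] is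
    approximated by some [q] in the domain of [L], and [f1 = (1 + L)^-1 q] then approximates [f]
    together with [L f]. The quadratic remainder serves for [f1], the linear bound [heat_sub] for
    [f - f1]. *)
Lemma heat_taylor f g e : lap (f, g) -> 0 < e -> exists2 d : R, 0 < d & forall t, 0 < t -> t < d ->
  n2 (fun x => T t f x - f x + t%:C * g x) <= t * e.
Proof.
move=> L e0; have [f2 g2] := lap_l2 m_gt0 L.
have e80 : 0 < e / 8 by rewrite divr_gt0.
have s2 : l2 (fun x => f x + g x) by exact: (l2D m_ge0).
have [q [w [w' [Lq Lw hq]]]] := lap_domain_sqr_dense G m_gt0 s2 e80.
have [q2 w2] := lap_l2 m_gt0 Lq.
have one : (1 : R)%:C = 1 :> R[i] by [].
have [g1 L1 E1] := lap_lapP G m_gt0 ltr01 q2.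
set f1 := J 1 q in L1 E1.
have [L1' E1'] := J_lap m_gt0 ltr01 Lq.
have g1E : g1 = (fun x => q x - f1 x) by apply/funext => x; rewrite (E1 x) one; ring.
have LL := lap_B m_gt0 (-1) Lq L1.
have Lg1 : lap (g1, fun x => w x + -1 * g1 x).
  apply: lap_ext LL => x //; rewrite g1E; ring.
have [f12 g12] := lap_l2 m_gt0 L1.
have [_ h2] := lap_l2 m_gt0 Lg1.
have D := lap_B m_gt0 (-1) L L1.
have {}D : lap (fun x => f x - f1 x, fun x => g x - g1 x).
  by apply: lap_ext D => x; ring.
have [d1 d2] := lap_l2 m_gt0 D.
have nd1 : n2 (fun x => f x - f1 x) <= e / 8.
  apply: le_trans hq; have := lap_contr m_gt0 ler01 D.
  rewrite [X in _ <= n2 X](_ : _ = (fun x => f x + g x - q x))//.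
  by apply/funext => x; rewrite g1E one; ring.
have nd2 : n2 (fun x => g x - g1 x) <= e / 4.
  rewrite (_ : (fun x => _) = (fun x => (f x + g x - q x) - (f x - f1 x))); last by apply/funext => x; rewrite g1E; ring.
  rewrite (le_trans (n2B m_ge0 (l2B m_ge0 s2 q2) d1))//.
  have -> : e / 4 = e / 8 + e / 8 by field.
  exact: lerD.
set M := n2 (fun x => w x + -1 * g1 x) in h2.
have M0 : 0 <= n2 (fun x => w x + -1 * g1 x) by exact: n2_ge0.
pose K := n2 (fun x => w x + -1 * g1 x) + 1.
have K0 : 0 < K by rewrite ltr_wpDl.
exists (e / 4 / K) => [|t t0 td]; first by rewrite !divr_gt0.
have le1 := heat_taylor_dom t0 L1 Lg1; have le2 := heat_sub t0 D.
have Tf1 := heat_l2 (ltW t0) f12; have Tf := heat_l2 (ltW t0) f2.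
have Td := heat_l2 (ltW t0) d1.
have z1 : l2 (fun x => T t f1 x - f1 x + t%:C * g1 x).
  by apply: (l2D m_ge0); [exact: (l2B m_ge0)|exact: (l2Z m_ge0)].
have z2 : l2 (fun x => T t (fun x => f x - f1 x) x - (f x - f1 x)) by exact: (l2B m_ge0).
have z3 := l2Z m_ge0 t%:C d2.
rewrite (_ : (fun x => _) = (fun x => (T t f1 x - f1 x + t%:C * g1 x) +
   ((T t (fun x => f x - f1 x) x - (f x - f1 x)) + t%:C * (g x - g1 x)))); last first.
  by apply/funext => x; rewrite (heat_B (ltW t0))//; ring.
rewrite (le_trans (n2D m_ge0 z1 (l2D m_ge0 z2 z3)))//.
have -> : t * e = t * (e / 2) + (t * (e / 4) + t * (e / 4)) by field.
apply: lerD.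
  rewrite (le_trans le1)// expr2 -mulrA ler_wpM2l ?(ltW t0)//.
  apply: (@le_trans _ _ (t * K)).
    by rewrite ler_wpM2l ?(ltW t0)// lerDl.
  apply: (@le_trans _ _ (e / 4)); last lra.
  by rewrite -ler_pdivlMr// ltW.
rewrite (le_trans (n2D m_ge0 z2 z3))// (n2Z m_ge0 _ d2) cmod_real (ger0_norm (ltW t0)) lerD//.
  by rewrite (le_trans le2)// ler_wpM2l// ltW.
by rewrite ler_wpM2l// ltW.
Qed.

End HeatSemigroup.

(** * The semigroup on l^p *)

Section NormConvergence.
Variables (R : realType) (X : countType) (m : X -> R).
Hypothesis m_gt0 : forall x, 0 < m x.
Local Notation fn := (X -> R[i]).
Implicit Types (f g h u v : fn) (s t e M : R) (a : R[i]).

Let m_ge0 x : 0 <= m x. Proof. exact: ltW. Qed.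

Variables (r : R) (r1 : 1 <= r).
Let p1 : (1 <= r%:E)%E. Proof. by rewrite lee_fin. Qed.

Lemma near0_right (P : R -> Prop) :
  (\forall t \near (0 : R)^'+, P t) <-> exists2 d : R, 0 < d & forall t, 0 < t -> t < d -> P t.
Proof.
split=> [[d /= d0 hd]|[d d0 hd]].
  by exists d => // t t0 td; apply: hd => //=; rewrite /ball /= sub0r normrN gtr0_norm.
by exists d => //= t; rewrite /ball /= sub0r normrN => td t0; apply: hd => //; rewrite -(gtr0_norm t0).
Qed.

Lemma lp_norm_ge0 f : (0 <= lp_norm m r%:E f)%E.
Proof. by rewrite lp_norm_fin poweR_ge0. Qed.

Lemma nb_lp_norm f M : nb m r%:E f M -> nb m r%:E f (fine (lp_norm m r%:E f)).
Proof.
move=> [M0 h]; split; first by rewrite fine_ge0// lp_norm_ge0.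
by rewrite fineK// ge0_fin_numE ?lp_norm_ge0// (le_lt_trans h)// ltry.
Qed.

Lemma lp_norm_le f g : lp m r%:E f -> (forall M, nb m r%:E f M -> nb m r%:E g M) ->
  (lp_norm m r%:E g <= lp_norm m r%:E f)%E.
Proof.
move=> fl h; have [M fM] := (lpP _ _ _).1 fl.
have [_] := h _ (nb_lp_norm fM); rewrite fineK// ge0_fin_numE ?lp_norm_ge0//.
Qed.

Lemma cvg0P (F : R -> fn) : (lp_norm m r%:E (F t) @[t --> (0 : R)^'+] --> (0 : \bar R)%E) <->
  forall e, 0 < e -> exists2 d : R, 0 < d & forall t, 0 < t -> t < d -> nb m r%:E (F t) e.
Proof.
split=> [/fine_cvgP[fin /cvgrPdist_le h] e e0|h].
  have [d1 d10 h1] := (near0_right _).1 fin; have [d2 d20 h2] := (near0_right _).1 (h e e0).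
  exists (Num.min d1 d2) => [|t t0]; first by rewrite lt_min d10.
  rewrite lt_min => /andP[/(h1 _ t0) f1 /(h2 _ t0)] /=.
  rewrite sub0r normrN ger0_norm ?fine_ge0 ?lp_norm_ge0// => le.
  by split; [exact: ltW|rewrite -(fineK f1) lee_fin].
apply/fine_cvgP; split.
  apply/near0_right; have [d d0 hd] := h 1 ltr01; exists d => // t t0 td.
  have [_ le] := hd _ t0 td.
  by rewrite ge0_fin_numE ?lp_norm_ge0// (le_lt_trans le)// ltry.
apply/cvgrPdist_le => e e0; apply/near0_right; have [d d0 hd] := h e e0; exists d => // t t0 td.
have [_ le] := hd _ t0 td.
rewrite sub0r normrN /= ger0_norm ?fine_ge0 ?lp_norm_ge0//.
by rewrite -lee_fin fineK// ge0_fin_numE ?lp_norm_ge0// (le_lt_trans le)// ltry.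
Qed.

Definition rate (T : R -> fn -> fn) t f g : fn := fun x => (t^-1)%:C * (f x - T t f x) - g x.

Lemma generatorP T f g : generator m r%:E T (f, g) <-> [/\ exists M, nb m r%:E f M,
  exists M, nb m r%:E g M & forall e, 0 < e -> exists2 d : R, 0 < d & forall t, 0 < t -> t < d ->
    nb m r%:E (rate T t f g) e].
Proof.
split=> [[/= f1 g1 h]|[f1 g1 h]]; split.
- exact/lpP.
- exact/lpP.
- exact/cvg0P.
- exact/lpP.
- exact/lpP.
- exact/cvg0P.
Qed.

Lemma rate_taylor T t f g e : 0 < t ->
  nb m r%:E (fun x => T t f x - f x + t%:C * g x) (t * e) -> nb m r%:E (rate T t f g) e.
Proof.
move=> t0 h; have := nbZ m_ge0 p1 (- (t^-1)%:C) h.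
rewrite cmodN cmod_real ger0_norm ?invr_ge0 ?(ltW t0)// mulKf ?gt_eqF//.
rewrite (_ : (fun x => _) = rate T t f g)//; apply/funext => x; rewrite /rate.
have tt : (t^-1)%:C * t%:C = 1 :> R[i] by rewrite -rmorphM mulVf ?gt_eqF// rmorph1.
by rewrite -[g x in RHS]mul1r -tt; ring.
Qed.

Lemma taylor_rate T t f g e : 0 < t -> nb m r%:E (rate T t f g) e ->
  nb m r%:E (fun x => T t f x - f x + t%:C * g x) (t * e).
Proof.
move=> t0 h; have := nbZ m_ge0 p1 (- t%:C) h.
rewrite cmodN cmod_real ger0_norm ?(ltW t0)//.
rewrite (_ : (fun x => _) = (fun x => T t f x - f x + t%:C * g x))//; apply/funext => x; rewrite /rate.
have tt : t%:C * (t^-1)%:C = 1 :> R[i] by rewrite -rmorphM divff ?gt_eqF// rmorph1.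
rewrite mulrBr mulNr [t%:C * (_ * _)]mulrA tt; ring.
Qed.

Record nb_contraction (T : R -> fn -> fn) : Prop := NbContraction {
  nbc_lin : forall t a f g M N, 0 <= t -> nb m r%:E f M -> nb m r%:E g N ->
    T t (fun x => a * f x + g x) = (fun x => a * T t f x + T t g x) ;
  nbc_contr : forall t f M, 0 <= t -> nb m r%:E f M -> nb m r%:E (T t f) M ;
  nbc0 : forall f M, nb m r%:E f M -> T 0 f = f ;
  nbcD : forall s t f M, 0 <= s -> 0 <= t -> nb m r%:E f M -> T (s + t) f = T s (T t f) }.

Lemma contraction_semigroupP T : contraction_semigroup m r%:E T <-> nb_contraction T.
Proof.
have lpI f M : nb m r%:E f M -> lp m r%:E f by move=> fM; apply/lpP; exists M.
split=> -[h1 h2 h3 h4]; split.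
- by move=> t a f g M N t0 /lpI fl /lpI gl; exact: h1.
- move=> t f M t0 fM; have [M0 le] := fM; split=> //.
  by rewrite (le_trans (h2 _ _ t0 (lpI _ _ fM))).
- by move=> f M /lpI; exact: h3.
- by move=> s t f M s0 t0 /lpI; exact: h4.
- by move=> t a f g t0 /lpP[M fM] /lpP[N gN]; exact: h1 t0 fM gN.
- by move=> t f t0 fl; apply: lp_norm_le => // M; exact: h2.
- by move=> f /lpP[M fM]; exact: h3 fM.
- by move=> s t f s0 t0 /lpP[M fM]; exact: h4 s0 t0 fM.
Qed.

(** If [K] is the infimum of the bounds, the hypothesis gives [(1 + t) K - t e <= K], that is
    [K <= e]. The infimum replaces the norm so that one works with [nb] alone. *)
Lemma nb_zero d : (exists M, nb m r%:E d M) ->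
  (forall e, 0 < e -> exists2 t, 0 < t & forall M, nb m r%:E d M -> nb m r%:E d ((M + t * e) / (1 + t))) ->
  d = (fun=> 0).
Proof.
move=> [M1 dM1] h.
pose A := [set M | nb m r%:E d M].
have A0 : A !=set0 by exists M1.
have Alb : has_lbound A by exists 0 => M /nb_ge0.
set K := inf A.
have K0 : 0 <= K by apply: lb_le_inf => // M /nb_ge0.
have Ke e : 0 < e -> K <= e.
  move=> e0; have [t t0 ht] := h e e0.
  have t1 : 0 < 1 + t by rewrite addr_gt0.
  have : K * (1 + t) - t * e <= K.
    apply: lb_le_inf => // M dM; rewrite lerBlDr -ler_pdivlMr//.
    exact: ge_inf (ht M dM).
  have tt : t * K <= t * e -> K <= e by rewrite ler_pM2l.
  move=> le; apply: tt; move: le; lra.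
have K00 : K = 0 by apply/eqP; rewrite eq_le K0 andbT; apply/ler_addgt0Pr => e /Ke; rewrite add0r.
apply/funext => x; have [C C0 HC] := nb_pt m_ge0 p1 (m_gt0 x).
apply: cmod_le0 => e e0.
have [M dM] := inf_adherent (divr_gt0 e0 C0) (conj A0 Alb).
rewrite -/K K00 add0r => Mle; rewrite (le_trans (HC _ _ dM))//.
by rewrite mulrC -ler_pdivlMr// ltW.
Qed.

(** Injectivity of the generator plus 1: if the generator maps [d] to [- d], then [(1 + t) d] is
    [T t d] up to an error of norm [t e], and [T t] is a contraction. *)
Lemma generator_dissipative T d : nb_contraction T ->
  generator m r%:E T (d, fun x => - d x) -> d = (fun=> 0).
Proof.
move=> [_ Tc _ _] /generatorP[dM _ h]; apply: nb_zero => // e e0.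
have [t0 t00 ht] := h e e0; exists (t0 / 2); first by rewrite divr_gt0.
have t1 : 0 < t0 / 2 by rewrite divr_gt0.
have t2 : t0 / 2 < t0 by rewrite ltr_pdivrMr// ltr_pMr// ltr1n.
move: (ht _ t1 t2) => /(taylor_rate t1); move: (t0 / 2) t1 => t t1 h1 M dM'.
have t3 : 0 < 1 + t by rewrite addr_gt0.
have := nbB m_ge0 p1 (Tc _ _ _ (ltW t1) dM') h1.
move=> /(nbZ m_ge0 p1 ((1 + t)^-1)%:C); rewrite cmod_real ger0_norm ?invr_ge0 ?(ltW t3)// mulrC.
rewrite (_ : (fun x => _) = d)//; apply/funext => x.
have E : T t d x - (T t d x - d x + t%:C * - d x) = (1 + t)%:C * d x by rewrite rmorphD rmorph1; ring.
by rewrite E mulrA -rmorphM mulVf ?gt_eqF// rmorph1 mul1r.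
Qed.

Lemma generator_lin T a f g f' g' : nb_contraction T -> generator m r%:E T (f, g) ->
  generator m r%:E T (f', g') ->
  generator m r%:E T (fun x => a * f x + f' x, fun x => a * g x + g' x).
Proof.
move=> Tc /generatorP[[M1 fM] [M2 gM] h] /generatorP[[M3 fM'] [M4 gM'] h'].
apply/generatorP; split.
- by exists (cmod a * M1 + M3); apply: (nbD m_ge0 p1) => //; exact: (nbZ m_ge0 p1).
- by exists (cmod a * M2 + M4); apply: (nbD m_ge0 p1) => //; exact: (nbZ m_ge0 p1).
move=> e e0; have a0 := cmod_ge0 a.
have e10 : 0 < e / (cmod a + 1) by rewrite divr_gt0// ltr_wpDl.
have [d1 d10 h1] := h _ e10; have [d2 d20 h2] := h' _ e10.
exists (Num.min d1 d2) => [|t t0]; first by rewrite lt_min d10.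
rewrite lt_min => /andP[/(h1 _ t0) k1 /(h2 _ t0) k2].
have := nbD m_ge0 p1 (nbZ m_ge0 p1 a k1) k2.
have -> : cmod a * (e / (cmod a + 1)) + e / (cmod a + 1) = e by field; rewrite gt_eqF// ltr_wpDl.
rewrite (_ : (fun x => _) = rate T t (fun x => a * f x + f' x) (fun x => a * g x + g' x))//.
by apply/funext => x; rewrite /rate (nbc_lin Tc a (ltW t0) fM fM'); ring.
Qed.

End NormConvergence.

Section HeatOnL2.
Variables (R : realType) (X : countType) (m : X -> R) (G : graph R X).
Hypothesis m_gt0 : forall x, 0 < m x.
Local Notation fn := (X -> R[i]).
Local Notation lap := (laplacian2 m G).
Local Notation T := (heat m G).
Local Notation n2 := (n2 m).
Local Notation l2 := (l2 m).
Implicit Types (f g h u v : fn) (s t e M : R) (a : R[i]) (n k N : nat).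

Let m_ge0 x : 0 <= m x. Proof. exact: ltW. Qed.
Let r12 : 1 <= 2 :> R. Proof. by rewrite ler1n. Qed.

Lemma heat_nb_contraction : nb_contraction m 2 T.
Proof.
split.
- by move=> t a f g M N t0 fM gN; apply: heat_lin => //; [exists M|exists N].
- move=> t f M t0 fM; have f2 : l2 f by exists M.
  apply: (nb_n2P m_ge0); first exact: heat_l2.
  by rewrite (le_trans (heat_contr _ m_gt0 t0 f2))//; exact: (n2_le m_ge0).
- by move=> f M _; exact: heat0.
- by move=> s t f M s0 t0 fM; apply: heatD => //; exists M.
Qed.

Lemma heat_strongly_continuous f e : l2 f -> 0 < e ->
  exists2 d : R, 0 < d & forall t, 0 < t -> t < d -> nb m 2%:E (fun x => T t f x - f x) e.
Proof.
move=> f2 e0; have e30 : 0 < e / 3 by rewrite divr_gt0.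
have [f' [g [h [L _ hf]]]] := lap_domain_sqr_dense G m_gt0 f2 e30.
have [f'2 g2] := lap_l2 m_gt0 L.
have K0 : 0 < n2 g + 1 by rewrite ltr_wpDl// n2_ge0.
exists (e / 3 / (n2 g + 1)) => [|t t0 td]; first by rewrite divr_gt0.
have Tf := heat_l2 G m_gt0 (ltW t0) f2; have Tf' := heat_l2 G m_gt0 (ltW t0) f'2.
have d2 := l2B m_ge0 f2 f'2; have Td := heat_l2 G m_gt0 (ltW t0) d2.
have z1 := l2B m_ge0 Td d2; have z2 := l2B m_ge0 Tf' f'2.
apply: (nb_n2P m_ge0); first exact: (l2B m_ge0).
rewrite (_ : (fun x => _) = (fun x => (T t (fun x => f x - f' x) x - (f x - f' x)) + (T t f' x - f' x))); last first.
  by apply/funext => x; rewrite (heat_B G m_gt0 (ltW t0))//; ring.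
rewrite (le_trans (n2D m_ge0 z1 z2))//.
have -> : e = (e / 3 + e / 3) + e / 3 by field.
rewrite lerD//.
  by rewrite (le_trans (n2B m_ge0 Td d2))// lerD// (le_trans (heat_contr G m_gt0 (ltW t0) d2)).
rewrite (le_trans (heat_sub m_gt0 t0 L))//.
apply: (@le_trans _ _ (t * (n2 g + 1))); first by rewrite ler_wpM2l ?(ltW t0)// lerDl.
by rewrite -ler_pdivlMr// ltW.
Qed.

(** The generator extends [L] by the Taylor estimate. Equality follows since [L + 1] is onto while
    the generator plus 1 is injective. *)
Lemma heat_generator : generator m 2%:E T = lap.
Proof.
have sub f g : lap (f, g) -> generator m 2%:E T (f, g).
  move=> L; have [[M fM] [N gN]] := lap_l2 m_gt0 L.
  apply/generatorP; split; [by exists M|by exists N|].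
  move=> e e0; have [d d0 hd] := heat_taylor m_gt0 L e0; exists d => // t t0 td.
  apply: (rate_taylor m_gt0 r12 t0); apply: (nb_n2P m_ge0); last exact: hd.
  have f2 : l2 f by exists M.
  by apply: (l2D m_ge0); [apply: (l2B m_ge0) => //; apply: heat_l2 => //; exact: ltW|apply: (l2Z m_ge0); exists N].
apply/seteqP; split=> [[f g] FG|[f g]]; last exact: sub.
have [[M fM] [N gN] _] := (generatorP _ _ _ _ _).1 FG.
have fg2 : l2 (fun x => f x + g x) by apply: (l2D m_ge0); [exists M|exists N].
have [w L E] := lap_lapP G m_gt0 ltr01 fg2.
have D := generator_lin m_gt0 r12 (-1) heat_nb_contraction (sub _ _ L) FG.
have E0 : (fun x => -1 * J m G 1 (fun x => f x + g x) x + f x) = (fun=> 0).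
  apply: (generator_dissipative m_gt0 r12 heat_nb_contraction).
  rewrite (_ : (fun x => - _) = (fun x => -1 * w x + g x))//.
  by apply/funext => x; have := E x; rewrite rmorph1 mul1r => /eqP; rewrite -subr_eq => /eqP <-; ring.
apply: (lap_ext _ _ L) => x; have := congr1 (fun F => F x) E0 => /= /eqP; rewrite mulN1r addrC subr_eq0 => /eqP Ef.
  by rewrite Ef.
by have := E x; rewrite -Ef rmorph1 mul1r => /addrI ->.
Qed.

Lemma heat_heat_semigroup : heat_semigroup m G T.
Proof.
split; last exact: heat_generator.
- exact: (contraction_semigroupP m 2 T).2 heat_nb_contraction.
- move=> f /l2_lp f2; apply/cvg0P => e e0; exact: heat_strongly_continuous.
Qed.

End HeatOnL2.

(** * Kernels of operators on l^2 *)

Section OperatorKernels.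
Variables (R : realType) (X : countType) (m : X -> R).
Hypothesis m_gt0 : forall x, 0 < m x.
Local Notation fn := (X -> R[i]).
Local Notation n2 := (n2 m).
Local Notation l2 := (l2 m).
Local Notation delta := (point_mass R).
Implicit Types (f g h u v : fn) (x y : X) (A : fn -> fn).

Let m_ge0 x : 0 <= m x. Proof. exact: ltW. Qed.
Let r12 : 1 <= 2 :> R. Proof. by rewrite ler1n. Qed.

(** [op_sym] is symmetry for the bilinear pairing, without conjugation, and is asked on point masses
    only. *)
Record l2_operator A (K : R) : Prop := L2Operator {
  op_ge0 : 0 <= K ;
  op_lin : forall a f g, l2 f -> l2 g -> A (fun x => a * f x + g x) = (fun x => a * A f x + A g x) ;
  op_l2 : forall f, l2 f -> l2 (A f) ;
  op_bdd : forall f, l2 f -> n2 (A f) <= K * n2 f ;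
  op_sym : forall x y, A (delta x) y * (m y)%:C = A (delta y) x * (m x)%:C }.

(** Normalized for integration against [m]; by [op_sym] it does not matter which variable carries
    the point mass. *)
Definition op_kernel A x y : R[i] := A (delta x) y / (m x)%:C.

Variables (A : fn -> fn) (K : R) (AK : l2_operator A K).

Let deltal2 y : l2 (delta y). Proof. by apply: (l2_Cc m_ge0); exact: delta_Cc. Qed.

Lemma op_kernel_sym x y : op_kernel A x y = op_kernel A y x.
Proof.
have mx := m_neq0 m_gt0 x; have my := m_neq0 m_gt0 y.
apply: (mulIf my); apply: (mulIf mx); rewrite /op_kernel.
by rewrite mulrAC mulfVK// (op_sym AK x y) mulfVK.
Qed.

Lemma op_kernel_delta x y : op_kernel A x y * (m y)%:C = A (delta y) x.
Proof. by rewrite op_kernel_sym /op_kernel mulfVK// m_neq0. Qed.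

Lemma op_zero : A (fun=> 0) = (fun=> 0).
Proof.
have := op_lin AK (-1) (l20 m_ge0) (l20 m_ge0).
rewrite (_ : (fun x => _) = (fun=> 0)); last by apply/funext => x; rewrite mulr0 addr0.
by move=> ->; apply/funext => x; rewrite mulN1r addNr.
Qed.

Lemma op_restr f (s : seq X) x : uniq s -> A (restr s f) x = \sum_(y <- s) f y * A (delta y) x.
Proof.
elim: s => [|y s IH] /=; first by move=> _; rewrite restr_nil op_zero big_nil.
move=> /andP[ys us]; rewrite restr_cons// (op_lin AK (f y)).
- by rewrite IH// big_cons.
- exact: deltal2.
- by apply: (l2_Cc m_ge0); exact: restr_Cc.
Qed.

(** Duality between row sums and bounded functions: testing [A] on a finitely supported choice of
    phases aligns all terms of the row at [x], so the value at [x] is the sum of their absolute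
    values. *)
Lemma op_schur C : 0 < C -> (forall f, Cc f -> (forall x, cmod (f x) <= 1) -> forall x, cmod (A f x) <= C) ->
  schur_kernel m (op_kernel A) C.
Proof.
move=> C0 Ab; split=> //; first exact: op_kernel_sym.
move=> x s us; have [u u1 uE] : exists2 u : fn, (forall y, cmod (u y) <= 1) &
    forall y, u y * A (delta y) x = (cmod (A (delta y) x))%:C.
  have /choice[u hu] : forall y, exists w, cmod w <= 1 /\ w * A (delta y) x = (cmod (A (delta y) x))%:C.
    by move=> y; have [w w1 w2] := phase (A (delta y) x); exists w.
  by exists u => y; have [] := hu y.
have := Ab _ (restr_Cc s u) (fun y => le_trans (restr_le s u y) (u1 y)) x.
rewrite op_restr// (eq_bigr _ (fun y _ => uE y)) -rmorph_sum cmod_real ger0_norm; last first.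
  by apply: sumr_ge0 => y _; exact: cmod_ge0.
congr (_ <= C); apply: eq_bigr => y _.
by rewrite -op_kernel_delta cmodM cmod_real ger0_norm.
Qed.

Lemma kop_op_kernel C f : schur_kernel m (op_kernel A) C -> l2 f -> kop m (op_kernel A) f = A f.
Proof.
move=> kC [M fM]; apply: (ext_delta2 m_gt0 r12 _ _ _ _ _ fM).
- by move=> a g h N N' gN hN; apply: (kop_lin m_gt0 _ kC a gN hN).
- by move=> a g h N N' gN hN; apply: (op_lin AK); [exists N|exists N'].
- by move=> x; have [D _ hD] := kop_pt m_gt0 (le12 R) kC x; exists D.
- move=> x; have [D D0 hD] := nb_pt m_ge0 (le12 R) (m_gt0 x); exists (D * K) => g N gN.
  have g2 : l2 g by exists N.
  rewrite -mulrA; apply: hD; apply: (nb_n2P m_ge0); first exact: (op_l2 AK).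
  rewrite (le_trans (op_bdd AK g2))// ler_wpM2l ?(op_ge0 AK)//; exact: (n2_le m_ge0).
- by move=> y; apply/funext => x; rewrite kop_delta// op_kernel_delta.
Qed.

End OperatorKernels.

(** * The heat kernel and its action on l^p *)

Section HeatKernel.
Variables (R : realType) (X : countType) (m : X -> R) (G : graph R X).
Hypothesis m_gt0 : forall x, 0 < m x.
Local Notation fn := (X -> R[i]).
Local Notation T := (heat m G).
Local Notation n2 := (n2 m).
Local Notation l2 := (l2 m).
Local Notation delta := (point_mass R).
Implicit Types (f g h u v : fn) (s t e M : R) (a : R[i]).

Let m_ge0 x : 0 <= m x. Proof. exact: ltW. Qed.
Let deltal2 y : l2 (delta y). Proof. by apply: (l2_Cc m_ge0); exact: delta_Cc. Qed.

Lemma J_conj t f : 0 < t -> l2 f -> J m G t (fun x => (f x)^*) = (fun x => (J m G t f x)^*).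
Proof.
move=> t0 f2; have [g L E] := lap_lapP G m_gt0 t0 f2.
apply: (J_eq m_gt0 t0 (l2_conj m_ge0 f2) (lap_conj m_gt0 L)) => x.
have tc : (t%:C)^* = t%:C :> R[i] by exact: conj_realC.
by rewrite E rmorphD rmorphM; congr (_ + _ * _).
Qed.

Lemma euler_conj n t f : 0 < t -> l2 f -> euler m G n t (fun x => (f x)^*) = (fun x => (euler m G n t f x)^*).
Proof.
move=> t0 f2; rewrite /euler.
have : 0 < t / (2 ^ n)%:R by rewrite divr_gt0// ltr0n expn_gt0.
move: (t / (2 ^ n)%:R) => s s0; move: (2 ^ n)%N => k.
suff [] : iter k (J m G s) (fun x => (f x)^*) = (fun x => (iter k (J m G s) f x)^*) /\
  l2 (iter k (J m G s) f) by [].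
elim: k => [|k [IH1 IH2]] //=; rewrite IH1; split; last exact: (J_l2 G m_gt0).
exact: J_conj.
Qed.

Lemma heat_conj t f : 0 <= t -> l2 f -> T t (fun x => (f x)^*) = (fun x => (T t f x)^*).
Proof.
rewrite le_eqVlt => /orP[/eqP <-|t0] f2; first by rewrite !heat0.
have [T2 h] := heat_spec G m_gt0 t0 f2.
apply: (heat_uniq m_gt0 t0 (l2_conj m_ge0 f2) (l2_conj m_ge0 T2)) => e e0.
have [n0 hn] := h e e0; exists n0 => n nn; rewrite euler_conj//.
have d2 := l2B m_ge0 T2 (euler_l2 G m_gt0 n t0 f2).
apply: le_trans (hn n nn); apply: (n2_le m_ge0).
have := conj_nb m_ge0 (le12 R) (nb_n2 m_ge0 d2).
by rewrite (_ : (fun x => (_ - _)^*) = (fun x => (T t f x)^* - (euler m G n t f x)^*))//; apply/funext => x; rewrite rmorphB.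
Qed.

Lemma delta_conj y : (fun x => (delta y x)^*) = delta y :> fn.
Proof. by apply/funext => x; rewrite /point_mass; case: ifP => _; rewrite ?rmorph1 ?rmorph0. Qed.

Lemma inner_delta_l f y : l2 f -> inner m (delta y) f = (f y)^* * (m y)%:C.
Proof.
move=> f2; rewrite -(inner_conj m_ge0 f2 (deltal2 y)) inner_delta// rmorphM.
by congr (_ * _); exact: conj_realC.
Qed.

Lemma heat_l2_operator t : 0 <= t -> l2_operator m (T t) 1.
Proof.
move=> t0; split=> //.
- by move=> a f g f2 g2; exact: heat_lin.
- by move=> f f2; exact: heat_l2.
- by move=> f f2; rewrite mul1r; exact: heat_contr.
- move=> x y; have := heat_sym G m_gt0 t0 (deltal2 x) (deltal2 y).
  rewrite inner_delta// inner_delta_l; last exact: heat_l2.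
  by have := heat_conj t0 (deltal2 y); rewrite delta_conj => /(congr1 (fun F => F x)) <-.
Qed.

Definition heat_kernel t := op_kernel m (T t).

(** The sup-norm bound coming from truncation gives Schur constant 1, hence contractivity on every
    l^p. *)
Lemma heat_schur t : 0 <= t -> schur_kernel m (heat_kernel t) 1.
Proof.
move=> t0; apply: (op_schur m_gt0 (heat_l2_operator t0)) => // f /(l2_Cc m_ge0) f2 f1.
exact: (heat_bounded G m_gt0 t0 f2).
Qed.

Definition lp_heat t : fn -> fn := kop m (heat_kernel t).

Lemma lp_heat_l2 t f : 0 <= t -> l2 f -> lp_heat t f = T t f.
Proof. by move=> t0 f2; exact: (kop_op_kernel m_gt0 (heat_l2_operator t0) (heat_schur t0)). Qed.

Lemma heat_delta_bound t x : 0 <= t -> forall y, cmod (T t (delta x) y) <= 1.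
Proof.
move=> t0; apply: (heat_bounded G m_gt0 t0 (deltal2 x)) => // y.
by rewrite /point_mass; case: ifP => _; rewrite ?cmod1 ?cmod0.
Qed.

Lemma heat_delta_mass t x : 0 <= t -> sbd (fun y => cmod (T t (delta x) y) * m y) (m x).
Proof.
move=> t0; have := sbdZ (m_ge0 x) (schur_bound (heat_schur t0) x); rewrite mulr1.
apply: sbd_le => // y; rewrite /heat_kernel /op_kernel cmodM cmodV cmod_real gtr0_norm//.
by rewrite mulrA mulrCA divff ?gt_eqF// mulr1.
Qed.

(** The total mass of the evolved point mass is at most [m x], so the mass outside [x] is at most
    what was lost at [x]. The l^1 distance to the point mass is thereby controlled by the value at
    one point, which l^2 continuity handles. *)
Lemma heat_delta_diff t x : 0 <= t ->
  sbd (fun y => cmod (T t (delta x) y - delta x y) * m y) (2 * (cmod (T t (delta x) x - delta x x) * m x)).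
Proof.
move=> t0 s us; have h := heat_delta_mass x t0.
pose F y := cmod (T t (delta x) y - delta x y) * m y; have F0 y : 0 <= F y by rewrite mulr_ge0// cmod_ge0.
have dx : delta x x = 1 by rewrite /point_mass eqxx.
apply: (@le_trans _ _ (\sum_(y <- x :: rem x s) F y)).
  apply: ler_sum_subset => // y ys; rewrite inE; case: eqVneq => //= yx.
  by rewrite mem_rem_uniq// inE yx.
rewrite big_cons mulr2n mulrDl mul1r lerD2l.
have us' : uniq (x :: rem x s) by rewrite /= rem_uniq// mem_rem_uniq// inE eqxx.
have := h _ us'; rewrite big_cons.
have E : \sum_(y <- rem x s) cmod (T t (delta x) y) * m y = \sum_(y <- rem x s) F y.
  apply: eq_big_seq => y; rewrite mem_rem_uniq// inE => /andP[yx _].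
  by rewrite /F [delta x y](_ : _ = 0) ?subr0// /point_mass (negPf yx).
rewrite E dx => le.
have : m x <= cmod (T t (delta x) x) * m x + cmod (T t (delta x) x - 1) * m x.
  rewrite -mulrDl ler_peMl// -[leLHS](@cmod1 R).
  by rewrite cmod_distC; exact: cmod_dist.
by move: le; lra.
Qed.

Variables (r : R) (r1 : 1 <= r).
Let p1 : (1 <= r%:E)%E. Proof. by rewrite lee_fin. Qed.

Lemma lp_heat_contraction : nb_contraction m r lp_heat.
Proof.
split.
- by move=> t a f g M N t0 fM gN; exact: (kop_lin m_gt0 p1 (heat_schur t0) a fM gN).
- by move=> t f M t0 fM; have := nb_kop m_gt0 p1 (heat_schur t0) fM; rewrite mul1r.
- move=> f M fM; apply: (ext_delta2 m_gt0 r1 (A := lp_heat 0) (B := id) _ _ _ _ _ fM).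
  + by move=> a g h N N' gN hN; exact: (kop_lin m_gt0 p1 (heat_schur (lexx 0)) a gN hN).
  + by [].
  + by move=> x; have [D _ hD] := kop_pt m_gt0 p1 (heat_schur (lexx 0)) x; exists D.
  + by move=> x; have [D _ hD] := nb_pt m_ge0 p1 (m_gt0 x); exists D.
  + by move=> y; rewrite lp_heat_l2// heat0.
- move=> s t f M s0 t0 fM.
  apply: (ext_delta2 m_gt0 r1 (A := lp_heat (s + t)) (B := fun f => lp_heat s (lp_heat t f)) _ _ _ _ _ fM).
  + by move=> a g h N N' gN hN; exact: (kop_lin m_gt0 p1 (heat_schur (addr_ge0 s0 t0)) a gN hN).
  + move=> a g h N N' gN hN; rewrite /lp_heat (kop_lin m_gt0 p1 (heat_schur t0) a gN hN).
    have gN' := nb_kop m_gt0 p1 (heat_schur t0) gN; have hN' := nb_kop m_gt0 p1 (heat_schur t0) hN.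
    exact: (kop_lin m_gt0 p1 (heat_schur s0) a gN' hN').
  + by move=> x; have [D _ hD] := kop_pt m_gt0 p1 (heat_schur (addr_ge0 s0 t0)) x; exists D.
  + move=> x; have [D _ hD] := kop_pt m_gt0 p1 (heat_schur s0) x; exists D => g N gN.
    by apply: hD; have := nb_kop m_gt0 p1 (heat_schur t0) gN; rewrite mul1r.
  + move=> y; rewrite !lp_heat_l2 ?addr_ge0 ?heatD//; exact: (heat_l2 G m_gt0 t0 (deltal2 y)).
Qed.

Definition cont0 f := forall e, 0 < e -> exists2 d : R, 0 < d & forall t, 0 < t -> t < d ->
  nb m r%:E (fun x => lp_heat t f x - f x) e.

Lemma cont0_delta y : cont0 (delta y).
Proof.
move=> e e0; have [D D0 hD] := nb_pt m_ge0 (le12 R) (m_gt0 y).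
(* Values differ by at most 2, so the r-th power is at most [2^(r-1)] times the first power. The
   choice of [eta] turns the resulting bound [2^(r-1) 2 eta m y] into the r-th power of [e]. *)
set eta := e `^ r / (2 `^ r * m y).
have eta0 : 0 < eta by rewrite divr_gt0 ?mulr_gt0 ?powR_gt0.
have [d d0 hd] := heat_strongly_continuous G m_gt0 (deltal2 y) (divr_gt0 eta0 D0).
exists d => // t t0 td; rewrite lp_heat_l2 ?(ltW t0)//.
have := hD _ _ (hd t t0 td); rewrite mulrC divfK ?gt_eqF// => le.
apply/(nb_fin m_ge0 _ _ r1); split; first exact: ltW.
set C := 2 * (cmod (T t (delta y) y - delta y y) * m y).
have C0 : 2 `^ (r - 1) * C <= e `^ r.
  have -> : 2 `^ (r - 1) * C = cmod (T t (delta y) y - delta y y) * m y * 2 `^ r.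
    have r0 : 0 < r by rewrite (lt_le_trans ltr01).
    by rewrite /C -(mulr_powRB1 (ler0n R 2) r0); ring.
  have -> : e `^ r = eta * m y * 2 `^ r.
    by rewrite /eta; field; rewrite !gt_eqF// powR_gt0.
  by rewrite ler_wpM2r ?powR_ge0// ler_wpM2r.
apply: sbd_le C0 (sbdZ (powR_ge0 2 (r - 1)) (heat_delta_diff y (ltW t0))) => x.
rewrite mulrA ler_wpM2r// -(mulr_powRB1 (cmod_ge0 _)); last by rewrite (lt_le_trans ltr01).
rewrite mulrC ler_wpM2r ?cmod_ge0// ge0_ler_powR ?subr_ge0 ?nnegrE ?cmod_ge0//.
rewrite (le_trans (cmodB _ _))//; have -> : 2 = 1 + 1 :> R by [].
rewrite lerD ?(heat_delta_bound _ (ltW t0))//.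
by rewrite /point_mass; case: ifP => _; rewrite ?cmod1 ?cmod0.
Qed.

Lemma cont0_lin a f g M N : nb m r%:E f M -> nb m r%:E g N -> cont0 f -> cont0 g ->
  cont0 (fun x => a * f x + g x).
Proof.
move=> fM gN cf cg e e0; have a0 := cmod_ge0 a.
have e10 : 0 < e / (cmod a + 1) by rewrite divr_gt0// ltr_wpDl.
have [d1 d10 h1] := cf _ e10; have [d2 d20 h2] := cg _ e10.
exists (Num.min d1 d2) => [|t t0]; first by rewrite lt_min d10.
rewrite lt_min => /andP[/(h1 _ t0) k1 /(h2 _ t0) k2].
have := nbD m_ge0 p1 (nbZ m_ge0 p1 a k1) k2.
have -> : cmod a * (e / (cmod a + 1)) + e / (cmod a + 1) = e by field; rewrite gt_eqF// ltr_wpDl.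
rewrite (nbc_lin lp_heat_contraction a (ltW t0) fM gN).
rewrite (_ : (fun x => _) = (fun x => a * lp_heat t f x + lp_heat t g x - (a * f x + g x)))//.
by apply/funext => x; ring.
Qed.

Lemma cont0_restr f (s : seq X) : uniq s -> cont0 (restr s f).
Proof.
elim: s => [_|y s IH /= /andP[ys us]].
  rewrite restr_nil => e e0; exists 1 => // t t0 _.
  have [_ h0 _ _] := lp_heat_contraction.
  have := nbB m_ge0 p1 (h0 _ _ _ (ltW t0) (nb0 m_ge0 p1)) (nb0 m_ge0 p1).
  by rewrite addr0; apply: (nb_le m_ge0 p1); exact: ltW.
rewrite restr_cons//.
have [M1 h1] := nb_Cc m_ge0 p1 (delta_Cc R y).
have [M2 h2] := nb_restr m_ge0 p1 s f.
by apply: (cont0_lin (f y) h1 h2); [exact: cont0_delta|exact: IH].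
Qed.

Lemma cont0_nb f M : nb m r%:E f M -> cont0 f.
Proof.
move=> fM e e0; have e30 : 0 < e / 3 by rewrite divr_gt0.
have [s us fs] := nb_dens m_ge0 r1 fM e30.
have [d d0 hd] := cont0_restr f us e30; exists d => // t t0 td.
have [hl hc _ _] := lp_heat_contraction.
have [M2 h2] := nb_restr m_ge0 p1 s f.
have := nbD m_ge0 p1 (nbB m_ge0 p1 (hc _ _ _ (ltW t0) fs) fs) (hd t t0 td).
have -> : e / 3 + e / 3 + e / 3 = e by field.
rewrite (_ : (fun x => _ + _) = (fun x => lp_heat t f x - f x))//; apply/funext => x.
have := congr1 (fun F => F x) (hl t (-1) _ _ _ _ (ltW t0) h2 fM) => /=.
rewrite (_ : (fun x => -1 * _ + _) = (fun x => f x - restr s f x)) => [->|]; first ring.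
by apply/funext => y; ring.
Qed.

Lemma lp_heat_extension : lp_extension m r%:E T lp_heat.
Proof.
split.
- exact: (contraction_semigroupP m r lp_heat).2 lp_heat_contraction.
- by move=> f /lpP[M fM]; apply/cvg0P => e e0; exact: cont0_nb fM e e0.
- by move=> t f t0 /l2_lp f2 _; exact: lp_heat_l2.
Qed.

End HeatKernel.

(** * Generators in terms of resolvent kernels *)

Section GeneratorOnLp.
Variables (R : realType) (X : countType) (m : X -> R) (G : graph R X).
Hypothesis m_gt0 : forall x, 0 < m x.
Local Notation fn := (X -> R[i]).
Local Notation lap := (laplacian2 m G).
Local Notation n2 := (n2 m).
Local Notation l2 := (l2 m).
Local Notation delta := (point_mass R).
Local Notation K k := (kop m k).
Implicit Types (f g h u v w phi : fn) (s t e M : R) (a z : R[i]) (k : X -> X -> R[i]).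

Let m_ge0 x : 0 <= m x. Proof. exact: ltW. Qed.
Let r12 : 1 <= 2 :> R. Proof. by rewrite ler1n. Qed.
Let deltal2 y : l2 (delta y). Proof. by apply: (l2_Cc m_ge0); exact: delta_Cc. Qed.

(** All that is needed about [(L_2 - z)^-1]: a Schur kernel that solves [(L - z) u = phi] on l^2,
    and uniqueness of the solution. Only the Schur bound speaks about other exponents. *)
Record resolvent_kernel z k C : Prop := ResolventKernel {
  rk_schur : schur_kernel m k C ;
  rk_lap : forall phi, l2 phi -> lap (K k phi, fun x => phi x + z * K k phi x) ;
  rk_inj : forall q, lap (q, fun x => z * q x) -> q = (fun=> 0) }.

Lemma J_l2_operator : l2_operator m (J m G 1) 1.
Proof.
split=> //.
- by move=> a f g f2 g2; exact: J_lin.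
- by move=> f f2; exact: (J_l2 G m_gt0).
- by move=> f f2; rewrite mul1r; exact: (J_contr G m_gt0).
- move=> x y; have := J_sym G m_gt0 ltr01 (deltal2 x) (deltal2 y).
  rewrite inner_delta// (inner_delta_l m_gt0 _ (J_l2 G m_gt0 ltr01 (deltal2 y))).
  by have := J_conj G m_gt0 ltr01 (deltal2 y); rewrite delta_conj => /(congr1 (fun F => F x)) <-.
Qed.

(** The anchor point: here the Schur bound is the sup-norm contractivity of [(1 + L)^-1], and
    dissipativity gives injectivity of every generator plus 1. *)
Lemma J_resolvent_kernel : resolvent_kernel (-1) (op_kernel m (J m G 1)) 1.
Proof.
have sch : schur_kernel m (op_kernel m (J m G 1)) 1.
  apply: (op_schur m_gt0 J_l2_operator) => // f /(l2_Cc m_ge0) f2 f1.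
  exact: (J_bounded G m_gt0 ltr01 f2).
split=> //.
- move=> phi p2; rewrite (kop_op_kernel m_gt0 J_l2_operator sch p2).
  by apply: lap_ext (JP G m_gt0 ltr01 p2) => x //; rewrite invr1 rmorph1; ring.
- move=> q L; have [q2 _] := lap_l2 m_gt0 L.
  have <- : J m G 1 (fun=> 0) = q.
    by apply: (J_eq m_gt0 ltr01 (l20 m_ge0) L) => x; rewrite rmorph1; ring.
  exact: (op_zero m_gt0 J_l2_operator).
Qed.

(** On a point mass the difference of the two sides is an eigenfunction of [L] on l^2 for [z], hence
    zero by [rk_inj]; density carries the identity to l^r. *)
Lemma resolvent_identity r z k C k1 C1 f M : 1 <= r -> resolvent_kernel z k C ->
  resolvent_kernel (-1) k1 C1 -> nb m r%:E f M ->
  (fun x => K k f x - K k1 f x) = (fun x => (z + 1) * K k (K k1 f) x).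
Proof.
move=> r1 [sk Lk ik] [sk1 Lk1 _] fM; have p1 : (1 <= r%:E)%E by rewrite lee_fin.
pose A f := fun x => K k f x - K k1 f x; pose B f := fun x => (z + 1) * K k (K k1 f) x.
apply: (ext_delta2 m_gt0 r1 (A := A) (B := B) _ _ _ _ _ fM).
- move=> a g h N N' gN hN; rewrite /A (kop_lin m_gt0 p1 sk a gN hN) (kop_lin m_gt0 p1 sk1 a gN hN).
  by apply/funext => x; rewrite mulrBr opprD addrACA.
- move=> a g h N N' gN hN; rewrite /B (kop_lin m_gt0 p1 sk1 a gN hN).
  rewrite (kop_lin m_gt0 p1 sk a (nb_kop m_gt0 p1 sk1 gN) (nb_kop m_gt0 p1 sk1 hN)).
  by apply/funext => x; rewrite mulrDr mulrCA.
- move=> x; have [D _ hD] := kop_pt m_gt0 p1 sk x; have [D1 _ hD1] := kop_pt m_gt0 p1 sk1 x.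
  exists (D + D1) => g N gN; rewrite (le_trans (cmodB _ _))// mulrDl.
  by rewrite lerD ?(hD _ _ gN) ?(hD1 _ _ gN).
- move=> x; have [D _ hD] := kop_pt m_gt0 p1 sk x; exists (cmod (z + 1) * (D * C1)) => g N gN.
  rewrite /B cmodM -mulrA ler_wpM2l ?cmod_ge0// -mulrA.
  by apply: hD; exact: (nb_kop m_gt0 p1 sk1 gN).
- move=> y; have L1 := Lk1 _ (deltal2 y); have [k12 _] := lap_l2 m_gt0 L1.
  have L2 := lap_B m_gt0 (-1) (Lk _ (deltal2 y)) L1.
  have L3 := lap_B m_gt0 (- (z + 1)) L2 (Lk _ k12).
  have E : (fun x => A (delta y) x - B (delta y) x) = (fun=> 0).
    by apply: ik; apply: lap_ext L3 => x; rewrite /A /B;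
      move: (K k (delta y) x) (K k1 (delta y) x) (K k (K k1 (delta y)) x) => a1 a2 a3; ring.
  by apply/funext => x; have := congr1 (fun F => F x) E => /= /eqP; rewrite subr_eq0 => /eqP.
Qed.

Variables (r : R) (r1 : 1 <= r).
Let p1 : (1 <= r%:E)%E. Proof. by rewrite lee_fin. Qed.

Variables (T S : R -> fn -> fn).
Hypotheses (heatT : heat_semigroup m G T) (extS : lp_extension m r%:E T S).

Let Tc : nb_contraction m 2 T.
Proof. by have [h _ _] := heatT; exact/contraction_semigroupP. Qed.

Let Sc : nb_contraction m r S.
Proof. by have [h _ _] := extS; exact/contraction_semigroupP. Qed.

Let TS t f M N : 0 <= t -> nb m 2%:E f M -> nb m r%:E f N -> S t f = T t f.
Proof.
by have [_ _ h] := extS => t0 fM fN; apply: h => //; apply/lpP; [exists M|exists N].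
Qed.

Let S_cont f M e : nb m r%:E f M -> 0 < e -> exists2 d : R, 0 < d &
  forall t, 0 < t -> t < d -> nb m r%:E (fun x => S t f x - f x) e.
Proof.
have [_ h _] := extS => fM; have /h /cvg0P : lp m r%:E f by apply/lpP; exists M.
exact.
Qed.

Let Tsum u w s n x : T (n%:R * s) u x - u x + s%:C * \sum_(j < n) T (j%:R * s) w x =
  \sum_(j < n) (T (j.+1%:R * s) u x - T (j%:R * s) u x + s%:C * T (j%:R * s) w x) + (T (0%:R * s) u x - u x).
Proof.
rewrite big_split /= -mulr_sumr.
have -> : \sum_(j < n) (T (j.+1%:R * s) u x - T (j%:R * s) u x) = T (n%:R * s) u x - T (0%:R * s) u x.
  by rewrite -(big_mkord xpredT (fun j => T (j.+1%:R * s) u x - T (j%:R * s) u x)) telescope_sumr.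
ring.
Qed.

Let nb_sum (q : \bar R) (q1 : (1 <= q)%E) n (F : nat -> fn) e : 
  (forall j, (j < n)%N -> nb m q (F j) e) -> nb m q (fun x => \sum_(j < n) F j x) (n%:R * e).
Proof.
elim: n => [|n IH] h.
  rewrite mul0r (_ : (fun x => _) = (fun=> 0)); first exact: (nb0 m_ge0 q1).
  by apply/funext => x; rewrite big_ord0.
rewrite (_ : (fun x => _) = (fun x => \sum_(j < n) F j x + F n x)); last first.
  by apply/funext => x; rewrite big_ord_recr.
rewrite -natr1 mulrDl mul1r; apply: (nbD m_ge0 q1); last exact: h.
by apply: IH => j jn; apply: h; rewrite (ltn_trans jn).
Qed.

(* Riemann sums for [T t u - u = - int_0^t T s w ds], so that no vector-valued integral is needed. *)
Lemma duhamel_sum u w e t : lap (u, w) -> 0 < e -> 0 < t -> exists n0, forall n, (n0 <= n)%N ->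
  nb m 2%:E (fun x => T t u x - u x + (t / n.+1%:R)%:C * \sum_(j < n.+1) T (j%:R * (t / n.+1%:R)) w x) (t * e).
Proof.
move=> L e0 t0; have [_ _ GT] := heatT; move: (L); rewrite -GT => /generatorP[[M uM] [N wN] h].
have [d d0 hd] := h e e0.
have [n0 hn0] := archi_inv (divr_gt0 d0 (addr_gt0 t0 t0)).
exists n0 => n nn; set s := t / n.+1%:R.
have nn0 : 0 < n.+1%:R :> R by rewrite ltr0n.
have s0 : 0 < s by rewrite divr_gt0.
have sd : s < d.
  have : n.+1%:R^-1 <= d / (t + t) by rewrite (le_trans _ hn0)// lef_pV2 ?posrE ?ltr0n// ler_nat ltnS.
  rewrite /s ler_pdivlMr ?addr_gt0// => le; apply: lt_le_trans le.
  by rewrite mulrC ltr_pM2l ?invr_gt0// ltrDl.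
have E1 : t = n.+1%:R * s by rewrite /s mulrC divfK// gt_eqF.
have js j : 0 <= j%:R * s by rewrite mulr_ge0// ltW.
rewrite {1 2}E1 -mulrA (_ : (fun x => _) = (fun x => \sum_(j < n.+1)
   T (j%:R * s) (fun x => T s u x - u x + s%:C * w x) x)); last first.
  apply/funext => x; rewrite Tsum mul0r (nbc0 Tc uM) subrr addr0; apply: eq_bigr => j _.
  have Tu := nbc_contr Tc (ltW s0) uM.
  have w' := nbZ m_ge0 (le12 R) s%:C wN.
  have -> : (fun x => T s u x - u x + s%:C * w x) = (fun x => 1 * T s u x + (-1 * u x + s%:C * w x)).
    by apply/funext => y; ring.
  have u' := nbD m_ge0 (le12 R) (nbZ m_ge0 (le12 R) (-1) uM) w'.
  rewrite (nbc_lin Tc 1 (js j) Tu u') (nbc_lin Tc (-1) (js j) uM w').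
  rewrite (_ : (fun x => s%:C * w x) = (fun x => s%:C * w x + 0)); last by apply/funext => y; rewrite addr0.
  rewrite (nbc_lin Tc s%:C (js j) wN (nb0 m_ge0 (le12 R))).
  have -> : T (j%:R * s) (fun=> 0) = (fun=> 0).
    have := nbc_lin Tc (-1) (js j) (nb0 m_ge0 (le12 R)) (nb0 m_ge0 (le12 R)).
    rewrite (_ : (fun x => -1 * 0 + 0) = (fun=> 0)); last by apply/funext => y; rewrite mulr0 addr0.
    by move=> ->; apply/funext => y; rewrite mulN1r addNr.
  rewrite -(nbcD Tc (js j) (ltW s0) uM) -natr1 mulrDl mul1r; ring.
apply: (nb_sum (le12 R) (F := fun j => T (j%:R * s) _)) => j _.
exact: (nbc_contr Tc (js j) (taylor_rate m_gt0 r12 s0 (hd _ s0 sd))).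
Qed.

(** The left side is minus the integral of [S s w - w] over [[0, t]]. Its Riemann sums are bounded
    by [t e] in l^r and converge pointwise through l^2, where [S] and [T] agree; the bound survives
    pointwise limits. *)
Lemma taylor_l2 u w t e M N : lap (u, w) -> nb m r%:E u M -> nb m r%:E w N -> 0 < t -> 0 <= e ->
  (forall s, 0 <= s -> s <= t -> nb m r%:E (fun x => S s w x - w x) e) ->
  nb m r%:E (fun x => S t u x - u x + t%:C * w x) (t * e).
Proof.
move=> L uM wN t0 e0 h; have [[M2 u2] [N2 w2]] := lap_l2 m_gt0 L.
apply: (nb_seq_lim m_ge0 p1 (u := fun n x => - (t / n.+1%:R)%:C *
   \sum_(j < n.+1) (S (j%:R * (t / n.+1%:R)) w x - w x))) => [n|x e' e'0].
  have n0 : 0 < n.+1%:R :> R by rewrite ltr0n.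
  have := nbZ m_ge0 p1 (- (t / n.+1%:R)%:C) (nb_sum p1 (n := n.+1) (F := fun j x => S (j%:R * (t / n.+1%:R)) w x - w x) (e := e) _).
  rewrite cmodN cmod_real ger0_norm ?divr_ge0 ?ltW// mulrA divfK ?gt_eqF//; apply => j jn.
  apply: h; first by rewrite mulr_ge0// divr_ge0// ltW.
  by rewrite mulrCA ler_piMr ?(ltW t0)// ler_pdivrMr// mul1r ler_nat ltnW.
have [D D0 hD] := nb_pt m_ge0 (le12 R) (m_gt0 x).
have e10 : 0 < e' / (D * t) by rewrite divr_gt0// mulr_gt0.
have [n0 hn0] := duhamel_sum L e10 t0; exists n0 => n nn.
have /hD := hn0 n nn.
have -> : D * (t * (e' / (D * t))) = e' by field; rewrite !gt_eqF.
congr (cmod _ <= _); rewrite (TS (ltW t0) u2 uM) mulNr opprK sumrB sumr_const card_ord.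
have -> : \sum_(j < n.+1) S (j%:R * (t / n.+1%:R)) w x = \sum_(j < n.+1) T (j%:R * (t / n.+1%:R)) w x.
  by apply: eq_bigr => j _; rewrite (TS _ w2 wN)// mulr_ge0// divr_ge0// ltW.
have -> : t%:C = (t / n.+1%:R)%:C * n.+1%:R :> R[i].
  by rewrite -(rmorph_nat (real_complex R)) -rmorphM divfK// pnatr_eq0.
rewrite -mulr_natl; ring.
Qed.

Variables (z : R[i]) (k : X -> X -> R[i]) (C : R).
Hypothesis kC : resolvent_kernel z k C.

Let sk := rk_schur kC.

Let W phi : fn := fun x => phi x + z * K k phi x.

Let KB phi psi M N : nb m r%:E phi M -> nb m r%:E psi N ->
  K k (fun x => phi x - psi x) = (fun x => K k phi x - K k psi x).
Proof.
move=> h1 h2; have := kop_lin m_gt0 p1 sk (-1) h2 h1.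
rewrite (_ : (fun x => _) = (fun x => phi x - psi x)); last by apply/funext => x; ring.
by move=> ->; apply/funext => x; ring.
Qed.

Let Wnb phi M : nb m r%:E phi M -> nb m r%:E (W phi) ((1 + cmod z * C) * M).
Proof.
move=> h; rewrite mulrDl mul1r -mulrA; apply: (nbD m_ge0 p1) => //.
by apply: (nbZ m_ge0 p1); exact: (nb_kop m_gt0 p1 sk).
Qed.

Let WB phi psi M N : nb m r%:E phi M -> nb m r%:E psi N ->
  W (fun x => phi x - psi x) = (fun x => W phi x - W psi x).
Proof. by move=> h1 h2; apply/funext => x; rewrite /W (KB h1 h2); ring. Qed.

Let SB t phi psi M N : 0 <= t -> nb m r%:E phi M -> nb m r%:E psi N ->
  S t (fun x => phi x - psi x) = (fun x => S t phi x - S t psi x).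
Proof.
move=> t0 h1 h2; have := nbc_lin Sc (-1) t0 h2 h1.
rewrite (_ : (fun x => _) = (fun x => phi x - psi x)); last by apply/funext => x; ring.
by move=> ->; apply/funext => x; ring.
Qed.

Let taylor_diff t phi psi e N : 0 < t -> nb m r%:E phi N -> nb m r%:E (fun x => psi x - phi x) e ->
  [/\ exists M, nb m r%:E psi M,
  nb m r%:E (fun x => (S t (W psi) x - W psi x) - (S t (W phi) x - W phi x)) (2 * (1 + cmod z * C) * e) &
  nb m r%:E (fun x => (S t (K k psi) x - K k psi x + t%:C * W psi x) -
    (S t (K k phi) x - K k phi x + t%:C * W phi x)) (2 * C * e + t * ((1 + cmod z * C) * e))].
Proof.
move=> t0 phiN de.
have psiM : nb m r%:E psi (N + e).
  have := nbD m_ge0 p1 phiN de.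
  by rewrite (_ : (fun x => _) = psi)//; apply/funext => x; ring.
split; first by exists (N + e).
  have Wd := Wnb de; have := nbB m_ge0 p1 (nbc_contr Sc (ltW t0) Wd) Wd.
  rewrite (WB psiM phiN) (SB (ltW t0) (Wnb psiM) (Wnb phiN)) -mulr2n -[X in nb _ _ _ X]mulr_natl mulrA.
  by rewrite (_ : (fun x => _) = (fun x => (S t (W psi) x - W psi x) - (S t (W phi) x - W phi x)))//; apply/funext => x; ring.
have Kd := nb_kop m_gt0 p1 sk de.
have := nbD m_ge0 p1 (nbB m_ge0 p1 (nbc_contr Sc (ltW t0) Kd) Kd) (nbZ m_ge0 p1 t%:C (Wnb de)).
rewrite cmod_real gtr0_norm// -mulr2n -[X in nb _ _ _ (X + _) -> _]mulr_natl mulrA.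
rewrite (KB psiM phiN) (WB psiM phiN) (SB (ltW t0) (nb_kop m_gt0 p1 sk psiM) (nb_kop m_gt0 p1 sk phiN)).
rewrite (_ : (fun x => _) = (fun x => (S t (K k psi) x - K k psi x + t%:C * W psi x) -
    (S t (K k phi) x - K k phi x + t%:C * W phi x)))//; apply/funext => x; ring.
Qed.

(** For finitely supported [phi] the function [K k phi] lies in the domain of [L] on l^2, so
    [taylor_l2] applies. Both the hypothesis and the conclusion are stable under small changes of
    [phi] in l^r. *)
Lemma taylor_lp phi t e M : nb m r%:E phi M -> 0 < t -> 0 < e ->
  (forall s, 0 < s -> s <= t -> nb m r%:E (fun x => S s (W phi) x - W phi x) e) ->
  nb m r%:E (fun x => S t (K k phi) x - K k phi x + t%:C * W phi x) (t * e).
Proof.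
move=> phiM t0 e0 h; apply: nb_inf; first by rewrite mulr_ge0// ltW.
move=> e' e'0; have C0 := schur_gt0 sk; have z0 := cmod_ge0 z.
have D1 : 0 < 1 + cmod z * C by rewrite ltr_pwDl// mulr_ge0// ltW.
have D0 : 0 < t * (2 * (1 + cmod z * C)) + (2 * C + t * (1 + cmod z * C)).
    by rewrite addr_gt0 ?mulr_gt0// addr_gt0 ?mulr_gt0.
(* [D] collects the factors with which the truncation error [e' / D] enters, so that the total loss
   is [e']. *)
set D := t * _ + _ in D0; have ed : 0 < e' / D by rewrite divr_gt0.
have [s us hs] := nb_dens m_ge0 r1 phiM ed.
have hs' : nb m r%:E (fun x => restr s phi x - phi x) (e' / D).
  by apply: (nb_mono m_ge0 p1 _ (lexx _) hs) => x; rewrite cmod_distC.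
have [N sN] := nb_restr m_ge0 p1 s phi.
have [N2 sN2] := nb_restr m_ge0 (le12 R) s phi.
have L := rk_lap kC (L2 sN2).
have e10 : 0 <= e + 2 * (1 + cmod z * C) * (e' / D).
  by rewrite addr_ge0 ?(ltW e0)// mulr_ge0 ?(ltW ed)// mulr_ge0 ?(ltW D1).
have := taylor_l2 L (nb_kop m_gt0 p1 sk sN) (Wnb sN) t0 e10.
have H s' : 0 <= s' -> s' <= t ->
    nb m r%:E (fun x => S s' (W (restr s phi)) x - W (restr s phi) x) (e + 2 * (1 + cmod z * C) * (e' / D)).
  rewrite le_eqVlt => /orP[/eqP <- _|s'0 s't].
    rewrite (nbc0 Sc (Wnb sN)) (_ : (fun x => _) = (fun=> 0)); last by apply/funext => x; rewrite subrr.
    by apply: (nb_le m_ge0 p1 _ (nb0 m_ge0 p1)).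
  have [_ h1 _] := taylor_diff s'0 phiM hs'.
  have := nbD m_ge0 p1 (h s' s'0 s't) h1.
  by rewrite (_ : (fun x => _) = (fun x => S s' (W (restr s phi)) x - W (restr s phi) x))//; apply/funext => x; ring.
move=> /(_ H) h1; have [_ _ h2] := taylor_diff t0 sN hs.
have := nbD m_ge0 p1 h1 h2.
have -> : t * (e + 2 * (1 + cmod z * C) * (e' / D)) +
   (2 * C * (e' / D) + t * ((1 + cmod z * C) * (e' / D))) = t * e + e'.
  have : D * (e' / D) = e' by rewrite mulrC divfK// gt_eqF.
  by move: (e' / D) => q; rewrite /D => <-; ring.
rewrite (_ : (fun x => _) = (fun x => S t (K k phi) x - K k phi x + t%:C * W phi x))//; apply/funext => x; rewrite /W; ring.
Qed.

(** The range of the kernel lies in the domain of the generator of any admissible [S]: strong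
    continuity of [S] at [phi + z K phi] feeds [taylor_lp]. *)
Lemma kop_generator phi M : nb m r%:E phi M ->
  generator m r%:E S (K k phi, fun x => phi x + z * K k phi x).
Proof.
move=> phiM; apply/generatorP; split.
- by exists (C * M); exact: (nb_kop m_gt0 p1 sk).
- by exists ((1 + cmod z * C) * M); exact: Wnb.
move=> e e0; have [d d0 hd] := S_cont (Wnb phiM) e0; exists d => // t t0 td.
apply: (rate_taylor m_gt0 r1 t0); apply: (taylor_lp phiM t0 e0) => s s0 st.
by apply: hd => //; exact: le_lt_trans td.
Qed.

End GeneratorOnLp.

(** * The graph of L_p in terms of a resolvent kernel *)

Section GeneratorCharacterization.
Variables (R : realType) (X : countType) (m : X -> R) (G : graph R X).
Hypothesis m_gt0 : forall x, 0 < m x.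
Local Notation fn := (X -> R[i]).
Local Notation K k := (kop m k).
Implicit Types (f g h : fn).
Let m_ge0 x : 0 <= m x. Proof. exact: ltW. Qed.

(** Write [k1] for the kernel at -1. If the generator maps [f] to [z f], injectivity of the
    generator plus 1 gives [f = (z + 1) k1 f]. Then the resolvent identity
    [k f - k1 f = (z + 1) k k1 f = k f] shows [k1 f = 0], so [f = 0]. *)
Lemma generator_inj r T S z k C f : 1 <= r -> heat_semigroup m G T -> lp_extension m r%:E T S ->
  resolvent_kernel m G z k C -> generator m r%:E S (f, fun x => z * f x) -> f = (fun=> 0).
Proof.
move=> r1 hT eS kC FG; have p1 : (1 <= r%:E)%E by rewrite lee_fin.
have Sc : nb_contraction m r S by have [h _ _] := eS; exact/contraction_semigroupP.
have [[M fM] _ _] := (generatorP m r S _ _).1 FG.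
have k1 := J_resolvent_kernel G m_gt0; set k' := op_kernel _ _ in k1.
have zM := nbZ m_ge0 p1 (z + 1) fM.
have Z0 := nb0 m_ge0 p1.
have KZ : K k' (fun x => (z + 1) * f x) = (fun x => (z + 1) * K k' f x).
  have := kop_lin m_gt0 p1 (rk_schur k1) (z + 1) fM Z0.
  rewrite (_ : (fun x => _ + 0) = (fun x => (z + 1) * f x)); last by apply/funext => x; rewrite addr0.
  move=> ->; apply/funext => x.
  have := kop_lin m_gt0 p1 (rk_schur k1) (-1) Z0 Z0.
  rewrite (_ : (fun x => -1 * 0 + 0) = (fun=> 0)); last by apply/funext => y; rewrite mulr0 addr0.
  by move=> ->; rewrite mulN1r addNr addr0.
have G1 := kop_generator m_gt0 r1 hT eS k1 zM.
have D := generator_lin m_gt0 r1 (-1) Sc G1 FG.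
have E : (fun x => -1 * K k' (fun x => (z + 1) * f x) x + f x) = (fun=> 0).
  apply: (generator_dissipative m_gt0 r1 Sc).
  by rewrite (_ : (fun x => - _) = (fun x => -1 * ((z + 1) * f x + -1 * K k' (fun x => (z + 1) * f x) x) + z * f x))//; apply/funext => x; ring.
have Ef x : f x = (z + 1) * K k' f x.
  by have := congr1 (fun F => F x) E => /= /eqP; rewrite KZ mulN1r addrC subr_eq0 => /eqP.
have RI := resolvent_identity m_gt0 r1 kC k1 fM.
have k'M := nb_kop m_gt0 p1 (rk_schur k1) fM.
have Kf : K k f = (fun x => (z + 1) * K k (K k' f) x).
  have {1}-> : f = (fun x => (z + 1) * K k' f x + 0) by apply/funext => x; rewrite addr0.
  rewrite (kop_lin m_gt0 p1 (rk_schur kC) (z + 1) k'M Z0); apply/funext => x.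
  have := kop_lin m_gt0 p1 (rk_schur kC) (-1) Z0 Z0.
  rewrite (_ : (fun x => -1 * 0 + 0) = (fun=> 0)); last by apply/funext => y; rewrite mulr0 addr0.
  by move=> ->; rewrite mulN1r addNr addr0.
apply/funext => x; rewrite Ef.
have := congr1 (fun F => F x) RI => /=; rewrite [K k f](Kf).
by move=> /eqP; rewrite -subr_eq0 addrAC subrr add0r oppr_eq0 => /eqP ->; rewrite mulr0.
Qed.

(** The right side mentions neither [T] nor [S], so the choice left open in [lp_generator] does not
    affect the operator. *)
Lemma lp_generatorP r z k C f g : 1 <= r -> resolvent_kernel m G z k C ->
  lp_generator m G r%:E (f, g) <->
  [/\ exists M, nb m r%:E f M, exists M, nb m r%:E g M & f = K k (fun x => g x - z * f x)].
Proof.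
move=> r1 kC; have p1 : (1 <= r%:E)%E by rewrite lee_fin.
have nbz M N : nb m r%:E f M -> nb m r%:E g N -> nb m r%:E (fun x => g x - z * f x) (N + cmod z * M).
  by move=> fM gN; apply: (nbB m_ge0 p1) => //; exact: (nbZ m_ge0 p1).
split=> [[T [S [hT eS FG]]]|[[M fM] [N gN] E]].
  have Sc : nb_contraction m r S by have [h _ _] := eS; exact/contraction_semigroupP.
  have [[M fM] [N gN] _] := (generatorP m r S _ _).1 FG.
  split; [by exists M|by exists N|].
  have D := generator_lin m_gt0 r1 (-1) Sc (kop_generator m_gt0 r1 hT eS kC (nbz _ _ fM gN)) FG.
  have E : (fun x => -1 * K k (fun x => g x - z * f x) x + f x) = (fun=> 0).
    apply: (generator_inj r1 hT eS kC).
    rewrite (_ : (fun x => z * _) = (fun x => -1 * (g x - z * f x + z * K k (fun x => g x - z * f x) x) + g x))//.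
    by apply/funext => x; ring.
  by apply/funext => x; have := congr1 (fun F => F x) E => /= /eqP; rewrite mulN1r addrC subr_eq0 => /eqP.
exists (heat m G), (lp_heat m G).
have hT := heat_heat_semigroup G m_gt0; have eS := lp_heat_extension G m_gt0 r1; split=> //.
have := kop_generator m_gt0 r1 hT eS kC (nbz _ _ fM gN); rewrite -E.
by rewrite (_ : (fun x => _) = g)//; apply/funext => x; ring.
Qed.

Lemma laplacianP (p : \bar R) z k C f g : (1 <= p)%E -> resolvent_kernel m G z k C ->
  laplacian m G p (f, g) <->
  [/\ exists M, nb m p f M, exists M, nb m p g M & f = K k (fun x => g x - z * f x)].
Proof.
move=> p1 kC; case: p p1 => [r| |//]; first by rewrite lee_fin => r1; exact: (lp_generatorP f g r1 kC).
move=> _; have oo1 : (1 <= +oo :> \bar R)%E by rewrite leey.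
have l11 : (1 <= 1%:E :> \bar R)%E by rewrite lee_fin.
have r11 : 1 <= 1 :> R by [].
have nbz M N : nb m +oo%E f M -> nb m +oo%E g N -> nb m +oo%E (fun x => g x - z * f x) (N + cmod z * M).
  by move=> fM gN; apply: (nbB m_ge0 oo1) => //; exact: (nbZ m_ge0 oo1).
have sk := rk_schur kC.
(* The defect in the duality relation, tested with [u = K k phi], equals the pairing of [phi] with
   [K k (g - z f) - f]. Point masses [phi] give one direction, and since all elements of the domain
   on l^1 have the form [K k phi], it gives the other too. *)
have key phi M N L : nb m +oo%E f M -> nb m +oo%E g N -> nb m 1%:E phi L ->
    pairing m (K k phi) g - pairing m (fun x => phi x + z * K k phi x) f =
    pairing m phi (fun x => -1 * f x + K k (fun x => g x - z * f x) x).
  move=> fM gN pL; have KL := nb_kop m_gt0 l11 sk pL.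
  rewrite (pairing_linr m_gt0 (-1) pL fM (nb_kop m_gt0 oo1 sk (nbz _ _ fM gN))).
  rewrite -(pairing_kop m_gt0 sk pL (nbz _ _ fM gN)).
  rewrite (_ : (fun x => phi x + _) = (fun x => z * K k phi x + phi x)); last by apply/funext => x; rewrite addrC.
  rewrite (pairing_linl m_gt0 z KL pL fM).
  rewrite (_ : (fun x => g x - _) = (fun x => - z * f x + g x)); last by apply/funext => x; ring.
  by rewrite (pairing_linr m_gt0 (- z) KL fM gN); ring.
split=> [[/= /lpP [M fM] /lpP[N gN] h]|[[M fM] [N gN] E]].
  split; [by exists M|by exists N|].
  apply/funext => y; have [L dL] := nb_Cc m_ge0 l11 (delta_Cc R y).
  have := key _ _ _ _ fM gN dL.
  have -> : pairing m (K k (point_mass R y)) g = pairing m (fun x => point_mass R y x + z * K k (point_mass R y) x) f.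
    apply/esym; apply: h; apply/(lp_generatorP _ _ r11 kC); split.
    - by exists (C * L); exact: (nb_kop m_gt0 l11 sk).
    - exists (L + cmod z * (C * L)); apply: (nbD m_ge0 l11) => //; apply: (nbZ m_ge0 l11).
      exact: (nb_kop m_gt0 l11 sk).
    - by congr (K k _); apply/funext => x; ring.
  rewrite subrr pairing_delta => /esym /eqP; rewrite mulf_eq0 (negPf (m_neq0 m_gt0 y)) orbF.
  by rewrite mulN1r addrC subr_eq0 => /eqP.
split; [by apply/lpP; exists M|by apply/lpP; exists N|] => u v /(lp_generatorP _ _ r11 kC)[[M1 uM] [M2 vM] Eu].
have phiM := nbB m_ge0 l11 vM (nbZ m_ge0 l11 z uM).
have := key _ _ _ _ fM gN phiM; rewrite -Eu.
rewrite (_ : (fun x => v x - z * u x + z * u x) = v); last by apply/funext => x; ring.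
rewrite (_ : (fun x => -1 * _ + _) = (fun=> 0)); last first.
  by apply/funext => x; rewrite {1}E; ring.
have -> : pairing m (fun x => v x - z * u x) (fun=> 0) = 0.
  have Z0 := nb0 m_ge0 oo1.
  have := pairing_linr m_gt0 (-1) phiM Z0 Z0.
  rewrite (_ : (fun x => -1 * 0 + 0) = (fun=> 0)); last by apply/funext => y; rewrite mulr0 addr0.
  by rewrite mulN1r addNr.
by move=> /eqP; rewrite subr_eq0 => /eqP ->.
Qed.

End GeneratorCharacterization.

(** * The Combes-Thomas estimate *)

(** Tonelli for bounds on finite sums: a finite list of pairs sits in a finite rectangle, over which
    the sums are exchanged. *)
Lemma sbd_snd (R : realType) (I J : choiceType) (a : I * J -> R) (c e : J -> R) A :
  (forall p, 0 <= a p) -> (forall y, 0 <= c y) -> (forall y, sbd (fun x => a (x, y)) (e y)) ->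
  sbd (fun y => e y * c y) A -> sbd (fun p => a p * c p.2) A.
Proof.
move=> a0 c0 ae ecA s us.
pose t := [seq (x, y) | x <- undup (map fst s), y <- undup (map snd s)].
apply: (@le_trans _ _ (\sum_(p <- t) a p * c p.2)).
  apply: ler_sum_subset => // [p|[x y] xys]; first by rewrite mulr_ge0.
  apply/allpairsP; exists (x, y); rewrite /= !mem_undup; split=> //.
    by apply/mapP; exists (x, y).
  by apply/mapP; exists (x, y).
rewrite /t big_allpairs exchange_big /=; apply: le_trans (ecA _ (undup_uniq (map snd s))).
apply: ler_sum => y _ /=; rewrite -mulr_suml ler_wpM2r//; apply: ae; exact: undup_uniq.
Qed.

Lemma one_sub_expR_le (R : realType) (a B : R) : `|a| <= B -> `|1 - expR a| <= `|a| * expR B.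
Proof.
move=> aB; have [a0|a0] := leP 0 a.
  have e1 : 1 <= expR a by rewrite -expR0 ler_expR.
  rewrite distrC ger0_norm ?subr_ge0// (ger0_norm a0).
  have := expR_ge1Dx (- a); rewrite expRN => h.
  have E0 := expR_gt0 a.
  apply: (@le_trans _ _ (a * expR a)).
    have : (1 - a) * expR a <= 1 by rewrite -[leRHS](mulVf (lt0r_neq0 E0)) ler_wpM2r ?(ltW E0).
    lra.
  by rewrite ler_wpM2l// ler_expR (le_trans _ aB)// ler_norm.
have B0 : 0 <= B by apply: le_trans aB.
rewrite ger0_norm ?subr_ge0; last by rewrite -expR0 ler_expR ltW.
rewrite (ltr0_norm a0); apply: (@le_trans _ _ (- a)).
  by have := expR_ge1Dx a; lra.
by rewrite ler_peMr ?oppr_ge0 ?(ltW a0)// -expR0 ler_expR.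
Qed.

(** The form on a single edge: [p], [q] are the values of [f] at its ends, [v], [w] those of the
    conjugated test function, [a], [c] the weights. Each error term contains a factor [1 - c / a] or
    [1 - a / c], and the last contains both. *)
Lemma tilt_identity (F : fieldType) (a c p q v w : F) : a != 0 -> c != 0 ->
  (p - q) * (a * v - c * w) = (a * p - c * q) * (v - w) + ((a * p - c * q) * ((1 - c / a) * w) +
    (1 - a / c) * (c * q) * (v - w) + (1 - c / a) * (c * q) * ((1 - a / c) * w)).
Proof. by move=> a0 c0; field; rewrite a0 c0. Qed.

Lemma conj_affine (F : numClosedFieldType) (z a c : F) :
  ((1 + z^*) * (a + c))^* = (1 + z) * (a^* + c^*).
Proof. by rewrite rmorphM !rmorphD rmorph1 /= conjCK. Qed.

Section Tilt.
Variables (R : realType) (X : countType) (m : X -> R) (G : graph R X) (d : X -> X -> R).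
Hypothesis m_gt0 : forall x, 0 < m x.
Local Notation fn := (X -> R[i]).
Local Notation b := (edge_weight G).
Local Notation FD := (form_domain m G).
Local Notation W := (form_weight m G).
Local Notation lap := (laplacian2 m G).
Local Notation nQ f := (n2 (W 1) (gr f)).
Local Notation n2w := n2.
Local Notation n2 := (n2 m).
Local Notation l2w := l2.
Local Notation l2 := (l2 m).
Local Notation delta := (point_mass R).
Implicit Types (f g h u v : fn) (x y : X) (t e M : R) (z : R[i]).

Let m_ge0 x : 0 <= m x. Proof. exact: ltW. Qed.
Let W10 : forall k, 0 <= W 1 k. Proof. by apply: form_weight_ge0 => //; exact: ler01. Qed.
Let b0 x y : 0 <= b x y. Proof. exact: edge_weight_ge0. Qed.

Variable s : R.
Hypothesis d_ge0 : forall x y, 0 <= d x y.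
Hypothesis d_sym : forall x y, d x y = d y x.
Hypothesis d_intr : forall x, sbd (fun y => b x y * d x y ^+ 2) (m x).
Hypothesis d_jump : forall x y, 0 < b x y -> d x y <= s.

Definition edge_family (F : X * X -> R[i]) (k : form_index X) : R[i] := if k is inl p then F p else 0.

(** This is where the intrinsic condition enters: for fixed [y], the sum of [b(x, y) d(x, y)^2] over
    [x] is at most [m y], so a factor [d] on each edge is paid for by the l^2 norm of [v]. *)
Lemma nb_edge F v kappa M : 0 <= kappa ->
  (forall x y, 0 < b x y -> cmod (F (x, y)) <= kappa * d x y * cmod (v y)) ->
  nb m 2%:E v M -> nb (W 1) 2%:E (edge_family F) (kappa * M).
Proof.
move=> k0 Fv vM; have M0 := nb_ge0 vM; have [_ vs] := (nb2P m_ge0 _ _).1 vM.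
apply/(nb2P W10); split; first by rewrite mulr_ge0.
rewrite -[_ ^+ 2]addr0; apply: sbd_split => /=; last first.
  by move=> t _; rewrite big1// => j _; rewrite cmod0 expr0n mul0r.
have h : sbd (fun p : X * X => b p.1 p.2 * d p.1 p.2 ^+ 2 * cmod (v p.2) ^+ 2) (M ^+ 2).
  apply: (sbd_snd (a := fun p => b p.1 p.2 * d p.1 p.2 ^+ 2) (c := fun y => cmod (v y) ^+ 2) (e := m)).
  - by move=> p; rewrite mulr_ge0 ?sqr_ge0.
  - by move=> y; rewrite sqr_ge0.
  - move=> y; apply: sbd_le (d_intr y) => //= x.
    by rewrite edge_weight_sym d_sym.
  - by apply: sbd_le vs => // y; rewrite mulrC.
rewrite exprMn; apply: sbd_le (lexx _) (sbdZ (sqr_ge0 kappa) h) => -[x y].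
rewrite [form_weight _ _ _ _](_ : _ = 1 * (2^-1 * b x y)); last by [].
have := b0 x y; rewrite le_eqVlt => /orP[/eqP <-|bp].
  by rewrite !(mulr0, mul0r).
have := Fv _ _ bp; set a := cmod (F _) => le.
have le2 : a ^+ 2 <= (kappa * d x y * cmod (v y)) ^+ 2.
  by rewrite ler_pXn2r ?nnegrE ?cmod_ge0// !mulr_ge0// cmod_ge0.
apply: (@le_trans _ _ (a ^+ 2 * b x y)).
  rewrite mul1r ler_wpM2l ?sqr_ge0//; have := b0 x y; lra.
apply: (@le_trans _ _ ((kappa * d x y * cmod (v y)) ^+ 2 * b x y)); first by rewrite ler_wpM2r.
rewrite le_eqVlt; apply/orP; left; apply/eqP => /=; ring.
Qed.

Lemma edge_n2 F v kappa : 0 <= kappa ->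
  (forall x y, 0 < b x y -> cmod (F (x, y)) <= kappa * d x y * cmod (v y)) ->
  l2 v -> l2w (W 1) (edge_family F) /\ n2w (W 1) (edge_family F) <= kappa * n2 v.
Proof.
move=> k0 Fv v2; have h := nb_edge k0 Fv (nb_n2 m_ge0 v2); split; first by exists (kappa * n2 v).
exact: (n2_le W10 h).
Qed.

Lemma edge_grad_n2 f : l2w (W 1) (gr f) -> let F := edge_family (fun p => f p.1 - f p.2) in
  l2w (W 1) F /\ n2w (W 1) F <= nQ f.
Proof. by move=> f2; apply: (n2_mono W10 _ f2) => -[p|k] //=; rewrite cmod0 cmod_ge0. Qed.

Section Weight.
Variables (eps N : R) (tau : X -> R).
Hypothesis eps0 : 0 <= eps.
Hypothesis tauN : forall x, tau x <= N.
Hypothesis tau_lip : forall x y, `|tau x - tau y| <= d x y.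

(** Across an edge the exponent varies by at most [eps d(x, y)], itself at most [eps s]; hence the
    relative change of the weight is at most [kappa d(x, y)]. *)
Let kappa := eps * expR (eps * s).
Let k0 : 0 <= kappa. Proof. by rewrite mulr_ge0// expR_ge0. Qed.

Definition tilt f : fn := fun x => (expR (eps * tau x))%:C * f x.

Let theta x y := 1 - expR (eps * (tau y - tau x)).

Let theta_le x y : 0 < b x y -> `|theta x y| <= kappa * d x y.
Proof.
move=> bp; rewrite /theta.
have le : `|eps * (tau y - tau x)| <= eps * d x y.
  by rewrite normrM ger0_norm// ler_wpM2l// distrC.
have le2 : `|eps * (tau y - tau x)| <= eps * s by rewrite (le_trans le)// ler_wpM2l// d_jump.
rewrite (le_trans (one_sub_expR_le le2))// /kappa mulrAC ler_wpM2r ?expR_ge0//.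
Qed.

Let theta_le' x y : 0 < b x y -> `|theta y x| <= kappa * d x y.
Proof. by move=> bp; rewrite d_sym theta_le// edge_weight_sym. Qed.

Lemma tilt_move f v x : f x * (tilt v x)^* = tilt f x * (v x)^*.
Proof.
rewrite /tilt [(_ * _)^*]rmorphM mulrA; congr (_ * _); rewrite mulrC; congr (_ * _).
by exact: conj_realC.
Qed.

(** The upper bound [N] on [tau] makes the weight bounded. By the product rule the gradient of
    [tilt g] is weight times gradient plus an edge term covered by [nb_edge], so approximation by
    finitely supported functions persists. *)
Lemma tilt_FD f : FD f -> FD (tilt f).
Proof.
move=> /(form_domainP G m_gt0) h; apply/(form_domainP G m_gt0) => e e0.
pose B := expR (eps * N); have B0 : 0 < B := expR_gt0 _.
have D0 : 0 < B * (1 + kappa) by rewrite mulr_gt0// ltr_wpDr.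
have [phi phiC hp] := h _ (divr_gt0 e0 D0).
exists (tilt phi).
  apply: sub_finite_set phiC => x /=; apply: contra => /eqP p0.
  by rewrite /tilt p0 mulr0.
set g := fun x => f x - phi x in hp.
have rB x : cmod (expR (eps * tau x))%:C <= B.
  by rewrite cmod_real ger0_norm ?expR_ge0// ler_expR ler_wpM2l.
have E : gr (fun x => tilt f x - tilt phi x) = (fun k => (match k with
   | inl p => (expR (eps * tau p.1))%:C | inr (inl x) => (expR (eps * tau x))%:C
   | inr (inr x) => (expR (eps * tau x))%:C end) * gr g k +
   edge_family (fun p => (expR (eps * tau p.1) * theta p.1 p.2)%:C * g p.2) k).
  apply/funext => -[[x y]|[x|x]].
  - have E1 : expR (eps * tau x) * theta x y = expR (eps * tau x) - expR (eps * tau y).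
      by rewrite /theta mulrBr mulr1 -expRD; congr (_ - expR _); ring.
    rewrite [gr _ _](_ : _ = (tilt f x - tilt phi x) - (tilt f y - tilt phi y)); last by [].
    rewrite [gr _ _](_ : _ = g x - g y); last by [].
    rewrite [edge_family _ _](_ : _ = (expR (eps * tau x) * theta x y)%:C * g y); last by [].
    by rewrite E1 rmorphB /g /tilt /=; ring.
  - rewrite [gr _ _](_ : _ = tilt f x - tilt phi x); last by [].
    rewrite [gr _ _](_ : _ = g x); last by [].
    by rewrite [edge_family _ _](_ : _ = 0)// /g /tilt; ring.
  - rewrite [gr _ _](_ : _ = tilt f x - tilt phi x); last by [].
    rewrite [gr _ _](_ : _ = g x); last by [].
    by rewrite [edge_family _ _](_ : _ = 0)// /g /tilt; ring.
rewrite E.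
have -> : e = B * (e / (B * (1 + kappa))) + B * kappa * (e / (B * (1 + kappa))).
  by field; rewrite !gt_eqF// ltr_wpDr.
apply: (nbD W10 (le12 R)).
  have := nbZ W10 (le12 R) B%:C hp; rewrite cmod_real (gtr0_norm B0).
  apply: (nb_mono W10 (le12 R)) => // k; rewrite !cmodM cmod_real (gtr0_norm B0) ler_wpM2r ?cmod_ge0//.
  by case: k => [p|[x|x]].
apply: (nb_edge (v := g)); first by rewrite mulr_ge0// ltW.
  move=> x y bp; rewrite cmodM ler_wpM2r ?cmod_ge0// cmod_real normrM /=.
  rewrite -mulrA ler_pM//; last exact: theta_le.
  by have := rB x; rewrite cmod_real.
exact: (nb_gr m_gt0 ler01 hp).
Qed.

(* The perturbation is split into three terms controlled by [b d^2], which is summable,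
   whereas [sum_y b(x,y) d(x,y)] may be infinite. *)
Lemma tilt_form f v : FD f -> FD v -> exists P : R[i],
  inner (W 1) (gr f) (gr (tilt v)) = inner (W 1) (gr (tilt f)) (gr v) + P /\
  cmod P <= (2 * kappa + kappa ^+ 2) * (nQ (tilt f) * nQ v).
Proof.
move=> fF vF; have tf := tilt_FD fF; have tv := tilt_FD vF; set u := tilt f in tf *.
have R01 : 0 <= 1 :> R := ler01.
have gf := FD_gr m_gt0 R01 fF; have gv := FD_gr m_gt0 R01 vF.
have gu := FD_gr m_gt0 R01 tf; have gtv := FD_gr m_gt0 R01 tv.
have u2 := FD_l2 m_gt0 tf; have v2 := FD_l2 m_gt0 vF.
pose th x y : R[i] := (theta x y)%:C.
have thc x y : (th x y)^* = th x y by exact: conj_realC.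
have le1 w x y : 0 < b x y -> cmod (th x y * w y) <= kappa * d x y * cmod (w y).
  by move=> bp; rewrite cmodM ler_wpM2r ?cmod_ge0// cmod_real theta_le.
have le2 w x y : 0 < b x y -> cmod (th y x * w y) <= kappa * d x y * cmod (w y).
  by move=> bp; rewrite cmodM ler_wpM2r ?cmod_ge0// cmod_real theta_le'.
pose A1 := edge_family (fun p => u p.1 - u p.2); pose B1 := edge_family (fun p => th p.1 p.2 * v p.2).
pose A2 := edge_family (fun p => th p.2 p.1 * u p.2); pose B2 := edge_family (fun p => v p.1 - v p.2).
pose A3 := edge_family (fun p => th p.1 p.2 * u p.2); pose B3 := edge_family (fun p => th p.2 p.1 * v p.2).
have [A1l A1n] := edge_grad_n2 gu; have [B2l B2n] := edge_grad_n2 gv.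
have [B1l B1n] := edge_n2 (F := fun p => th p.1 p.2 * v p.2) k0 (le1 v) v2.
have [A2l A2n] := edge_n2 (F := fun p => th p.2 p.1 * u p.2) k0 (le2 u) u2.
have [A3l A3n] := edge_n2 (F := fun p => th p.1 p.2 * u p.2) k0 (le1 u) u2.
have [B3l B3n] := edge_n2 (F := fun p => th p.2 p.1 * v p.2) k0 (le2 v) v2.
exists (inner (W 1) A1 B1 + inner (W 1) A2 B2 + inner (W 1) A3 B3); split; last first.
  have nu := n2_gr m_gt0 tf; have nv := n2_gr m_gt0 vF.
  have nu0 := n2_ge0 m u; have nv0 := n2_ge0 m v.
  have ge1 := n2_ge0 (W 1) (gr u); have ge2 := n2_ge0 (W 1) (gr v).
  have := cmod_inner_n2 W10 A1l B1l; have := cmod_inner_n2 W10 A2l B2l; have := cmod_inner_n2 W10 A3l B3l.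
  move=> h3 h2 h1.
  have h1' : cmod (inner (W 1) A1 B1) <= kappa * (nQ u * nQ v).
    rewrite (le_trans h1)// mulrCA ler_pM ?n2_ge0// (le_trans B1n)// ler_wpM2l//.
  have h2' : cmod (inner (W 1) A2 B2) <= kappa * (nQ u * nQ v).
    rewrite (le_trans h2)// mulrA ler_pM ?n2_ge0// (le_trans A2n)// ler_wpM2l//.
  have h3' : cmod (inner (W 1) A3 B3) <= kappa ^+ 2 * (nQ u * nQ v).
    rewrite (le_trans h3)// expr2 mulrACA ler_pM ?n2_ge0//.
      by rewrite (le_trans A3n)// ler_wpM2l.
    by rewrite (le_trans B3n)// ler_wpM2l.
  rewrite (le_trans (cmodD _ _))// mulrDl lerD// (le_trans (cmodD _ _))//.
  by rewrite -mulrA [leRHS]mulr_natl mulr2n lerD.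
have s0 := asum_inner W10 gu gv; have s1 := asum_inner W10 A1l B1l.
have s2 := asum_inner W10 A2l B2l; have s3 := asum_inner W10 A3l B3l.
have s12 := asumD s1 s2; have s123 := asumD s12 s3.
rewrite !innerE -(csumD s1 s2) -(csumD s12 s3) -(csumD s0 s123).
apply: eq_csum => -[[x y]|[x|x]].
- rewrite [gr f _](_ : _ = f x - f y); last by [].
  rewrite [gr v _](_ : _ = v x - v y); last by [].
  rewrite [gr u _](_ : _ = u x - u y); last by [].
  rewrite [gr (tilt v) _](_ : _ = tilt v x - tilt v y); last by [].
  rewrite /A1 /A2 /A3 /B1 /B2 /B3 /edge_family /=.
  rewrite -!mulrDl; congr (_ * _).
  have thE x' y' : th x' y' = 1 - (expR (eps * tau y'))%:C / (expR (eps * tau x'))%:C.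
    by rewrite /th /theta mulrBr expRD expRN rmorphB rmorph1 rmorphM fmorphV.
  have cJ z w : (z * w)^* = z^* * w^* by exact: rmorphM.
  have cB z w : (z - w)^* = z^* - w^* by exact: rmorphB.
  have ec x' : (expR (eps * tau x'))%:C^* = (expR (eps * tau x'))%:C :> R[i].
    by exact: conj_realC.
  rewrite /u /tilt !cB !cJ !thc !ec !thE.
  by apply: tilt_identity; rewrite eq_complex /= eqxx andbT expR_eq0.
- rewrite [gr f _](_ : _ = f x); last by [].
  rewrite [gr v _](_ : _ = v x); last by [].
  rewrite [gr u _](_ : _ = u x); last by [].
  rewrite [gr (tilt v) _](_ : _ = tilt v x); last by [].
  by rewrite /A1 /A2 /A3 /edge_family !mul0r !addr0; congr (_ * _); exact: tilt_move.
- rewrite [gr f _](_ : _ = f x); last by [].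
  rewrite [gr v _](_ : _ = v x); last by [].
  rewrite [gr u _](_ : _ = u x); last by [].
  rewrite [gr (tilt v) _](_ : _ = tilt v x); last by [].
  by rewrite /A1 /A2 /A3 /edge_family !mul0r !addr0; congr (_ * _); exact: tilt_move.
Qed.

Lemma gr_add f g : gr (fun x => f x + g x) = (fun k => gr f k + gr g k).
Proof.
rewrite (_ : (fun x => f x + g x) = (fun x => 1 * f x + g x)); last by apply/funext => x; rewrite mul1r.
by rewrite gr_lin; apply/funext => k; rewrite mul1r.
Qed.

Variables (z : R[i]) (M : R).
Hypothesis M0 : 0 <= M.
Hypothesis adjoint : forall f, l2 f -> exists2 q, lap (q, fun x => f x + z^* * q x) & n2 q <= M * n2 f.

Let A := cmod (1 + z).
Let A0 : 0 <= A. Proof. exact: cmod_ge0. Qed.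
(** With [B = M A], the correction [q] in the test function satisfies
    [nQ q ^ 2 <= A B (1 + B) nQ u ^ 2], and [A B (1 + B)] is at most the square of
    [(1 + A)(1 + B)]. *)
Let D := 1 + (1 + A) * (1 + M * A).
Let D1 : 1 <= D. Proof. by rewrite lerDl mulr_ge0 ?addr_ge0 ?mulr_ge0. Qed.

(* [v = u + (L - conj z)^-1 ((1 + conj z) u)] turns [(Q - z)(u, v)] into [Q(u, u) + |u|^2]. *)
Lemma test_function u : FD u -> exists v, [/\ FD v, nQ v <= D * nQ u &
  inner (W 1) (gr u) (gr v) = (nQ u ^+ 2)%:C + (1 + z) * inner m u v].
Proof.
move=> uF; have R01 : 0 <= 1 :> R := ler01.
have u2 := FD_l2 m_gt0 uF; have w2 := l2Z m_ge0 (1 + z^*) u2.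
have [q Lq nq] := adjoint w2.
have Az : cmod (1 + z^*) = A.
  by rewrite -[1]conjc1 -[X in cmod X]rmorphD cmod_conj.
have [qF g2 hq] := (lapP G m_gt0 _ _).1 Lq.
have q2 := FD_l2 m_gt0 qF.
have gu := FD_gr m_gt0 R01 uF; have gq := FD_gr m_gt0 R01 qF.
have form w : FD w -> inner (W 1) (gr q) (gr w) = (1 + z^*) * (inner m u w + inner m q w).
  move=> wF; have w2' := FD_l2 m_gt0 wF; rewrite hq//.
  by rewrite (innerDl m_ge0 w2 (l2Z m_ge0 z^* q2) w2') (innerZl m_ge0 _ u2 w2') (innerZl m_ge0 _ q2 w2'); ring.
have qn : n2 q <= M * A * nQ u.
  rewrite (le_trans nq)// (n2Z m_ge0 _ u2) Az mulrA ler_wpM2l ?mulr_ge0//; exact: (n2_gr m_gt0).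
exists (fun x => u x + q x); split; first exact: (FD_eqD m_gt0).
  rewrite gr_add (le_trans (n2D W10 gu gq))// /D mulrDl mul1r lerD2l.
  have E := inner_n2 W10 gq; have := form _ qF; rewrite E => /(congr1 (@cmod R)).
  rewrite cmod_real ger0_norm ?sqr_ge0// cmodM Az => E2.
  have B0 : 0 <= (1 + A) * (1 + M * A) * nQ u by rewrite !mulr_ge0 ?addr_ge0 ?mulr_ge0 ?n2_ge0.
  rewrite -(ler_pXn2r (n := 2)) ?nnegrE ?n2_ge0// E2.
  have V0 := n2_ge0 (W 1) (gr u); have UV := n2_gr m_gt0 uF.
  have q0 := n2_ge0 m q.
  apply: (@le_trans _ _ (A * (nQ u * (M * A * nQ u) + (M * A * nQ u) ^+ 2))).
    rewrite ler_wpM2l// (le_trans (cmodD _ _))// lerD//.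
      by rewrite (le_trans (cmod_inner_n2 m_ge0 u2 q2))// ler_pM ?n2_ge0.
    by rewrite (inner_n2 m_ge0 q2) cmod_real ger0_norm ?sqr_ge0// ler_pXn2r ?nnegrE// (le_trans q0).
  have MA0 : 0 <= M * A by rewrite mulr_ge0.
  have -> : A * (nQ u * (M * A * nQ u) + (M * A * nQ u) ^+ 2) = A * (M * A) * (1 + M * A) * nQ u ^+ 2 by ring.
  rewrite exprMn ler_wpM2r ?sqr_ge0//; move: (M * A) MA0 => B BB0.
  apply: (@le_trans _ _ ((1 + A) * (1 + B) * (1 + B))).
    by rewrite ler_wpM2r ?addr_ge0// ler_pM// lerDr.
  by rewrite expr2 ler_wpM2l ?mulr_ge0 ?addr_ge0// ler_peMl ?addr_ge0// lerDl.
have uv2 : l2 (fun x => u x + q x) by exact: (l2D m_ge0).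
rewrite gr_add (innerDr W10 gu gq gu) (inner_n2 W10 gu).
by rewrite -(inner_conj W10 gq gu) form// (innerDr m_ge0 u2 q2 u2) conj_affine (inner_conj m_ge0 u2 u2) (inner_conj m_ge0 q2 u2).
Qed.

(** Testing the equation for [u0] with [tilt v] gives [nQ u ^ 2 = inner (delta y) v - P] for
    [u = tilt u0]; the source keeps weight 1 because [tau y = 0]. Since [|P| <= 3 kappa D nQ u ^ 2]
    is at most half of the left side, it is absorbed. *)
Lemma tilt_bound y u0 : tau y = 0 -> 6 * kappa * D <= 1 -> lap (u0, fun x => delta y x + z * u0 x) ->
  n2 (tilt u0) <= 2 * D * n2 (delta y).
Proof.
move=> ty kD L; have [uF _ hu] := (lapP G m_gt0 _ _).1 L.
have tF := tilt_FD uF; set u := tilt u0 in tF *.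
have [v [vF vn hv]] := test_function tF.
have tv := tilt_FD vF.
have d2 : l2 (delta y) by apply: (l2_Cc m_ge0); exact: delta_Cc.
have u2 := FD_l2 m_gt0 uF; have tv2 := FD_l2 m_gt0 tv; have v2 := FD_l2 m_gt0 vF.
have [P [hP Pn]] := tilt_form uF vF.
have swap : inner m u0 (tilt v) = inner m u v.
  by rewrite !innerE; apply: eq_csum => x; rewrite tilt_move.
have dy : inner m (delta y) (tilt v) = inner m (delta y) v.
  rewrite (inner_delta_l m_gt0 _ tv2) (inner_delta_l m_gt0 _ v2) /tilt ty mulr0 expR0 rmorph1.
  by rewrite mul1r.
have := hu _ tv; rewrite hP hv (innerDl m_ge0 d2 (l2Z m_ge0 z u2) tv2) (innerZl m_ge0 _ u2 tv2) swap dy => E.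
have {E} : (nQ u ^+ 2)%:C = inner m (delta y) v - P.
  apply: (addIr ((1 + z) * inner m u v + P)); rewrite addrA E; ring.
move=> /(congr1 (@cmod R)); rewrite cmod_real ger0_norm ?sqr_ge0// => E.
have le := cmodB (inner m (delta y) v) P; rewrite -E in le.
have k1 : kappa <= 1.
  have : kappa <= 6 * kappa * D by rewrite mulrAC ler_peMl// (le_trans D1)// ler_peMl ?ler1n// (le_trans ler01).
  by move/le_trans; apply.
have V0 := n2_ge0 (W 1) (gr u); have S0 := n2_ge0 m (delta y).
have vv := n2_gr m_gt0 vF.
have h1 : cmod (inner m (delta y) v) <= n2 (delta y) * (D * nQ u).
  rewrite (le_trans (cmod_inner_n2 m_ge0 d2 v2))// ler_wpM2l//; exact: le_trans vn.
have h2 : cmod P <= 3 * kappa * D * (nQ u * nQ u).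
  rewrite (le_trans Pn)//; apply: (@le_trans _ _ (3 * kappa * (nQ u * (D * nQ u)))); last by rewrite le_eqVlt; apply/orP; left; apply/eqP; ring.
  apply: ler_pM; rewrite ?mulr_ge0 ?n2_ge0 ?addr_ge0 ?sqr_ge0 ?mulr_ge0//.
    have : kappa ^+ 2 <= kappa by rewrite expr2 ler_piMl.
    lra.
  by rewrite ler_wpM2l.
have h3 : 3 * kappa * D * (nQ u * nQ u) <= 2^-1 * (nQ u * nQ u).
  by rewrite ler_wpM2r ?mulr_ge0//; lra.
have uV := n2_gr m_gt0 tF.
apply: (le_trans uV).
have [V1|V1] := ltP 0 (nQ u); last by rewrite (le_trans V1)// !mulr_ge0// (le_trans ler01).
rewrite -(ler_pM2r V1); move: le h1 h2 h3; rewrite expr2; move: (nQ u) (n2 (delta y)) => V S.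
move: (cmod _) (cmod P) => a c; rewrite -/D; lra.
Qed.

End Weight.

Lemma n2_delta y : n2 (delta y) ^+ 2 = m y.
Proof.
have d2 : l2 (delta y) by apply: (l2_Cc m_ge0); exact: delta_Cc.
have := inner_n2 m_ge0 d2; rewrite inner_delta /point_mass eqxx mul1r => /(congr1 (@complex.Re R)) /= ->.
by [].
Qed.

Lemma pt_n2 f x : l2 f -> cmod (f x) * n2 (delta x) <= n2 f.
Proof.
move=> f2; have d2 : l2 (delta x) by apply: (l2_Cc m_ge0); exact: delta_Cc.
have := cmod_inner_n2 m_ge0 f2 d2; rewrite inner_delta cmodM cmod_real ger0_norm//.
have S0 : 0 < n2 (delta x).
  rewrite lt0r n2_ge0 andbT; apply/eqP => E; have := n2_delta x; rewrite E expr0n => /esym/eqP.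
  by rewrite gt_eqF.
by rewrite -n2_delta expr2 mulrA ler_pM2r.
Qed.

Hypothesis d_refl : forall x, d x x = 0.
Hypothesis d_tri : forall x y w, d x w <= d x y + d y w.
Hypothesis s_ge0 : 0 <= s.

Lemma combes_thomas z M : 0 <= M ->
  (forall f, l2 f -> exists2 q, lap (q, fun x => f x + z^* * q x) & n2 q <= M * n2 f) ->
  exists2 eps, 0 < eps & exists2 C, 0 < C & forall u x y, lap (u, fun x => delta y x + z * u x) ->
    cmod (u x) * n2 (delta x) <= C * expR (- (eps * d x y)) * n2 (delta y).
Proof.
move=> M0 adj; pose D := 1 + (1 + cmod (1 + z)) * (1 + M * cmod (1 + z)).
have D1 : 1 <= D by rewrite lerDl mulr_ge0 ?addr_ge0 ?mulr_ge0 ?cmod_ge0.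
have D0 : 0 < D by rewrite (lt_le_trans ltr01).
have E1 : 1 <= expR s by rewrite -expR0 ler_expR.
have E0 : 0 < 6 * D * expR s by rewrite !mulr_gt0 ?expR_gt0.
(* Then [eps <= 1], so [kappa <= eps expR s] and [6 kappa D <= 1], as absorption requires. *)
pose eps := (6 * D * expR s)^-1; have e0 : 0 < eps by rewrite invr_gt0.
have e1 : eps <= 1.
  rewrite invf_le1//; have -> : 1 = 1 * 1 :> R by rewrite mulr1.
  by rewrite ler_pM//; lra.
exists eps => //; exists (2 * D); first by rewrite mulr_gt0.
(* The cutoff may depend on [x] because the bound does not involve it: [d x y] is the smallest
   cutoff for which the weight at [x] is [expR (eps d x y)]. *)
move=> u x y L; pose tau w := Num.min (d w y) (d x y).
have tN w : tau w <= d x y by rewrite ge_min lexx orbT.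
have tl a c : `|tau a - tau c| <= d a c.
  have ac := d_tri a c y; have ca := d_tri c a y; rewrite (d_sym c a) in ca.
  have dac := d_ge0 a c.
  by rewrite /tau ler_norml !minEle; case: ifP; case: ifP => h1 h2; lra.
have t0 : tau y = 0 by rewrite /tau d_refl; apply/min_idPl.
have kD : 6 * (eps * expR (eps * s)) * D <= 1.
  have -> : 6 * (eps * expR (eps * s)) * D = 6 * D * expR (eps * s) * eps by ring.
  rewrite -[leRHS](mulfV (lt0r_neq0 E0)) -/eps.
  rewrite ler_wpM2r ?(ltW e0)// ler_wpM2l ?mulr_ge0 ?(ltW D0)// ler_expR.
  by rewrite ler_piMl.
have := tilt_bound (ltW e0) tN tl M0 adj t0 kD L.
have u2 : l2 u by have [] := lap_l2 m_gt0 L.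
have tu2 : l2 (tilt eps tau u).
  apply: (FD_l2 m_gt0); apply: (tilt_FD (ltW e0) tN tl); by have [] := (lapP G m_gt0 _ _).1 L.
move=> le; have := le_trans (pt_n2 x tu2) le.
rewrite /tilt cmodM cmod_real gtr0_norm ?expR_gt0// /tau minxx.
by move=> h; rewrite expRN [2 * D * _ * _]mulrAC ler_pdivlMr ?expR_gt0// mulrC mulrA.
Qed.

End Tilt.

Lemma conj_shift (F : numClosedFieldType) (z a c : F) : (a^* + z * c)^* = a + z^* * c^*.
Proof. by rewrite rmorphD rmorphM /= conjCK. Qed.

Lemma conj_scale (F : numClosedFieldType) (z c : F) : (z^* * c)^* = z * c^*.
Proof. by rewrite rmorphM /= conjCK. Qed.

(** * Resolvents on l^2 *)

Section L2Resolvents.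
Variables (R : realType) (X : countType) (m : X -> R) (G : graph R X).
Hypothesis m_gt0 : forall x, 0 < m x.
Local Notation fn := (X -> R[i]).
Local Notation lap := (laplacian2 m G).
Local Notation n2 := (n2 m).
Local Notation l2 := (l2 m).
Local Notation delta := (point_mass R).
Implicit Types (f g h u v : fn) (x y : X) (M : R) (z : R[i]) (Rz : fn -> fn).

Let m_ge0 x : 0 <= m x. Proof. exact: ltW. Qed.
Let deltal2 y : l2 (delta y). Proof. by apply: (l2_Cc m_ge0); exact: delta_Cc. Qed.

(** [Rz] is merely a selection of solutions; its linearity and the symmetry of its kernel follow
    from uniqueness. *)
Record l2_resolvent z Rz M : Prop := L2Resolvent {
  lr_ge0 : 0 <= M ;
  lr_lap : forall f, l2 f -> lap (Rz f, fun x => f x + z * Rz f x) ;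
  lr_inj : forall q, lap (q, fun x => z * q x) -> q = (fun=> 0) ;
  lr_bdd : forall f, l2 f -> n2 (Rz f) <= M * n2 f }.

Lemma lr_uniq z Rz M f u : l2_resolvent z Rz M -> l2 f -> lap (u, fun x => f x + z * u x) -> u = Rz f.
Proof.
move=> H f2 L; have L2 := lap_B m_gt0 (-1) L (lr_lap H f2).
have E : (fun x => u x - Rz f x) = (fun=> 0).
  by apply: (lr_inj H); apply: lap_ext L2 => x; ring.
by apply/funext => x; have := congr1 (fun F => F x) E => /= /eqP; rewrite subr_eq0 => /eqP.
Qed.

Lemma lp_norm2_le f N : l2 f -> (lp_norm m 2%:E f <= N%:E)%E -> n2 f <= N.
Proof.
move=> f2 le; apply: (n2_le m_ge0); split=> //.
by rewrite -lee_fin; apply: le_trans le; rewrite lp_norm_ge0.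
Qed.

Lemma lp_norm2E f : l2 f -> lp_norm m 2%:E f = (n2 f)%:E.
Proof.
move=> f2; have [_ le] := nb_n2 m_ge0 f2; have [M0 h] := nb_lp_norm (nb_n2 m_ge0 f2).
have E : (fine (lp_norm m 2%:E f))%:E = lp_norm m 2%:E f.
  by rewrite fineK// ge0_fin_numE ?lp_norm_ge0// (le_lt_trans le)// ltry.
apply/eqP; rewrite eq_le le -E lee_fin; apply: (lp_norm2_le f2).
by rewrite E.
Qed.

Lemma resolvent_setP z : resolvent_set m 2%:E lap z <-> exists Rz M, l2_resolvent z Rz M.
Proof.
split=> [[h1 [M hM]]|[Rz [M H]]].
  have [Rz hR] : exists Rz, forall f, l2 f -> lap (Rz f, fun x => f x + z * Rz f x).
    have /choice[Rz hR] : forall f, exists u, l2 f -> lap (u, fun x => f x + z * u x).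
      move=> f; have [f2|nf2] := pselect (l2 f); last by exists f.
      by have [u [Lu _]] := h1 f ((l2_lp m f).2 f2); exists u.
    by exists Rz.
  exists Rz, (Num.max M 0); split=> //.
  - by rewrite le_max lexx orbT.
  - move=> q L; have [u [_ uu]] := h1 _ ((l2_lp m _).2 (l20 m_ge0)).
    rewrite -(uu q); last by apply: lap_ext L => x //; rewrite add0r.
    apply: uu; have := lap_B m_gt0 (-1) L L.
    by apply: lap_ext => x; rewrite ?mulr0 ?add0r mulN1r subrr.
  - move=> f f2; have L := hR f f2; have [u2 _] := lap_l2 m_gt0 L.
    have := hM _ _ L; rewrite (_ : (fun x => _ - _) = f); last by apply/funext => x; rewrite addrK.
    rewrite !lp_norm2E// -EFinM lee_fin => le; apply: le_trans le _.
    by rewrite ler_wpM2r ?n2_ge0// le_max lexx.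
split=> [h /l2_lp h2|].
  exists (Rz h); split; first exact: (lr_lap H).
  by move=> u Lu; rewrite (lr_uniq H h2 Lu).
exists M => f g L; have [f2 g2] := lap_l2 m_gt0 L.
have h2 := l2B m_ge0 g2 (l2Z m_ge0 z f2).
rewrite !lp_norm2E// -EFinM lee_fin.
have E : f = Rz (fun x => g x - z * f x).
  by apply: (lr_uniq H h2); apply: lap_ext L => x //; rewrite subrK.
by rewrite {1}E; exact: (lr_bdd H).
Qed.

(** [L] commutes with conjugation, so conjugating inputs and outputs gives the resolvent at the
    conjugate point with the same bound. It supplies the adjoint problem of the test function and
    the adjoint factor in the symmetrization argument. *)
Lemma l2_resolvent_conj z Rz M : l2_resolvent z Rz M ->
  l2_resolvent z^* (fun f x => (Rz (fun y => (f y)^*) x)^*) M.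
Proof.
move=> H; split; first exact: (lr_ge0 H).
- move=> f f2; have := lap_conj m_gt0 (lr_lap H (l2_conj m_ge0 f2)).
  apply: lap_ext => x //; exact: conj_shift.
- move=> q L; have E : (fun x => (q x)^*) = (fun=> 0).
    apply: (lr_inj H); apply: lap_ext (lap_conj m_gt0 L) => x //; exact: conj_scale.
  apply/funext => x; have := congr1 (fun F => F x) E => /= /eqP.
  by rewrite conjc_eq0 => /eqP.
- move=> f f2; have c2 := l2_conj m_ge0 f2.
  have R2 : l2 (Rz (fun y => (f y)^*)) by have [] := lap_l2 m_gt0 (lr_lap H c2).
  have nc g : l2 g -> n2 (fun x => (g x)^*) <= n2 g.
    by move=> g2; apply: (n2_le m_ge0); apply: (conj_nb m_ge0 (le12 R)); exact: nb_n2.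
  rewrite (le_trans (nc _ R2))// (le_trans (lr_bdd H c2))// ler_wpM2l ?(lr_ge0 H)//; exact: nc.
Qed.

(** For kernel symmetry, [lap_sym] is applied to [Rz (delta x)] and the conjugated resolvent at
    [delta y]; the two terms containing [z] cancel. *)
Lemma l2_resolvent_operator z Rz M : l2_resolvent z Rz M -> l2_operator m Rz M.
Proof.
move=> H; have Rl2 f : l2 f -> l2 (Rz f) by move=> f2; have [] := lap_l2 m_gt0 (lr_lap H f2).
split=> //.
- exact: (lr_ge0 H).
- move=> a f g f2 g2; apply/esym; apply: (lr_uniq H); first by apply: (l2D m_ge0) => //; exact: l2Z.
  apply: lap_ext (lap_lin m_gt0 a (lr_lap H f2) (lr_lap H g2)) => x //; ring.
- exact: (lr_bdd H).
- move=> x y; have H' := l2_resolvent_conj H.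
  have := lap_sym m_gt0 (lr_lap H (deltal2 x)) (lr_lap H' (deltal2 y)).
  have y2 := deltal2 y; have x2 := deltal2 x.
  set v := (fun x0 => _^*); have v2 : l2 v by apply: (l2_conj m_ge0); apply: Rl2; exact: l2_conj.
  have u2 := Rl2 _ x2.
  rewrite (innerDl m_ge0 x2 (l2Z m_ge0 z u2) v2) (innerZl m_ge0 _ u2 v2).
  rewrite (innerDr m_ge0 y2 (l2Z m_ge0 z^* v2) u2) (innerZr m_ge0 _ v2 u2) conjCK => /addIr.
  rewrite (inner_delta_l m_gt0 _ v2) inner_delta => <-.
  by rewrite /v conjCK delta_conj.
Qed.

End L2Resolvents.

(** * Exponential sums under volume growth *)

Section Growth.
Variables (R : realType) (X : countType) (m : X -> R) (d : X -> X -> R).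
Hypothesis m_gt0 : forall x, 0 < m x.
Hypothesis d_ge0 : forall x y, 0 <= d x y.

Lemma vol_sum (A : set X) V (s : seq X) : (vol m A <= V%:E)%E -> uniq s ->
  (forall y, y \in s -> A y) -> \sum_(y <- s) m y <= V.
Proof.
move=> AV us sA; pose F y := if y \in A then m y else 0.
have F0 y : 0 <= F y by rewrite /F; case: ifP => // _; exact: ltW.
have : sbd F V.
  apply/(sbdP _ F0); apply: le_trans AV; rewrite /vol [leRHS]esum_mkcond le_eqVlt; apply/orP; left; apply/eqP.
  by apply: eq_esum => y _; rewrite /F; case: ifP.
move=> /(_ _ us); congr (_ <= _); apply: eq_big_seq => y ys.
by rewrite /F mem_set//; exact: sA.
Qed.

Lemma geometric_le (q : R) n : 0 < q -> q < 1 -> \sum_(i < n) q ^+ i <= (1 - q)^-1.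
Proof.
move=> q0 q1; have := subrX1 q n => E.
have p0 : 0 < 1 - q by rewrite subr_gt0.
have h : (1 - q) * \sum_(i < n) q ^+ i = 1 - q ^+ n by rewrite -opprB mulNr -E opprB.
by rewrite -[leRHS]mul1r ler_pdivlMr// mulrC h lerBlDr lerDl exprn_ge0// ltW.
Qed.

Lemma shell_sum (beta dl C1 : R) : 0 < C1 -> dl < beta -> 0 <= beta ->
  (forall x r, 0 <= r -> (vol m (dball d x r) <= (C1 * expR (dl * r) * m x)%:E)%E) ->
  exists2 C, 0 < C & forall x, sbd (fun y => expR (- (beta * d x y)) * m y) (C * m x).
Proof.
move=> C10 db be0 gr; pose q := expR (- (beta - dl)).
have q0 : 0 < q := expR_gt0 _.
have q1 : q < 1 by rewrite /q expR_lt1 oppr_lt0 subr_gt0.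
(* The points of the unit shell [n <= d < n + 1] lie in the ball of radius [n + 1]; the extra unit
   costs [expR dl], and the shells form a geometric series with ratio [q]. *)
exists (C1 * expR dl * (1 - q)^-1).
  by rewrite !mulr_gt0 ?expR_gt0// invr_gt0 subr_gt0.
move=> x s us; pose N := (\max_(y <- s) (Num.truncn (d x y))).+1.
have dN y : y \in s -> (Num.truncn (d x y) < N)%N.
  by move=> ys; rewrite ltnS; exact: (@leq_bigmax_seq _ s xpredT (fun y => Num.truncn (d x y)) y ys isT).
have pt y : y \in s -> expR (- (beta * d x y)) * m y <=
    \sum_(n < N) expR (- (beta * n%:R)) * ((d x y <= n.+1%:R)%R%:R * m y).
  move=> ys; rewrite (bigD1 (Ordinal (dN y ys)))//= -[leLHS]addr0 lerD//; last first.
    by apply: sumr_ge0 => n _; rewrite mulr_ge0 ?expR_ge0// mulr_ge0// ltW.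
  have [h1 h2] := andP (truncn_itv (d_ge0 x y)).
  by rewrite (ltW h2) mul1r ler_wpM2r ?(ltW (m_gt0 y))// ler_expR lerN2 ler_wpM2l.
apply: (@le_trans _ _ (\sum_(y <- s) \sum_(n < N) expR (- (beta * n%:R)) * ((d x y <= n.+1%:R)%R%:R * m y))).
  by rewrite big_seq [leRHS]big_seq; apply: ler_sum => y; exact: pt.
rewrite exchange_big /=.
apply: (@le_trans _ _ (\sum_(n < N) C1 * expR dl * m x * q ^+ n)).
  apply: ler_sum => n _; rewrite -mulr_sumr.
  have -> : \sum_(y <- s) (d x y <= n.+1%:R)%R%:R * m y = \sum_(y <- [seq y <- s | d x y <= n.+1%:R]) m y.
    by rewrite big_filter [RHS]big_mkcond; apply: eq_bigr => y _; case: ifP; rewrite ?mul1r ?mul0r.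
  have := vol_sum (gr x n.+1%:R (ler0n _ _)) (filter_uniq (fun y => d x y <= n.+1%:R) us).
  move=> /(_ (fun y => _)) h.
  apply: (@le_trans _ _ (expR (- (beta * n%:R)) * (C1 * expR (dl * n.+1%:R) * m x))).
    rewrite ler_wpM2l ?expR_ge0//; apply: h => y; rewrite mem_filter => /andP[//].
  have -> : q ^+ n = expR (- (beta * n%:R)) * expR (dl * n%:R).
    by rewrite /q -expRM_natl -expRD; congr expR; ring.
  rewrite -natr1 mulrDr mulr1 expRD le_eqVlt; apply/orP; left; apply/eqP; ring.
rewrite -mulr_sumr [leRHS]mulrAC ler_wpM2l ?geometric_le//.
by rewrite !mulr_ge0 ?expR_ge0 ?(ltW C10) ?(ltW (m_gt0 x)).
Qed.

End Growth.

(** * Comparison of the spectra *)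

Section ResolventSets.
Variables (R : realType) (X : countType) (m : X -> R) (G : graph R X).
Hypothesis m_gt0 : forall x, 0 < m x.
Local Notation fn := (X -> R[i]).
Local Notation lap := (laplacian2 m G).
Local Notation n2 := (n2 m).
Local Notation l2 := (l2 m).
Local Notation delta := (point_mass R).
Local Notation K k := (kop m k).
Implicit Types (f g h u v phi : fn) (x y : X) (M : R) (z lam : R[i]) (Rz : fn -> fn).

Let m_ge0 x : 0 <= m x. Proof. exact: ltW. Qed.

Lemma lp_norm_bound (p : \bar R) f h C : (1 <= p)%E -> 0 < C -> lp m p h ->
  (forall N, nb m p h N -> nb m p f (C * N)) -> (lp_norm m p f <= C%:E * lp_norm m p h)%E.
Proof.
move=> p1 C0 hl H; case: p p1 hl H => [r _ hl H|_ hl H|//].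
  have [N hN] := (lpP m r%:E h).1 hl; have hN' := nb_lp_norm hN.
  have [_] := H _ hN'; rewrite EFinM fineK//.
  rewrite ge0_fin_numE ?lp_norm_ge0//.
have [N hN] := (lpP m +oo%E h).1 hl.
apply: ge_ereal_sup => _ [x ->].
have le0 : (0 <= lp_norm m +oo h)%E.
  by apply: le_trans (ereal_sup_ubound _); last (by exists x); rewrite lee_fin cmod_ge0.
have fin : lp_norm m +oo h \is a fin_num.
  by rewrite ge0_fin_numE//; have [_ le] := hN; rewrite (le_lt_trans le)// ltry.
have /H : nb m +oo%E h (fine (lp_norm m +oo h)) by split; [exact: fine_ge0|rewrite fineK].
by move=> /nb_oo[_ /(_ x)]; rewrite -lee_fin EFinM fineK.
Qed.

Lemma resolvent_kernel_lp (p : \bar R) z k C : (1 <= p)%E -> resolvent_kernel m G z k C ->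
  resolvent_set m p (laplacian m G p) z.
Proof.
move=> p1 kC; have sk := rk_schur kC; split=> [h /lpP[N hN]|].
  have KN := nb_kop m_gt0 p1 sk hN.
  have E u : (fun x => h x + z * u x - z * u x) = h by apply/funext => x; rewrite addrK.
  exists (K k h); split=> [|u /(laplacianP m_gt0 _ _ p1 kC)[_ _]]; last by rewrite E.
  apply/(laplacianP m_gt0 _ _ p1 kC); split; [by exists (C * N)| |by rewrite E].
  by exists (N + cmod z * (C * N)); apply: (nbD m_ge0 p1) => //; exact: (nbZ m_ge0 p1).
exists C => f g /(laplacianP m_gt0 _ _ p1 kC)[[M fM] [N gN] E].
have h := nbB m_ge0 p1 gN (nbZ m_ge0 p1 z fM).
apply: (lp_norm_bound p1 (schur_gt0 sk)); first by apply/lpP; exists (N + cmod z * M).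
by move=> L; rewrite {2}E; exact: (nb_kop m_gt0 p1 sk).
Qed.

Lemma lr_adj z Rz Rz' M M' f g : l2_resolvent m G z Rz M -> l2_resolvent m G z^* Rz' M' ->
  l2 f -> l2 g -> inner m (Rz f) g = inner m f (Rz' g).
Proof.
move=> H H' f2 g2; have := lap_sym m_gt0 (lr_lap H f2) (lr_lap H' g2).
have [u2 _] := lap_l2 m_gt0 (lr_lap H f2); have [v2 _] := lap_l2 m_gt0 (lr_lap H' g2).
rewrite (innerDl m_ge0 f2 (l2Z m_ge0 z u2) v2) (innerZl m_ge0 _ u2 v2).
by rewrite (innerDr m_ge0 g2 (l2Z m_ge0 z^* v2) u2) (innerZr m_ge0 _ v2 u2) conjCK => /addIr.
Qed.

(* This is the selfadjointness of [L], obtained from the symmetry of [(1 + L)^-1]. *)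
Lemma orth_range lam q : l2 q ->
  (forall f g, lap (f, g) -> inner m q (fun x => g x - lam * f x) = 0) -> lap (q, fun x => lam^* * q x).
Proof.
move=> q2 h; have Jq2 := J_l2 G m_gt0 ltr01 q2.
have E phi : l2 phi -> inner m (fun x => q x - (1 + lam^*) * J m G 1 q x) phi = 0.
  move=> p2; have Jp2 := J_l2 G m_gt0 ltr01 p2.
  have := h _ _ (JP G m_gt0 ltr01 p2).
  rewrite (_ : (fun x => _ - lam * _) = (fun x => phi x - (1 + lam) * J m G 1 phi x)); last first.
    by apply/funext => x; rewrite invr1 rmorph1; ring.
  rewrite (innerBr m_ge0 p2 (l2Z m_ge0 (1 + lam) Jp2) q2) (innerZr m_ge0 _ Jp2 q2).
  rewrite (innerBl m_ge0 q2 (l2Z m_ge0 (1 + lam^*) Jq2) p2) (innerZl m_ge0 _ Jq2 p2).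
  by rewrite (J_sym G m_gt0 ltr01 q2 p2) rmorphD rmorph1.
have d2 := l2B m_ge0 q2 (l2Z m_ge0 (1 + lam^*) Jq2).
have d0 : (fun x => q x - (1 + lam^*) * J m G 1 q x) = (fun=> 0).
  apply: (n2_eq0 m_gt0 d2); have := inner_n2 m_ge0 d2; rewrite E// => /(congr1 (@complex.Re R)) /= /esym/eqP.
  by rewrite sqrf_eq0 => /eqP ->.
have qE x : q x = (1 + lam^*) * J m G 1 q x.
  by have := congr1 (fun F => F x) d0 => /= /eqP; rewrite subr_eq0 => /eqP.
have L := lap_B m_gt0 lam^* (JP G m_gt0 ltr01 q2) (JP G m_gt0 ltr01 q2).
apply: lap_ext L => x; rewrite [in RHS]qE ?invr1 ?rmorph1; first by ring.
by rewrite [q x in LHS]qE; ring.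
Qed.

(** The part of [h] orthogonal to the closure of the range of [L - lam] is an eigenfunction for the
    conjugate of [lam], and the second bound makes it zero: the range is dense. By the first bound,
    preimages of an approximating sequence are Cauchy, and closedness of [L] gives a solution. *)
Lemma resolvent_of_bound lam c : 0 <= c ->
  (forall f g, lap (f, g) -> n2 f <= c * n2 (fun x => g x - lam * f x)) ->
  (forall f g, lap (f, g) -> n2 f <= c * n2 (fun x => g x - lam^* * f x)) ->
  resolvent_set m 2%:E lap lam.
Proof.
move=> c0 b1 b2; apply: (resolvent_setP G m_gt0 lam).2.
have l2s f g : lap (f, g) -> l2 (fun x => g x - lam * f x).
  by move=> L; have [f2 g2] := lap_l2 m_gt0 L; exact: (l2B m_ge0 g2 (l2Z m_ge0 lam f2)).
pose S : set fn := [set s | exists f g, lap (f, g) /\ s = (fun x => g x - lam * f x)].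
have key h : l2 h -> exists f, lap (f, fun x => h x + lam * f x).
  move=> h2.
  have Z0 : lap (fun=> 0, fun=> 0).
    have L := JP G m_gt0 ltr01 h2; have := lap_B m_gt0 (-1) L L.
    by apply: lap_ext => x; rewrite mulN1r subrr.
  have S0 : S (fun=> 0).
    by exists (fun=> 0), (fun=> 0); split=> //; apply/funext => x; rewrite mulr0 subrr.
  have SL (a : R[i]) (f g : fn) : S f -> S g -> S (fun x => a * f x + g x).
    move=> [f1 [g1 [L1 ->]]] [f2 [g2 [L2 ->]]].
    exists (fun x => a * f1 x + f2 x), (fun x => a * g1 x + g2 x); split; first exact: lap_lin.
    by apply/funext => x; ring.
  have S2 f : S f -> l2 (id f) by move=> [f1 [g1 [L1 ->]]]; exact: l2s.
  have [w [w2 wa worth]] := projection m_ge0 (Phi := id) (P := id) (fun _ _ _ => erefl)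
    (fun x => nb_pt m_ge0 (le12 R) (m_gt0 x)) (fun _ _ uf => uf) S0 SL S2 h2 (fun f Sf => conj Sf (lexx _)).
  have q2 := l2B m_ge0 h2 w2.
  have q0 : (fun x => h x - w x) = (fun=> 0).
    have L : lap (fun x => h x - w x, fun x => lam^* * (h x - w x)).
      by apply: orth_range => // f g L; apply: worth; exists f, g.
    have := b2 _ _ L; rewrite (_ : (fun x => _ - _ * _) = (fun=> 0)); last by apply/funext => x; rewrite subrr.
    by rewrite (n20 m_ge0) mulr0; exact: n2_eq0.
  have wh : w = h.
    by apply/funext => x; have := congr1 (fun F => F x) q0 => /= /eqP; rewrite subr_eq0 => /eqP.
  have /choice[fg hfg] : forall n : nat, exists fg : fn * fn, lap fg /\
      nb m 2%:E (fun x => h x - (fg.2 x - lam * fg.1 x)) (n.+1%:R^-1).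
    move=> n; have n0 : 0 < (n.+1%:R^-1 : R) by rewrite invr_gt0 ltr0n.
    have [s [f [g [L ->]]] hs] := wa _ n0; exists (f, g); split=> //.
    by rewrite -wh.
  pose u n := (fg n).1; pose v n := (fg n).2; pose s n := fun x => v n x - lam * u n x.
  have L n : lap (u n, v n) by have [] := hfg n; rewrite /u /v; case: (fg n).
  have u2 n : l2 (u n) by have [] := lap_l2 m_gt0 (L n).
  have hs n : nb m 2%:E (fun x => h x - s n x) (n.+1%:R^-1) by have [] := hfg n.
  have ninv n k : (n <= k)%N -> (k.+1%:R^-1 : R) <= n.+1%:R^-1.
    by move=> nk; rewrite lef_pV2 ?posrE ?ltr0n// ler_nat ltnS.
  have cau e : 0 < e -> exists n0, forall n k, (n0 <= n)%N -> (n0 <= k)%N ->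
     nb m 2%:E (id (fun x => u n x - u k x)) e.
    move=> e0; have c1 : 0 < c + c + 1 by rewrite ltr_wpDl ?addr_ge0.
    have [n0 hn0] := archi_inv (divr_gt0 e0 c1); exists n0 => n k nn kk.
    have d2 := l2B m_ge0 (u2 n) (u2 k); apply: (nb_n2P m_ge0) => //.
    have LD := lap_B m_gt0 (-1) (L n) (L k).
    have := b1 _ _ LD; rewrite (_ : (fun x => u n x + -1 * u k x) = (fun x => u n x - u k x)); last first.
      by apply/funext => x; rewrite mulN1r.
    rewrite (_ : (fun x => _ - lam * _) = (fun x => (h x - s k x) - (h x - s n x))); last first.
      by apply/funext => x; rewrite /s; ring.
    have /(n2_le m_ge0) le := nbB m_ge0 (le12 R) (hs k) (hs n).
    have le1 := ninv _ _ nn; have le2 := ninv _ _ kk.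
    move=> /le_trans; apply; apply: (@le_trans _ _ (c * (n0.+1%:R^-1 + n0.+1%:R^-1))).
      by rewrite ler_wpM2l// (le_trans le)// lerD.
    move: hn0; rewrite ler_pdivlMr// => hn0; apply: le_trans hn0.
    have : 0 <= (n0.+1%:R^-1 : R) by rewrite invr_ge0.
    by move: (n0.+1%:R^-1) => q q0'; lra.
  have [f [_ f2 fu]] := Phi_complete m_ge0 (Phi := id) (fun _ _ _ => erefl)
    (fun x => nb_pt m_ge0 (le12 R) (m_gt0 x)) (fun _ _ uf => uf) u2 cau.
  (* [phi] is what [(1 + L) f] must be; identifying [f] with [(1 + L)^-1 phi] by continuity shows
     that the limit lies in the domain. *)
  exists f; pose phi := fun x => f x + (h x + lam * f x).
  have phi2 : l2 phi by apply: (l2D m_ge0) => //; apply: (l2D m_ge0) => //; exact: (l2Z m_ge0).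
  have fJ : f = J m G 1 phi.
    apply: (l2_eq m_gt0) => //; first exact: (J_l2 G m_gt0).
    move=> e e0; have c1 : 0 < cmod (1 + lam) + 2 by rewrite ltr_wpDl ?cmod_ge0.
    have ec := divr_gt0 e0 c1.
    have [n0 hn0] := archi_inv ec; have [n1 hn1] := fu _ ec.
    pose n := maxn n0 n1; have := hn1 n (leq_maxr _ _) => /= fun_.
    have sn := nb_le m_ge0 (le12 R) (le_trans (ninv _ _ (leq_maxl n0 n1)) hn0) (hs n).
    have [_ v2] := lap_l2 m_gt0 (L n); have un2 := u2 n.
    have uv2 := l2D m_ge0 un2 v2.
    have Ju : J m G 1 (fun x => u n x + v n x) = u n.
      by apply: (J_eq m_gt0 ltr01 uv2 (L n)) => x; rewrite rmorph1 mul1r.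
    have d1 := l2B m_ge0 f2 un2; have d2 := l2B m_ge0 uv2 phi2.
    have EJ : (fun x => f x - J m G 1 phi x) = (fun x => (f x - u n x) + J m G 1 (fun x => (u n x + v n x) - phi x) x).
      have := J_lin G m_gt0 (-1) ltr01 phi2 uv2; rewrite Ju.
      rewrite (_ : (fun x => -1 * phi x + _) = (fun x => u n x + v n x - phi x)); last by apply/funext => x; ring.
      by move=> ->; apply/funext => x; ring.
    rewrite EJ (le_trans (n2D m_ge0 d1 (J_l2 G m_gt0 ltr01 d2)))//.
    have le1 := n2_le m_ge0 fun_.
    have le2 : n2 (fun x => u n x + v n x - phi x) <= cmod (1 + lam) * (e / (cmod (1 + lam) + 2)) + e / (cmod (1 + lam) + 2).
      apply: (n2_le m_ge0); have := nbD m_ge0 (le12 R) (nbZ m_ge0 (le12 R) (- (1 + lam)) fun_) (nbN m_ge0 (le12 R) sn).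
      rewrite cmodN (_ : (fun x => _ + _) = (fun x => u n x + v n x - phi x))//.
      by apply/funext => x; rewrite /phi /s; ring.
    have le3 := le_trans (J_contr G m_gt0 ltr01 d2) le2.
    apply: (le_trans (lerD le1 le3)); rewrite le_eqVlt; apply/orP; left; apply/eqP.
    by field; rewrite gt_eqF.
  have := JP G m_gt0 ltr01 phi2; rewrite -fJ; apply: lap_ext => x //.
  by rewrite invr1 rmorph1 mul1r /phi addrAC subrr add0r.
have /choice[Rz hR] : forall h, exists f, l2 h -> lap (f, fun x => h x + lam * f x).
  move=> h; have [h2|nh2] := pselect (l2 h); last by exists h.
  by have [f hf] := key h h2; exists f.
exists Rz, c; split=> //.
- move=> q L; have [q2 _] := lap_l2 m_gt0 L; apply: (n2_eq0 m_gt0 q2).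
  have := b1 _ _ L; rewrite (_ : (fun x => _ - _) = (fun=> 0)); last by apply/funext => x; rewrite subrr.
  by rewrite (n20 m_ge0) mulr0.
- move=> f f2; have := b1 _ _ (hR f f2).
  by rewrite (_ : (fun x => _ - _) = f)//; apply/funext => x; rewrite addrK.
Qed.

(** Since [inner (L f) f] is real, the imaginary part of [inner ((L - w) f) f] is [- Im w |f|^2],
    and Cauchy-Schwarz gives the lower bound for both [z] and its conjugate. *)
Lemma nonreal_resolvent z : complex.Im z != 0 -> resolvent_set m 2%:E lap z.
Proof.
move=> z0; have i0 : 0 < `|complex.Im z| by rewrite normr_gt0.
have bound w f g : `|complex.Im w| = `|complex.Im z| -> lap (f, g) ->
    n2 f <= `|complex.Im z|^-1 * n2 (fun x => g x - w * f x).
  move=> wz L; have [f2 g2] := lap_l2 m_gt0 L.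
  have d2 := l2B m_ge0 g2 (l2Z m_ge0 w f2).
  rewrite ler_pdivlMl//.
  have := innerBl m_ge0 g2 (l2Z m_ge0 w f2) f2.
  rewrite (innerZl m_ge0 _ f2 f2) (lap_pos m_gt0 L) (inner_n2 m_ge0 f2) => E.
  have : `|complex.Im z| * n2 f ^+ 2 <= n2 (fun x => g x - w * f x) * n2 f.
    apply: le_trans (cmod_inner_n2 m_ge0 d2 f2); apply: le_trans (Im_le_cmod _).
    rewrite E; case: w wz E {d2} => a b /= wz _.
    by rewrite sub0r mulr0 add0r normrN normrM wz (ger0_norm (sqr_ge0 _)).
  have [n0|n0] := ltP 0 (n2 f); first by rewrite expr2 mulrA ler_pM2r.
  have -> : n2 f = 0 by apply/eqP; rewrite eq_le n0 n2_ge0.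
  by move=> _; rewrite mulr0 n2_ge0.
have zc : `|complex.Im z^*| = `|complex.Im z| by case: (z) => a b /=; rewrite normrN.
apply: (resolvent_of_bound (c := `|complex.Im z|^-1)); first by rewrite invr_ge0.
- by move=> f g; exact: bound.
- by move=> f g; exact: bound.
Qed.

End ResolventSets.

(** * Norms of symmetric operators from the growth of their iterates *)

Section Lax.
Variables (R : realType) (X : countType) (m : X -> R).
Hypothesis m_gt0 : forall x, 0 < m x.
Local Notation fn := (X -> R[i]).
Local Notation n2 := (n2 m).
Local Notation l2 := (l2 m).
Let m_ge0 x : 0 <= m x. Proof. exact: ltW. Qed.

Lemma bounded_powers (q D : R) : 0 <= q -> (forall j, q ^+ j <= D) -> q <= 1.
Proof.
move=> q0 h; rewrite leNgt; apply/negP => q1.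
have D0 : 0 < D + 1 by have := h 0; rewrite expr0; lra.
have bern j : 1 + j%:R * (q - 1) <= q ^+ j.
  elim: j => [|j IH]; first by rewrite mul0r addr0 expr0.
  rewrite exprS -natr1; apply: (@le_trans _ _ (q * (1 + j%:R * (q - 1)))); last by rewrite ler_wpM2l.
  have := mulr_ge0 (ler0n R j) (sqr_ge0 (q - 1)); lra.
have q10 : 0 < q - 1 by rewrite subr_gt0.
have [n hn] := archi_inv (divr_gt0 q10 D0).
have n0 : 0 < n.+1%:R :> R by rewrite ltr0n.
have : D + 1 <= n.+1%:R * (q - 1).
  by move: hn; rewrite ler_pdivlMr// mulrC ler_pdivrMr// [leRHS]mulrC.
by have := bern n.+1; have := h n.+1; lra.
Qed.

(* [j |-> log |N^j phi|] is convex, so its initial slope is at most its asymptotic growth rate. *)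
Lemma lax (N : fn -> fn) (phi : fn) (B t : R) : 0 < t -> l2 phi ->
  (forall f, l2 f -> l2 (N f)) ->
  (forall f g, l2 f -> l2 g -> inner m (N f) g = inner m f (N g)) ->
  (forall j, cmod (inner m (iter j N phi) phi) <= B * t ^+ j) -> n2 (N phi) <= t * n2 phi.
Proof.
move=> t0 p2 N2 Nsym hB; pose b j := n2 (iter j N phi).
have i2 j : l2 (iter j N phi) by elim: j => //= j IH; exact: N2.
have b0 j : 0 <= b j by exact: n2_ge0.
have conv j : b j.+1 ^+ 2 <= b j * b j.+2.
  have := inner_n2 m_ge0 (i2 j.+1); rewrite {1}iterS Nsym// => /(congr1 (@cmod R)).
  rewrite cmod_real ger0_norm ?sqr_ge0// => E.
  rewrite /b -E; exact: (cmod_inner_n2 m_ge0 (i2 j) (i2 j.+2)).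
have isym j f g : l2 f -> l2 g -> inner m (iter j N f) g = inner m f (iter j N g).
  elim: j f g => //= j IH f g f2 g2; have j2 h : l2 h -> l2 (iter j N h) by move=> h2; elim: (j) => //= k; exact: N2.
  by rewrite (Nsym _ _ (j2 _ f2) g2) (IH _ _ f2 (N2 _ g2)) -iterSr.
(* By symmetry [b j ^ 2] is the pairing of the iterate of order [2 j] with [phi], so only pairings
   with the fixed [phi] have to be controlled. *)
have up j : b j ^+ 2 <= B * (t ^+ 2) ^+ j.
  have := inner_n2 m_ge0 (i2 j); rewrite -(isym j (iter j N phi) phi (i2 j) p2).
  rewrite -iterD => /(congr1 (@cmod R)); rewrite cmod_real ger0_norm ?sqr_ge0// => E.
  by rewrite /b -E (le_trans (hB _))// addnn -mul2n exprM.
have mono j : b 1 * b j <= b 0 * b j.+1.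
  elim: j => [|j IH]; first by rewrite mulrC.
  have := b0 j; rewrite le_eqVlt => /orP[/eqP bj|bj].
    have := conv j; rewrite -bj mul0r => le.
    have -> : b j.+1 = 0 by apply/eqP; rewrite -sqrf_eq0 eq_le le sqr_ge0.
    by rewrite mulr0 mulr_ge0.
  rewrite -(ler_pM2r bj); have := ler_wpM2l (b0 0%N) (conv j); have := ler_wpM2r (b0 j.+1) IH.
  by rewrite expr2; lra.
have low j : b 1 ^+ j * b 0 <= b 0 ^+ j * b j.
  elim: j => [|j IH]; first by rewrite !expr0.
  rewrite exprS -mulrA (le_trans (ler_wpM2l (b0 1%N) IH))// mulrCA exprSr -mulrA.
  by rewrite ler_wpM2l ?exprn_ge0.
rewrite -[N phi]/(iter 1 N phi) -/(b 1) -[phi in leRHS]/(iter 0 N phi) -/(b 0).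
have := b0 0%N; rewrite le_eqVlt => /orP[/eqP b00|b00].
  have := conv 0%N; rewrite -b00 mul0r mulr0 => le.
  by rewrite le_eqVlt -sqrf_eq0 eq_le le sqr_ge0.
have tb : 0 < t * b 0 by rewrite mulr_gt0.
rewrite -[leRHS]mul1r -ler_pdivrMr//.
rewrite -(ler_pXn2r (n := 2)) ?nnegrE ?divr_ge0 ?(ltW tb)// expr1n.
(* Squaring [low] and inserting [up] bounds all powers of the squared ratio [b 1 / (t b 0)] by
   [B / b 0 ^ 2]; a number with bounded powers is at most 1. *)
apply: (bounded_powers (D := B / b 0 ^+ 2)); first exact: sqr_ge0.
move=> j.
have -> : (b 1 / (t * b 0)) ^+ 2 ^+ j = b 1 ^+ 2 ^+ j / (t ^+ 2 ^+ j * b 0 ^+ 2 ^+ j).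
  by rewrite !expr_div_n -[in RHS]exprMn -[in RHS]exprMn.
rewrite ler_pdivlMr ?exprn_gt0// mulrAC ler_pdivrMr ?mulr_gt0 ?exprn_gt0//.
have le : (b 1 ^+ j * b 0) ^+ 2 <= (b 0 ^+ j * b j) ^+ 2.
  by rewrite ler_pXn2r ?nnegrE ?mulr_ge0 ?exprn_ge0.
rewrite 2![(_ * _) ^+ 2]exprMn (exprAC (b 1) j 2) (exprAC (b 0) j 2) in le.
apply: (le_trans le); rewrite [leLHS]mulrC [leRHS]mulrA ler_wpM2r//.
by rewrite exprn_ge0// sqr_ge0.
Qed.

End Lax.

Section Spectra.
Variables (R : realType) (X : countType) (m : X -> R) (G : graph R X) (d : X -> X -> R).
Hypothesis m_gt0 : forall x, 0 < m x.
Hypothesis d_intrinsic : intrinsic_metric m G d.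
Hypothesis d_jump : (jump_size G d < +oo)%E.
Hypothesis growth : uniform_subexponential_growth m d.
Local Notation fn := (X -> R[i]).
Local Notation lap := (laplacian2 m G).
Local Notation n2 := (n2 m).
Local Notation l2 := (l2 m).
Local Notation delta := (point_mass R).
Implicit Types (f g h u v phi : fn) (x y : X) (M : R) (z lam : R[i]) (Rz : fn -> fn).

Let m_ge0 x : 0 <= m x. Proof. exact: ltW. Qed.
Let deltal2 y : l2 (delta y). Proof. by apply: (l2_Cc m_ge0); exact: delta_Cc. Qed.

Lemma jump_bound : exists2 s, 0 <= s & forall x y, 0 < edge_weight G x y -> d x y <= s.
Proof.
have ub x y : 0 < edge_weight G x y -> ((d x y)%:E <= jump_size G d)%E.
  by move=> bp; apply: ereal_sup_ubound; exists x, y.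
move: d_jump ub; case: (jump_size G d) => [s _ ub|//|_ ub].
  exists (Num.max s 0) => [|x y bp]; first by rewrite le_max lexx orbT.
  by have := ub x y bp; rewrite lee_fin le_max => ->.
by exists 0 => // x y bp; have := ub x y bp; rewrite leeNy_eq.
Qed.

(** Growth at rate [eps / 4] is used twice against the decay [eps]: once to replace the norm of
    [delta x] by that of [delta y], which leaves decay [3 eps / 4], and once to sum over shells. *)
Lemma resolvent_kernel_exists z Rz M : l2_resolvent m G z Rz M ->
  exists C, resolvent_kernel m G z (op_kernel m Rz) C.
Proof.
move=> H; have [[d_ge0 d_sym d_refl d_tri] d_int] := d_intrinsic.
have d_intr x : sbd (fun y => edge_weight G x y * d x y ^+ 2) (m x).
  by apply/sbdP => // y; rewrite mulr_ge0 ?sqr_ge0// edge_weight_ge0.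
have [s s0 ds] := jump_bound.
have H' := l2_resolvent_conj m_gt0 H.
have adj f : l2 f -> exists2 q, lap (q, fun x => f x + z^* * q x) & n2 q <= M * n2 f.
  move=> f2; eexists; first exact: (lr_lap H' f2).
  exact: (lr_bdd H' f2).
have [eps e0 [C C0 ct]] := combes_thomas m_gt0 d_ge0 d_sym d_intr ds d_refl d_tri s0 (lr_ge0 H) adj.
have e40 : 0 < eps / 4 by rewrite divr_gt0.
have [C1 C10 gr] := growth e40.
have dlb : eps / 4 < eps - eps / 4 by lra.
have be0 : 0 <= eps - eps / 4 by lra.
have [C3 C30 shell] := shell_sum m_gt0 d_ge0 C10 dlb be0 gr.
have AK := l2_resolvent_operator m_gt0 H.
have sch : schur_kernel m (op_kernel m Rz) (C * (1 + C1) * C3).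
  split; [by rewrite !mulr_gt0// addr_gt0|exact: (op_kernel_sym m_gt0 AK)|move=> x].
  have mx := m_gt0 x.
  have c0 : 0 <= C * (1 + C1) / m x by rewrite divr_ge0 ?mulr_ge0 ?addr_ge0 ?(ltW C0) ?(ltW C10).
  have := sbdZ c0 (shell x).
  have -> : C * (1 + C1) / m x * (C3 * m x) = C * (1 + C1) * C3 by field; rewrite gt_eqF.
  apply: sbd_le => // y; have my := m_gt0 y.
  have := ct _ y x (lr_lap H (deltal2 x)); rewrite d_sym.
  have wx := n2_delta m_gt0 x; have wy := n2_delta m_gt0 y.
  have wx0 := n2_ge0 m (delta x); have wy0 := n2_ge0 m (delta y).
  (* The ball around [y] of radius [d x y] contains [x], so volume growth compares the masses of
     single points. *)
  have gx : m x <= C1 * expR (eps / 4 * d x y) * m y.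
    have := vol_sum (s := [:: x]) m_gt0 (gr y (d x y) (d_ge0 x y)) isT.
    rewrite big_seq1; apply => w; rewrite inE => /eqP ->.
    by rewrite /dball /= d_sym.
  have E1 : 1 <= expR (eps / 4 * d x y) by rewrite -[leLHS]expR0 ler_expR mulr_ge0// ltW.
  have wxy : n2 (delta x) <= (1 + C1) * expR (eps / 4 * d x y) * n2 (delta y).
    have B0 : 1 <= (1 + C1) * expR (eps / 4 * d x y).
      by rewrite -[leLHS]mulr1 ler_pM// lerDl ltW.
    rewrite -(ler_pXn2r (n := 2)) ?nnegrE ?mulr_ge0 ?addr_ge0 ?expR_ge0 ?(ltW C10)//.
    rewrite exprMn wx wy (le_trans gx)// ler_wpM2r ?(ltW my)//.
    have B1 : C1 * expR (eps / 4 * d x y) <= (1 + C1) * expR (eps / 4 * d x y).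
      by rewrite ler_wpM2r ?expR_ge0// lerDr.
    rewrite (le_trans B1)// expr2 ler_peMl// (le_trans ler01 B0)//.
  have -> : expR (- ((eps - eps / 4) * d x y)) = expR (- (eps * d x y)) * expR (eps / 4 * d x y).
    by rewrite -expRD; congr expR; ring.
  rewrite /op_kernel cmodM cmodV cmod_real (gtr0_norm mx).
  move: (cmod (Rz (delta x) y)) (cmod_ge0 (Rz (delta x) y)) => a a0 le.
  rewrite [leLHS]mulrAC [leRHS]mulrAC ler_wpM2r ?invr_ge0 ?(ltW mx)//.
  rewrite -wy expr2 mulrA.
  apply: (@le_trans _ _ (C * expR (- (eps * d x y)) * n2 (delta x) * n2 (delta y))).
    by rewrite mulrA ler_wpM2r.
  apply: (@le_trans _ _ (C * expR (- (eps * d x y)) * ((1 + C1) * expR (eps / 4 * d x y) * n2 (delta y)) * n2 (delta y))).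
    by rewrite ler_wpM2r// ler_wpM2l// mulr_ge0 ?expR_ge0 ?(ltW C0).
  rewrite le_eqVlt; apply/orP; left; apply/eqP; ring.
exists (C * (1 + C1) * C3); split=> //.
- by move=> phi p2; rewrite (kop_op_kernel m_gt0 AK sch p2); exact: (lr_lap H).
- exact: (lr_inj H).
Qed.

Variables (p : \bar R) (p1 : (1 <= p)%E).

Lemma l2_resolvent_set_sub z : resolvent_set m 2%:E lap z -> resolvent_set m p (laplacian m G p) z.
Proof.
move=> /(resolvent_setP G m_gt0 z).1 [Rz [M H]]; have [C kC] := resolvent_kernel_exists H.
exact: resolvent_kernel_lp p1 kC.
Qed.

Section RealPoint.
Variables (a M : R).
Hypothesis M0 : 0 < M.
Hypothesis aM : forall f g, laplacian m G p (f, g) ->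
  (lp_norm m p f <= M%:E * lp_norm m p (fun x => g x - a%:C * f x)%R)%E.

(** The Schur constant depends on [z] and serves only to make the l^p norm finite. As
    [(L - a) u = f + (z - a) u] and [|z - a| M <= 1/2], any bound [F] improves to [M N + F / 2];
    iterating leads to the fixed point [2 M N]. *)
Lemma nearby_bound z Rz M' f N : cmod (z - a%:C) * M <= 2^-1 -> l2_resolvent m G z Rz M' ->
  l2 f -> nb m p f N -> nb m p (Rz f) (2 * M * N).
Proof.
move=> za H f2 fN; have [C kC] := resolvent_kernel_exists H.
have AK := l2_resolvent_operator m_gt0 H; have sk := rk_schur kC.
have E := kop_op_kernel m_gt0 AK sk f2; set u := Rz f in E *.
have N0 := nb_ge0 fN.
have uC : nb m p u (C * N) by rewrite -E; exact: (nb_kop m_gt0 p1 sk fN).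
have L : laplacian m G p (u, fun x => f x + z * u x).
  apply/(laplacianP m_gt0 _ _ p1 kC); split.
  - by exists (C * N).
  - by exists (N + cmod z * (C * N)); apply: (nbD m_ge0 p1) => //; exact: (nbZ m_ge0 p1).
  - by rewrite (_ : (fun x => _ - _) = f)//; apply/funext => x; rewrite addrK.
have step F : nb m p u F -> nb m p u (M * N + F / 2).
  move=> uF; have F0 := nb_ge0 uF.
  have [_ le] := nbD m_ge0 p1 fN (nbZ m_ge0 p1 (z - a%:C) uF).
  have le2 := aM L.
  rewrite (_ : (fun x => f x + z * u x - _) = (fun x => f x + (z - a%:C) * u x)) in le2; last first.
    by apply/funext => x; ring.
  split; first by rewrite addr_ge0 ?divr_ge0 ?mulr_ge0 ?(ltW M0).
  apply: (le_trans le2); apply: (@le_trans _ _ (M%:E * (N + cmod (z - a%:C) * F)%:E)%E).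
    by rewrite lee_wpmul2l// lee_fin ltW.
  rewrite -EFinM lee_fin mulrDr lerD2l mulrA [M * _]mulrC [leRHS]mulrC ler_wpM2r//.
have iterate n : nb m p u (2 * M * N + C * N / 2 ^+ n).
  elim: n => [|n IH].
    apply: (nb_le m_ge0 p1 _ uC); rewrite expr0 divr1 lerDr !mulr_ge0//; exact: ltW.
  have := step _ IH; congr (nb _ _ _ _); rewrite exprS; field; exact: expf_neq0.
apply: nb_inf; first by rewrite !mulr_ge0// ltW.
move=> e e0; have CN : 0 < C * N + 1 by rewrite ltr_wpDl// mulr_ge0// ltW// (schur_gt0 sk).
have [n0 hn] := pow2_inv_small (divr_gt0 e0 CN).
apply: (nb_le m_ge0 p1 _ (iterate n0)); rewrite lerD2l.
have := hn n0 (leqnn _); rewrite natrX ler_pdivlMr// mulrC => le.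
apply: le_trans le; rewrite ler_wpM2r ?invr_ge0 ?exprn_ge0// lerDl//.
Qed.

(** [lax] is applied to [N = Rz' Rz], whose iterates on a finitely supported [f] grow in l^p at most
    like powers of [(2 M)^2]. Then [|Rz f|^2 = inner f (N f)] gives the factor [2 M]. *)
Lemma nearby_l2_bound z Rz M' phi : cmod (z - a%:C) * M <= 2^-1 -> l2_resolvent m G z Rz M' ->
  l2 phi -> n2 (Rz phi) <= 2 * M * n2 phi.
Proof.
move=> za H; have H' := l2_resolvent_conj m_gt0 H; set Rz' := (fun f x => _) in H'.
have za' : cmod (z^* - a%:C) * M <= 2^-1.
  rewrite (_ : z^* - a%:C = (z - a%:C)^*) ?cmod_conj//.
  have ac : (a%:C)^* = a%:C :> R[i] by exact: conj_realC.
  by rewrite [RHS]rmorphB; congr (_ - _).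
have Rl2 := op_l2 (l2_resolvent_operator m_gt0 H); have Rl2' := op_l2 (l2_resolvent_operator m_gt0 H').
pose N f := Rz' (Rz f).
have t0 : 0 < (2 * M) ^+ 2 by rewrite exprn_gt0// mulr_gt0.
have fin (s : seq X) phi0 : n2 (Rz (restr s phi0)) <= 2 * M * n2 (restr s phi0).
  set f := restr s phi0; have f2 : l2 f by apply: (l2_Cc m_ge0); exact: restr_Cc.
  have [L fL] := nb_restr m_ge0 p1 s phi0; rewrite -/f in fL.
  have iter2 j : l2 (iter j N f) /\ nb m p (iter j N f) (((2 * M) ^+ 2) ^+ j * L).
    elim: j => [|j [IH1 IH2]] /=; first by rewrite expr0 mul1r.
    split; first by apply: Rl2'; exact: Rl2.
    have := nearby_bound za' H' (Rl2 _ IH1) (nearby_bound za H IH1 IH2).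
    congr (nb _ _ _ _); rewrite (exprS _ j); move: (_ ^+ j) => q; ring.
  have [D hD] : exists D : X -> R, forall x, 0 <= D x /\ forall g Q, nb m p g Q -> cmod (g x) <= D x * Q.
    have /choice[D hD] : forall x, exists D : R, 0 <= D /\ forall g Q, nb m p g Q -> cmod (g x) <= D * Q.
      by move=> x; have [D D0 hD] := nb_pt m_ge0 p1 (m_gt0 x); exists D; split=> //; exact: ltW.
    by exists D.
  (* Pairing with [f] sees only values on its finite support, so bounded point evaluations turn the
     l^p growth into scalar growth, with no dual exponent involved. *)
  pose B := \sum_(x <- undup s) D x * L * cmod (f x) * m x.
  have bnd j : cmod (inner m (iter j N f) f) <= B * ((2 * M) ^+ 2) ^+ j.
    rewrite innerE; have [||_ ->] := csum_fin (F := fun x => iter j N f x * (f x)^* * (m x)%:C) (s := undup s).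
    - exact: undup_uniq.
    - by move=> x; rewrite mem_undup => xs; rewrite /f /restr (negPf xs) rmorph0 mulr0 mul0r.
    rewrite (le_trans (cmod_sum _ _))// /B mulr_suml; apply: ler_sum => x _.
    rewrite !cmodM cmod_conj cmod_real ger0_norm// [leRHS]mulrAC ler_wpM2r// [leRHS]mulrAC ler_wpM2r ?cmod_ge0//.
    have [_ h] := hD x; have [_ le] := iter2 j.
    by rewrite (le_trans (h _ _ le))// -mulrA [L * _]mulrC.
  have Nsym g h : l2 g -> l2 h -> inner m (N g) h = inner m g (N h).
    move=> g2 h2; rewrite /N -(lr_adj m_gt0 H H' g2 (Rl2 _ h2)).
    have H'' : l2_resolvent m G z^*^* Rz M' by rewrite conjCK.
    by rewrite (lr_adj m_gt0 H' H'' (Rl2 _ g2) h2).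
  have Nn := lax m_gt0 t0 f2 (fun _ w => Rl2' _ (Rl2 _ w)) Nsym bnd.
  have Rf2 := Rl2 _ f2.
  have sq : n2 (Rz f) ^+ 2 <= (2 * M * n2 f) ^+ 2.
    have := inner_n2 m_ge0 Rf2; rewrite (lr_adj m_gt0 H H' f2 Rf2) => /(congr1 (@cmod R)).
    rewrite cmod_real ger0_norm ?sqr_ge0// => <-.
    rewrite (le_trans (cmod_inner_n2 m_ge0 f2 (Rl2' _ Rf2)))// exprMn mulrC [n2 f ^+ 2]expr2 mulrA.
    by rewrite ler_wpM2r ?n2_ge0.
  by rewrite -(ler_pXn2r (n := 2)) ?nnegrE ?n2_ge0// !mulr_ge0 ?n2_ge0// ltW.
move=> p2; apply/ler_addgt0Pr => e e0.
(* The a priori bound [M'], which may depend on [z], is applied only to the small remainder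
   [phi - f] and does not enter the final constant. *)
have M'0 := lr_ge0 H; have c0 : 0 < 2 * M + M' by rewrite ltr_pwDl// mulr_gt0.
have r12 : 1 <= 2 :> R by rewrite ler1n.
have [s us hs] := nb_dens m_ge0 r12 (nb_n2 m_ge0 p2) (divr_gt0 e0 c0).
set f := restr s phi in hs.
have f2 : l2 f by apply: (l2_Cc m_ge0); exact: restr_Cc.
have d2 := l2B m_ge0 p2 f2.
have E : Rz phi = (fun x => Rz (fun x => phi x - f x) x + Rz f x).
  have := op_lin (l2_resolvent_operator m_gt0 H) 1 d2 f2.
  rewrite (_ : (fun x => 1 * _ + _) = phi) => [->|]; last by apply/funext => x; ring.
  by apply/funext => x; rewrite mul1r.
have h1 := n2D m_ge0 (Rl2 _ d2) (Rl2 _ f2).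
have h2 := lr_bdd H d2; have h3 := n2_le m_ge0 hs; have h4 := fin s phi.
have h5 : n2 f <= n2 phi by have [] := n2_mono m_ge0 (restr_le s phi) p2.
rewrite E (le_trans h1)// addrC lerD//.
  by rewrite (le_trans h4)// ler_wpM2l// mulr_ge0// ltW.
rewrite (le_trans h2)//; apply: (@le_trans _ _ ((2 * M + M') * (e / (2 * M + M')))).
  apply: ler_pM => //; first exact: n2_ge0.
  by rewrite lerDr mulr_ge0// ltW.
by rewrite mulrC divfK// gt_eqF.
Qed.

Lemma real_point : resolvent_set m 2%:E lap a%:C.
Proof.
(* [eps M = 1/4] meets the requirement of [nearby_bound]. It also turns
   [|f| <= 2 M (|(L - a) f| + eps |f|)] into an inequality whose last term is [|f| / 2], so that it
   is absorbed with constant [4 M]. *)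
pose eps := (4 * M)^-1; have e0 : 0 < eps by rewrite invr_gt0 mulr_gt0.
pose z := a +i* eps; have zr : resolvent_set m 2%:E lap z.
  by apply: (nonreal_resolvent G m_gt0); rewrite /= gt_eqF.
have [Rz [M' H]] := (resolvent_setP G m_gt0 z).1 zr.
have za : cmod (z - a%:C) = eps.
  have : cmod (z - a%:C) ^+ 2 = eps ^+ 2.
    by rewrite cmod_sqr /z /= subrr subr0 expr0n add0r.
  move=> /eqP; rewrite eqf_sqr => /orP[/eqP//|/eqP E].
  by have := cmod_ge0 (z - a%:C); rewrite E oppr_ge0 leNgt e0.
have eM : eps * M <= 2^-1.
  by rewrite /eps invfM -mulrA mulVf ?gt_eqF// mulr1 lef_pV2 ?posrE// ler_nat.
have bound f g : lap (f, g) -> n2 f <= 4 * M * n2 (fun x => g x - a%:C * f x).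
  move=> L; have [f2 g2] := lap_l2 m_gt0 L.
  have h2 := l2B m_ge0 g2 (l2Z m_ge0 z f2); have d2 := l2B m_ge0 g2 (l2Z m_ge0 a%:C f2).
  have Ef : f = Rz (fun x => g x - z * f x).
    by apply: (lr_uniq m_gt0 H h2); apply: lap_ext L => x //; rewrite subrK.
  have le1 : n2 f <= 2 * M * n2 (fun x => g x - z * f x).
    by rewrite {1}Ef; apply: (nearby_l2_bound _ H h2); rewrite za.
  have le2 : n2 (fun x => g x - z * f x) <= n2 (fun x => g x - a%:C * f x) + eps * n2 f.
    have := n2B m_ge0 d2 (l2Z m_ge0 (z - a%:C) f2); rewrite (n2Z m_ge0 _ f2) za.
    by rewrite (_ : (fun x => _ - _) = (fun x => g x - z * f x))//; apply/funext => x; ring.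
  have le3 := le_trans le1 (ler_wpM2l (ltac:(by rewrite mulr_ge0// ltW) : 0 <= 2 * M) le2).
  have eM4 : M * eps = 4^-1 by rewrite /eps invfM mulrCA mulfV ?gt_eqF// mulr1.
  have : 2 * M * (eps * n2 f) = 2^-1 * n2 f.
    have -> : 2 * M * (eps * n2 f) = 2 * (M * eps) * n2 f by ring.
    by rewrite eM4; field.
  move: le3; rewrite mulrDr => le3 E; rewrite E in le3.
  move: le3; rewrite -!mulrA; move: (n2 f) (M * _) => V S; lra.
apply: (resolvent_of_bound m_gt0 (c := 4 * M)) => //; first by rewrite mulr_ge0// ltW.
move=> f g L; have -> : (a%:C)^* = a%:C :> R[i] by exact: conj_realC.
exact: bound.
Qed.

End RealPoint.

Lemma lp_resolvent_set_sub z : resolvent_set m p (laplacian m G p) z -> resolvent_set m 2%:E lap z.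
Proof.
move=> [hz [M hM]]; have [z0|z0] := eqVneq (complex.Im z) 0; last exact: nonreal_resolvent.
have zE : z = (complex.Re z)%:C by apply/eqP; rewrite eq_complex /= z0 !eqxx.
rewrite zE; apply: (real_point (M := Num.max M 1)); first by rewrite lt_max ltr01 orbT.
move=> f g L; rewrite -zE.
(* Enlarging [M] to a positive constant needs a nonnegative norm on the right. For [p = +oo] the
   norm is a supremum over points, negative only when there is no point; any point [x] at which the
   left side is tested excludes this. *)
have [f0|f0] := leP 0%E (lp_norm m p (fun x => g x - z * f x)).
  by apply: le_trans (hM _ _ L) _; rewrite lee_wpmul2r// lee_fin le_max lexx.
case: p p1 f0 {hz hM L} => [r _|_ f0|//]; first by rewrite ltNge lp_norm_ge0.
apply: ge_ereal_sup => _ [x ->]; suff : (0 <= lp_norm m +oo (fun x => g x - z * f x)%R)%E by rewrite leNgt f0.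
by apply: le_trans (ereal_sup_ubound _); last (by exists x); rewrite lee_fin cmod_ge0.
Qed.

End Spectra.

Theorem theorem2p1 (R : realType) (X : countType) (m : X -> R)
    (G : graph R X) (d : X -> X -> R)
    (m_gt0 : forall x : X, (0 < m x)%R)
    (G_nbr : no_isolated_vertex G)
    (d_intrinsic : intrinsic_metric m G d)
    (d_jump : (jump_size G d < +oo)%E)
    (growth : uniform_subexponential_growth m d)
    (p : \bar R) (p_ge1 : (1 <= p)%E) :
  spectrum m p (laplacian m G p) = spectrum m 2%:E (laplacian2 m G).
Proof.
rewrite /spectrum; congr (~` _); apply/seteqP; split=> z.
  exact: (lp_resolvent_set_sub m_gt0 d_intrinsic d_jump growth p_ge1).
exact: (l2_resolvent_set_sub m_gt0 d_intrinsic d_jump growth p_ge1).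
Qed.
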